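(* Let $2\le a<b<c$ be pairwise relatively prime integers, let $\mathbf{r}=(ab,ac,bc)$, let $S(\mathbf{r})$ denote the generic semigroup adapted to $\mathbf{r}$, and assume $d\ge 2g(S(\mathbf{r}))$. Then the Severi variety $M^3_{d,g(S(\mathbf{r}));S(\mathbf{r}),\mathbf{r}}$ is excess-dimensional whenever $a\ge 4$.
   Context: We work over $\mathbb{C}$; $\mathbb{N}=\{0,1,2,\dots\}$. For a numerical semigroup $S$ (a submonoid of $\mathbb{N}$ with finite complement), the genus $g(S)$ is the cardinality of $\mathbb{N}\setminus S$. $v_t$ is the $t$-adic valuation on $\mathbb{C}[[t]]$. Generic semigroup adapted to $\mathbf{r}=(r_1,r_2,r_3)$ with $0<r_1<r_2<r_3$: let $f_i(t)=\sum_{n\ge r_i} a_{i,n}t^n\in\mathbb{C}[[t]]$ $(i=1,2,3)$ be power series with fixed nonzero lowest-order coefficients $a_{i,r_i}$ and generic higher-order coefficients, i.e. the coefficients $a_{i,n}$ with $n>r_i$, $i=1,2,3$, are algebraically independent over $\mathbb{Q}(a_{1,r_1},a_{2,r_2},a_{3,r_3})$. The generic semigroup adapted to $\mathbf{r}$ is $S(\mathbf{r})=\{v_t(G(f_1,f_2,f_3)) : G\in\mathbb{C}[x_1,x_2,x_3],\ G(f_1,f_2,f_3)\ne 0\}$. A cusp is a unibranch curve singularity, locally given by a ring map $\phi:\mathbb{C}[x_1,\dots,x_n]\to\mathbb{C}[[t]]$; its value semigroup is the set of $t$-adic valuations of the nonzero elements of the image of $\phi$. Its ramification profile is the increasing sequence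 $\mathbf{r}=(r_1,\dots,r_n)$ of vanishing orders, at the preimage of the cusp, of the parametrizing functions (after a linear change of coordinates so that these orders are strictly increasing). $M^n_d$ denotes the space of morphisms $\mathbb{P}^1\to\mathbb{P}^n$ of degree $d$. $M^n_{d,g;S,\mathbf{r}}\subset M^n_d$ denotes the (generalized) Severi variety of morphisms whose images are unicuspidal rational curves of arithmetic genus $g$, with cusp having value semigroup $S$ (with $g(S)=g$) and ramification profile $\mathbf{r}$. The variety $M^n_{d,g;S,\mathbf{r}}$ is called excess-dimensional if its codimension in $M^n_d$ is strictly less than $(n-2)g$; for $n=3$ this means codimension strictly less than $g$. *)

(* Defs.v *)
From HB Require Import structures.
From mathcomp Require Import all_boot all_order all_algebra.
From mathcomp Require Import complex finmap.
From mathcomp Require Import boolp classical_sets functions cardinality reals.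
From mathcomp Require Import mpoly.

Set Implicit Arguments.
Unset Strict Implicit.
Unset Printing Implicit Defensive.

Import GRing.Theory.

Local Open Scope ring_scope.
Local Open Scope classical_set_scope.

Record fps (R : Type) := FPS { fps_coef :> nat -> R }.

HB.instance Definition _ (R : Type) := gen_eqMixin (fps R).
HB.instance Definition _ (R : Type) := gen_choiceMixin (fps R).

Lemma fpsP (R : Type) (f g : fps R) : (forall n, f n = g n) -> f = g.
Proof. by case: f g => f [g] /= fg; congr FPS; apply: funext. Qed.

Section FpsRing.
Variable R : comNzRingType.
Implicit Types f g h : fps R.

Definition fps_zero : fps R := FPS (fun=> 0).
Definition fps_opp f : fps R := FPS (fun n => - f n).
Definition fps_add f g : fps R := FPS (fun n => f n + g n).
Definition fps_one : fps R := FPS (fun n => (n == 0%N)%:R).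
Definition fps_mul f g : fps R :=
  FPS (fun n => \sum_(i < n.+1) f i * g (n - i)%N).

Fact fps_addA : associative fps_add.
Proof. by move=> f g h; apply: fpsP => n /=; rewrite addrA. Qed.
Fact fps_addC : commutative fps_add.
Proof. by move=> f g; apply: fpsP => n /=; rewrite addrC. Qed.
Fact fps_add0 : left_id fps_zero fps_add.
Proof. by move=> f; apply: fpsP => n /=; rewrite add0r. Qed.
Fact fps_addN : left_inverse fps_zero fps_opp fps_add.
Proof. by move=> f; apply: fpsP => n /=; rewrite addNr. Qed.

HB.instance Definition _ :=
  GRing.isZmodule.Build (fps R) fps_addA fps_addC fps_add0 fps_addN.

Definition fps_trunc N f : {poly R} := \poly_(i < N) f i.

Fact coef_fps_trunc_mul N f g k : (k < N)%N ->
  (fps_trunc N f * fps_trunc N g)`_k = fps_mul f g k.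
Proof.
move=> kN; rewrite coefM; apply: eq_bigr => i _; rewrite !coef_poly.
by rewrite (leq_ltn_trans (leq_subr _ _) kN) (leq_ltn_trans _ kN) // -ltnS.
Qed.

Fact fps_mulA : associative fps_mul.
Proof.
move=> f g h; apply: fpsP => n.
transitivity
  ((fps_trunc n.+1 f * (fps_trunc n.+1 g * fps_trunc n.+1 h))`_n).
  rewrite coefM; apply: eq_bigr => i _; rewrite coef_poly ltn_ord.
  by rewrite coef_fps_trunc_mul // ltnS leq_subr.
rewrite mulrA coefM; apply: eq_bigr => i _.
by rewrite coef_fps_trunc_mul ?ltn_ord // coef_poly ltnS leq_subr.
Qed.

Fact fps_mulC : commutative fps_mul.
Proof.
by move=> f g; apply: fpsP => n; rewrite -!(@coef_fps_trunc_mul n.+1) // mulrC.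
Qed.

Fact fps_mul1 : left_id fps_one fps_mul.
Proof.
move=> f; apply: fpsP => n /=.
by rewrite big_ord_recl /= mul1r subn0 big1 ?addr0 // => i _; rewrite mul0r.
Qed.

Fact fps_mulD : left_distributive fps_mul fps_add.
Proof.
move=> f g h; apply: fpsP => n /=; rewrite -big_split /=.
by apply: eq_bigr => i _; rewrite mulrDl.
Qed.

Fact fps_oner_neq0 : fps_one != fps_zero.
Proof.
by apply/eqP => /(congr1 (fun f : fps R => f 0%N)) /eqP; rewrite oner_eq0.
Qed.

HB.instance Definition _ := GRing.Zmodule_isComNzRing.Build (fps R)
  fps_mulA fps_mulC fps_mul1 fps_mulD fps_oner_neq0.

Definition fps_of_poly (P : {poly R}) : fps R := FPS (fun k => P`_k).

(* [v_t f = k]; in particular [f != 0] *)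
Definition fps_val f (k : nat) : Prop :=
  f k <> 0 /\ forall i, (i < k)%N -> f i = 0.

Definition fps_eval n (f : 'I_n -> fps R) (G : {mpoly R[n]}) : fps R :=
  mmap (fun c : R => fps_of_poly c%:P) f G.

Definition value_semigroup n (f : 'I_n -> fps R) : set nat :=
  [set k | exists G : {mpoly R[n]}, fps_val (fps_eval f G) k].

End FpsRing.

Definition numerical_semigroup (S : set nat) : Prop :=
  [/\ S 0%N, forall x y, S x -> S y -> S (x + y)%N & finite_set (~` S)].

(* [fset_set] returns the empty set on infinite sets, so this is the genus only
   for sets with finite complement. *)
Definition genus (S : set nat) : nat := #|` fset_set (~` S)|%fset.

Definition subfield_generated (K : fieldType) (A : set K) : set K :=
  [set z | forall L : {pred K}, GRing.divring_closed L ->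
    (forall a, A a -> a \in L) -> z \in L].

Definition alg_independent (K : fieldType) (k : set K) (J : Type) (x : J -> K) :
    Prop :=
  forall (m : nat) (s : 'I_m -> J), injective s ->
  forall P : {mpoly K[m]}, (forall mon, k P@_mon) ->
  P.@[fun i => x (s i)] = 0 -> P = 0.

Definition generic_adapted (K : fieldType) n (r : n.-tuple nat)
    (f : 'I_n -> fps K) : Prop :=
  (forall i, fps_val (f i) (tnth r i)) /\
  alg_independent (subfield_generated [set f i (tnth r i) | i in [set: 'I_n]])
    (fun j : {j : 'I_n * nat | (tnth r j.1 < j.2)%N} =>
       f (val j).1 (val j).2).

Definition generic_semigroup (K : fieldType) n (r : n.-tuple nat)
    (S : set nat) : Prop :=
  exists2 f : 'I_n -> fps K, generic_adapted r f & S = value_semigroup f.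

(** Points of a projective space are represented by nonzero vectors. A matrix
    [F : 'M[K]_(n.+1, d.+1)] stands for the [n.+1] binary forms
    [F_i(u, v) = \sum_j F i j u^j v^(d-j)]; a morphism of degree [d] is such a
    matrix whose forms have no common zero, up to a nonzero scalar, i.e. a
    point of an open subset of the projective space of matrices. Sets of
    morphisms are represented by sets of matrices stable under nonzero
    scalars. *)

Section Curves.
Variable K : fieldType.

Definition same_point m (x y : 'cV[K]_m) : Prop := exists2 c, c != 0 & y = c *: x.

Definition veronese (A : comNzRingType) d (u v : A) : 'cV[A]_d.+1 :=
  \col_j (u ^+ j * v ^+ (d - j)).

Section Morphism.
Variables n d : nat.
Implicit Types (F : 'M[K]_(n.+1, d.+1)) (p q : 'cV[K]_2).

Definition mor_eval F p : 'cV[K]_n.+1 := F *m veronese d (p 0 0) (p 1 0).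

Definition morphisms : set 'M[K]_(n.+1, d.+1) :=
  [set F | forall p, p != 0 -> mor_eval F p != 0].

(* the forms of [F] along the line [t |-> p + t q]; when [p] and [q] are
   independent, [t] is a local parameter of the projective line at [p] *)
Definition expand F p q : 'cV[fps K]_n.+1 :=
  let l i := (p i 0)%:P + q i 0 *: 'X in
  map_mx (@fps_of_poly K) (map_mx polyC F *m veronese d (l 0) (l 1)).

(* [x] is the local parametrization at [p], with values in K[[t]], of affine
   coordinates of the target centered at the image of [p]: after the linear
   change of coordinates [A], [x_i] is the quotient of the form number [i + 1]
   by the form number [0]. *)
Definition local_param F p (x : 'I_n -> fps K) : Prop :=
  exists (A : 'M[K]_n.+1) (q : 'cV[K]_2),
    let y := expand (A *m F) p q in
    [/\ A \in unitmx, row_mx p q \in unitmx, y 0 0 0%N != 0 &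
        forall i, x i 0%N = 0 /\ x i * y 0 0 = y (lift ord0 i) 0].

(* The local ring of the branch at [p] is regular iff it has an element of
   valuation [1]. *)
Definition smooth_branch F p : Prop :=
  exists2 x, local_param F p x & value_semigroup x 1%N.

(* The image has a unique singular point, the image of [p], and all its points
   are unibranch; injectivity also makes the morphism birational onto its image
   in characteristic zero. *)
Definition unicuspidal F p : Prop :=
  [/\ forall q q', q != 0 -> q' != 0 ->
        same_point (mor_eval F q) (mor_eval F q') -> same_point q q',
      forall q, q != 0 -> ~ same_point p q -> smooth_branch F q &
      ~ smooth_branch F p].

(* Dimension of the degree [m] part of the homogeneous coordinate ring of the
   image, i.e. of the span of the products of [m] of the forms, written as
   polynomials in [u] after setting [v = 1]. *)
Definition hilbert_function F (m : nat) : nat :=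
  \rank (\matrix_(s < #|{ffun 'I_m -> 'I_n.+1}|)
    (poly_rV (\prod_(k < m) rVpoly (row (enum_val s k) F)) :
       'rV[K]_(m * d).+1)).

(* The Hilbert polynomial of the image is [e X + 1 - g]. *)
Definition arithmetic_genus F (g : nat) : Prop :=
  exists e m0, forall m, (m0 <= m)%N ->
    (hilbert_function F m + g = e * m + 1)%N.

Definition severi (g : nat) (S : set nat) (r : n.-tuple nat) :
    set 'M[K]_(n.+1, d.+1) :=
  [set F | [/\ numerical_semigroup S, genus S = g, sorted ltn r, morphisms F &
    exists2 p, p != 0 &
      [/\ unicuspidal F p, arithmetic_genus F g &
          exists x, [/\ local_param F p x,
                        forall i, fps_val (x i) (tnth r i) &
                        value_semigroup x = S]]]].

End Morphism.

Section Zariski.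
Variables m n : nat.
Implicit Types X Z : set 'M[K]_(m, n).

(* Closed subsets for the topology induced on [X] by the Zariski topology of the
   projective space of matrices, whence the homogeneity of the equations. *)
Definition zclosed_in X Z : Prop :=
  exists2 I : set {mpoly K[(m * n)%N]},
    forall P, I P -> exists k, P \is k.-homog &
    Z = [set F | X F /\ forall P, I P -> P.@[fun k => mxvec F 0 k] = 0].

Definition zirreducible_in X Z : Prop :=
  Z !=set0 /\
  forall Z1 Z2, zclosed_in X Z1 -> zclosed_in X Z2 ->
    Z `<=` Z1 `|` Z2 -> Z `<=` Z1 \/ Z `<=` Z2.

Definition zchain X (k : nat) : Prop :=
  exists Z : nat -> set 'M[K]_(m, n),
    (forall i, (i <= k)%N -> zclosed_in X (Z i) /\ zirreducible_in X (Z i)) /\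
    (forall i, (i < k)%N -> Z i `<` Z i.+1).

Definition zdim X (k : nat) : Prop :=
  zchain X k /\ forall l, zchain X l -> (l <= k)%N.

(* [X] is meant to be irreducible; an empty [Z] has no codimension. *)
Definition zcodim X Z (c : nat) : Prop :=
  exists k l, [/\ zdim X k, zdim Z l & k = (l + c)%N].

End Zariski.

Definition excess_dimensional n d (g : nat) (S : set nat) (r : n.-tuple nat) :
    Prop :=
  exists2 c, zcodim (@morphisms n d) (@severi n d g S r) c &
             (c < (n - 2) * g)%N.

End Curves.

(* Main.v *)
Require Import Defs.
From HB Require Import structures.
From mathcomp Require Import all_boot all_order all_algebra.
From mathcomp Require Import complex finmap.
From mathcomp Require Import boolp classical_sets cardinality reals.
From mathcomp Require Import mpoly.
From mathcomp Require Import zify ring.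

(** Fix the cusp at [(0 : 1)] and the flag in the target. The matrices [F] whose
    last three forms vanish at the cusp to orders at least [a * b], [a * c] and
    [b * c] form a linear space of codimension [a * b + a * c + b * c]. A
    nonempty open part of it lies in the Severi variety, whose codimension is
    therefore at most [a * b + a * c + b * c]. On the other hand the genus of
    [S] is larger than this number when [4 <= a]: a value below [a * b * c]
    needs a monomial of weight below [a * b * c] in the three series, and the
    lattice points of a tetrahedron bound the number of these ([tetra_lt],
    [genus_lower_bound]).

    Curves in the open part. Let [F] have the right orders at the cusp. Its
    branch there has, below any bound, at most as many values as the generic
    semigroup [S]: the number of values is the rank of a matrix of truncated
    monomials, whose minors are polynomials in the coefficients of the
    parametrization ([cnt_value_semigroup_generic]). If, conversely, the
    products of [m] forms of [F] realize at the cusp as many orders as [S] has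
    elements, then the value semigroup is [S], and these products span every
    form of degree [m * d] that vanishes at the cusp to the order of the
    conductor. This single condition yields the Hilbert polynomial, the
    injectivity of the morphism and its smoothness outside the cusp, that is,
    membership in the Severi variety ([severi_cusp]). It is a condition on the
    rank of matrices, hence open ([open_curves_open]).

    Existence. The open part must contain one curve, obtained from the generic
    series [f] by truncation ([good_curve]). The truncated coordinates are given
    top coefficients in degrees [d] and [d - 1], chosen so that the affine
    coordinate ring contains a power of the ideal of the cusp: two coordinates
    of consecutive degrees generate a subalgebra of finite codimension, and the
    third one separates the finitely many bad points left. The value semigroup
    is not affected, because monomials of large weight are products and depend
    on fewer coefficients than their order suggests ([value_jets]). The
    condition [2 * genus S <= d] enters here.

    Dimension. Codimension is defined by chains of irreducible closed sets.
    Slicing the open part by a flag of linear subspaces gives a chain of the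
    expected length in the Severi variety ([zchain_open]); no chain of matrices
    is longer than the dimension of the projective space, as each step raises
    the order of growth of the Hilbert function ([zchain_bound],
    [zcodim_le]). *)

Set Implicit Arguments.
Unset Strict Implicit.
Unset Printing Implicit Defensive.

Import Order.TTheory GRing.Theory Num.Theory.

Local Open Scope ring_scope.
Local Open Scope classical_set_scope.

(** * Lattice points in a tetrahedron *)

(** Each term that counts accounts for [m] units of [M - w], except that the
    last one may exceed it by at most [m - 1]. *)
Lemma sum_ltn_bound n m w M : (0 < m)%N ->
  (m * (\sum_(x < n) (x * m + w < M)) <= (M - w) + (m - 1) * (w < M))%N.
Proof.
move=> m0; elim: n w => [|n IH] w; first by rewrite big_ord0 muln0.
rewrite big_ord_recl /= mul0n add0n.
rewrite (eq_bigr (fun i : 'I_n => nat_of_bool (i * m + (w + m) < M)%N)); last first.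
  by move=> i _; congr nat_of_bool; rewrite /bump /=; lia.
have := IH (w + m)%N; set s := (\sum_(i < n) _)%N; move: s => s.
rewrite mulnDr; move: (ltnP w M) (ltnP (w + m) M) => [h1|h1] [h2|h2] /=; nia.
Qed.

(** The bound telescopes: lowering [L] by [a] lowers [(2 * L + a) ^ 2] by
    [8 * a * L]. *)
Lemma sum_subn_bound n a L :
  (8 * a * (\sum_(y < n) (L - a * y)) <= (2 * L + a) ^ 2)%N.
Proof.
elim: n L => [|n IH] L; first by rewrite big_ord0 muln0.
rewrite big_ord_recl muln0 subn0.
rewrite (eq_bigr (fun y : 'I_n => ((L - a) - a * y)%N)); last first.
  by move=> i _; rewrite /bump /= mulnDr muln1 subnDA.
have := IH (L - a)%N; set s := (\sum_(i < n) _)%N => Hs.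
have [h|h] := leqP a L.
  move: s Hs => s; rewrite -{2 3}(subnKC h); move: (L - a)%N => k Hs.
  have -> : ((2 * (a + k) + a) ^ 2 = 8 * a * (a + k) + (2 * k + a) ^ 2)%N by ring.
  by rewrite mulnDr leq_add2l.
have s0 : s = 0%N by rewrite /s big1 // => i _; rewrite (eqP (ltnW h)) sub0n.
rewrite s0 addn0; have [+ _] := nat_AGM2 (2 * L) a.
by apply: leq_trans; apply/eq_leq; ring.
Qed.

Lemma sum_sqr_closed n a b :
  (3 * \sum_(z < n) (2 * (b * (n - z)) + a) ^ 2 =
   2 * b ^ 2 * n * n.+1 * (2 * n).+1 + 6 * a * b * n * n.+1 + 3 * a ^ 2 * n)%N.
Proof.
elim: n => [|n IH]; first by rewrite big_ord0; lia.
rewrite big_ord_recl subn0.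
under eq_bigr => i _ do rewrite /bump /= subSS.
by rewrite mulnDr IH; ring.
Qed.

Lemma sum_lin_closed n e b :
  (2 * \sum_(z < n) (b * (n - z) + e) = b * n * n.+1 + 2 * e * n)%N.
Proof.
elim: n => [|n IH]; first by rewrite big_ord0; lia.
rewrite big_ord_recl subn0.
under eq_bigr => i _ do rewrite /bump /= subSS.
by rewrite mulnDr IH; ring.
Qed.

(** The number of lattice points of the half-open simplex
    [x / c + y / b + z / a < 1] in the first octant. *)
Definition tetra a b c : nat :=
  (\sum_(z < a) \sum_(y < b) \sum_(x < c)
     (x * (a * b) + (y * (a * c) + z * (b * c)) < a * b * c))%N.

(** The leading term is the volume [a * b * c / 6] of the simplex; the other
    terms come from rounding in the summation over each coordinate in turn. *)
Lemma tetra_bound a b c : (0 < a)%N -> (0 < b)%N -> (0 < c)%N ->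
  (24 * (a * b * tetra a b c) <=
   c * (2 * b ^ 2 * a.+1 * (2 * a).+1 + 6 * a * b * a.+1 + 3 * a ^ 2) +
   12 * (a * b - 1) * (b * a.+1 + 2 * (a - 1)))%N.
Proof.
move=> a0 b0 c0; have m0 : (0 < a * b)%N by rewrite muln_gt0 a0.
set L := fun z => (b * (a - z))%N.
have H1 : (a * b * tetra a b c <=
  \sum_(z < a) \sum_(y < b)
    (c * (L z - a * y) + (a * b - 1) * (y * a + 0 < L z)))%N.
  rewrite /tetra big_distrr /=; apply: leq_sum => z _.
  rewrite big_distrr /=; apply: leq_sum => y _.
  apply: leq_trans (sum_ltn_bound _ _ _ m0) _; have := ltn_ord z; rewrite /L.
  move: (nat_of_ord z) (nat_of_ord y) => z' y' zl.
  have -> : (a * b * c = c * (b * (a - z')) + z' * (b * c))%N.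
    by rewrite -{1}(subnKC (ltnW zl)); ring.
  rewrite subnDr ltn_add2r; have -> : (y' * (a * c) = c * (a * y'))%N by ring.
  by rewrite -mulnBr ltn_pmul2l // addn0 (mulnC a).
pose S1 := (\sum_(z < a) \sum_(y < b) (L z - a * y))%N.
pose M := (\sum_(z < a) \sum_(y < b) (y * a + 0 < L z))%N.
have H2 : (a * b * tetra a b c <= c * S1 + (a * b - 1) * M)%N.
  apply: leq_trans H1 _; rewrite /S1 /M !big_distrr -big_split /=.
  by apply: leq_sum => z _; rewrite !big_distrr -big_split.
have H3 : (24 * S1 <= 2 * b ^ 2 * a.+1 * (2 * a).+1 + 6 * a * b * a.+1 + 3 * a ^ 2)%N.
  rewrite -(leq_pmul2l a0).
  have -> : (a * (24 * S1) = 3 * (8 * a * S1))%N by ring.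
  apply: (@leq_trans (3 * \sum_(z < a) (2 * (b * (a - z)) + a) ^ 2)%N).
    rewrite leq_mul2l /S1 big_distrr /=; apply: leq_sum => z _.
    exact: sum_subn_bound.
  by rewrite sum_sqr_closed; apply/eq_leq; ring.
have H4 : (2 * M <= b * a.+1 + 2 * (a - 1))%N.
  rewrite -(leq_pmul2l a0).
  have -> : (a * (2 * M) = 2 * (a * M))%N by ring.
  apply: (@leq_trans (2 * \sum_(z < a) (b * (a - z) + (a - 1)))%N).
    rewrite leq_mul2l /M big_distrr /=; apply: leq_sum => z _.
    apply: leq_trans (sum_ltn_bound _ _ _ a0) _.
    rewrite subn0 leq_add2l -{2}[(a - 1)%N]muln1 leq_mul2l; apply/orP; right.
    by case: ltnP.
  by rewrite sum_lin_closed; apply/eq_leq; ring.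
apply: (@leq_trans (24 * (c * S1 + (a * b - 1) * M))%N); first by rewrite leq_mul2l.
rewrite mulnDr; apply: leq_add.
  by rewrite mulnCA leq_mul2l H3 orbT.
have -> : (24 * ((a * b - 1) * M) = 12 * (a * b - 1) * (2 * M))%N by ring.
by rewrite leq_mul2l H4 orbT.
Qed.

(** Most of the box of volume [a * b * c] lies outside the simplex, which leaves
    room for [a * b + a * c + b * c] as soon as [4 <= a]. After multiplication
    by [24 * a * b] this is an inequality between polynomials, checked by
    expanding it around the smallest triples. For [a = 4] the estimate fails at
    [(4, 5, 6)], which is not a coprime triple. *)
Lemma tetra_lt a b c : (4 <= a)%N -> (a < b)%N -> (b < c)%N ->
  coprime a b -> coprime a c ->
  (tetra a b c + (a * b + a * c + b * c) < a * b * c)%N.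
Proof.
move=> a4 ab bc cab cac.
have := @tetra_bound a b c ltac:(lia) ltac:(lia) ltac:(lia).
set T := tetra a b c; move: T => T HT.
have m0 : (0 < 24 * (a * b))%N by lia.
rewrite -(ltn_pmul2l m0) mulnDr -(mulnA 24 _ T).
apply: leq_ltn_trans (leq_add HT (leqnn _)) _ => {HT}.
have [a5|a5] := ltnP 4 a.
  (* In terms of the increments [s], [t], [u] the two sides differ by a
     polynomial with nonnegative coefficients, written out below. *)
  have [s as_] : exists s, a = (5 + s)%N by exists (a - 5)%N; lia.
  have [t bt] : exists t, b = (6 + s + t)%N by exists (b - a - 1)%N; lia.
  have [u cu] : exists u, c = (7 + s + t + u)%N by exists (c - b - 1)%N; lia.
  have -> : (a * b - 1 = 29 + 11 * s + 5 * t + s * s + s * t)%N by subst a b; nia.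
  have -> : (a - 1 = 4 + s)%N by lia.
  apply: (@leq_trans (_ + (20 * s * s * s * s * s + 484 * s * s * s * s +
      60 * s * s * s * s * t + 20 * s * s * s * s * u + 4451 * s * s * s +
      1138 * s * s * s * t + 380 * s * s * s * u + 60 * s * s * s * t * t +
      40 * s * s * s * t * u + 18915 * s * s + 7699 * s * s * t + 2619 * s * s * u +
      824 * s * s * t * t + 550 * s * s * t * u + 34803 * s + 21468 * s * t +
      7650 * s * u + 3596 * s * t * t + 2430 * s * t * u + 20 * s * s * t * t * t +
      20 * s * s * t * t * u + 170 * s * t * t * t + 170 * s * t * t * u + 17498 +
      19617 * t + 7773 * u + 4872 * t * t + 3396 * t * u + 348 * t * t * t +
      348 * t * t * u))%N); first exact: leq_addr.
  by apply/eq_leq; subst; ring.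
have a_4 : a = 4%N by lia.
have b5 : (b = 5)%N \/ (7 <= b)%N.
  have : b <> 6%N by move=> b6; move: cab; rewrite a_4 b6.
  lia.
case: b5 => b5.
  have : c <> 6%N by move=> c6; move: cac; rewrite a_4 c6.
  by rewrite a_4 b5; lia.
have [t bt] : exists t, b = (7 + t)%N by exists (b - 7)%N; lia.
have [u cu] : exists u, c = (8 + t + u)%N by exists (c - b - 1)%N; lia.
have -> : (a * b - 1 = 27 + 4 * t)%N by lia.
have -> : (a - 1 = 3)%N by lia.
apply: (@leq_trans (_ + (198 * t * t * t + 3228 * t * t + 198 * t * t * u + 15306 * t
    + 2268 * t * u + 16907 + 6126 * u))%N); first exact: leq_addr.
by apply/eq_leq; subst; ring.
Qed.

(** * Orders of vanishing as ranks *)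

Definition cnt (S : set nat) (k : nat) : nat := (\sum_(j < k) `[< S j >])%N.

Lemma cnt0 (S : set nat) : cnt S 0 = 0%N.
Proof. exact: big_ord0. Qed.

Lemma cnt_subset (S S' : set nat) k : (forall j, (j < k)%N -> S j -> S' j) ->
  (cnt S k <= cnt S' k)%N.
Proof.
move=> SS; apply: leq_sum => j _; case: asboolP => // Sj.
by case: asboolP => // -[]; exact: SS.
Qed.

Lemma eq_cnt (S S' : set nat) k : (forall j, (j < k)%N -> S j <-> S' j) ->
  cnt S k = cnt S' k.
Proof.
by move=> SS; apply/eqP; rewrite eqn_leq !cnt_subset // => j /SS[].
Qed.

Definition pval (K : fieldType) (P : {poly K}) (j : nat) : Prop :=
  P`_j != 0 /\ forall i, (i < j)%N -> P`_i = 0.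

Definition leads (K : fieldType) p n (M : 'M[K]_(p, n)) : set nat :=
  fun j => exists2 v : 'rV_n, (v <= M)%MS & pval (rVpoly v) j.

Lemma mul_pid_coef (K : fieldType) p n (M : 'M[K]_(p, n)) k i j :
  (M *m (pid_mx k : 'M_n)) i j = if (j < k)%N then M i j else 0.
Proof.
rewrite mxE (bigD1 j) //= big1 ?addr0 => [|l lj].
  by rewrite mxE eqxx; case: ifP; rewrite (mulr1, mulr0).
by rewrite mxE (negPf (_ : (l != j :> nat))) ?mulr0 // -val_eqE.
Qed.

Lemma sub_pid_ker (K : fieldType) p n (M : 'M[K]_(p, n)) (v : 'rV_n) k :
  reflect ((v <= M)%MS /\ forall i, (i < k)%N -> (rVpoly v)`_i = 0)
    (v <= M :&: kermx (pid_mx k : 'M_n))%MS.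
Proof.
rewrite sub_capmx; apply: (iffP andP) => -[vM]; last first.
  move=> v0; split=> //; apply/sub_kermxP/rowP => j; rewrite mul_pid_coef mxE.
  by case: ifP => // jk; rewrite -coef_rVpoly_ord v0.
move/sub_kermxP => vk; split=> // i ik; rewrite coef_rVpoly; case: insubP => //= j _ ji.
have := congr1 (fun w : 'rV_n => w 0 j) vk; rewrite mul_pid_coef ji ik.
by rewrite mxE.
Qed.

(** From [k] to [k + 1] columns the rank grows exactly when some combination of
    the rows starts at the column [k]. The orders of vanishing of the
    combinations of rows are thus encoded in ranks, which minors control. *)
Lemma rank_pid_leads (K : fieldType) p n (M : 'M[K]_(p, n)) k : (k <= n)%N ->
  \rank (M *m (pid_mx k : 'M_n)) = cnt (leads M) k.
Proof.
pose E k := (M :&: kermx (pid_mx k : 'M_n))%MS.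
have rE l : (\rank (M *m (pid_mx l : 'M_n)) + \rank (E l) = \rank M)%N.
  exact: mxrank_mul_ker.
elim: k => [|k IH] kn.
  by rewrite /cnt big_ord0 pid_mx_0 mulmx0 mxrank0.
rewrite /cnt big_ord_recr /= -/(cnt _ k) -IH ?(ltnW kn) //.
pose i0 := Ordinal kn; pose B : 'cV[K]_n := delta_mx i0 0.
have coefB (v : 'rV_n) : v *m B = 0 <-> (rVpoly v)`_k = 0.
  rewrite -colE -[k]/(val i0) coef_rVpoly_ord; split=> [/colP /(_ 0)|v0].
    by rewrite !mxE.
  by apply/colP => a; rewrite !mxE ord1.
have EkB : (E k :&: kermx B :=: E k.+1)%MS.
  apply/eqmxP/andP; split; apply/rV_subP => v.
    rewrite sub_capmx => /andP[/sub_pid_ker[vM vk] /sub_kermxP /coefB vB].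
    apply/sub_pid_ker; split=> // i; rewrite ltnS leq_eqVlt => /predU1P[->//|].
    exact: vk.
  move=> /sub_pid_ker[vM vk]; rewrite sub_capmx; apply/andP; split.
    by apply/sub_pid_ker; split=> // i ik; apply: vk; apply: ltnW.
  by apply/sub_kermxP/coefB/vk.
have rB : \rank (E k *m B) = `[< leads M k >].
  case: asboolP => [[v vM [vk v0]]|nL].
    apply/eqP; rewrite eqn_leq rank_leq_col lt0n mxrank_eq0.
    apply: contra_neq vk => EB0; apply/coefB.
    have /submxP[D ->] : (v <= E k)%MS by apply/sub_pid_ker.
    by rewrite -mulmxA EB0 mulmx0.
  apply/eqP; rewrite mxrank_eq0; apply/eqP/row_matrixP => i.
  rewrite row_mul row0; apply/coefB/eqP/negP => /negP vk; apply: nL.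
  have /sub_pid_ker[vM v0] : (row i (E k) <= E k)%MS by apply: row_sub.
  by exists (row i (E k)).
have := mxrank_mul_ker (E k) B; rewrite EkB rB.
have := rE k; have := rE k.+1; lia.
Qed.

Lemma rank_leads (K : fieldType) p n (M : 'M[K]_(p, n)) :
  \rank M = cnt (leads M) n.
Proof. by rewrite -rank_pid_leads // pid_mx_1 mulmx1. Qed.

(** Cofiniteness, witnessed by a polynomial so that intersections are
    products. *)
Definition cofin (K : fieldType) (P : K -> Prop) : Prop :=
  exists2 p : {poly K}, p != 0 & forall x, p.[x] != 0 -> P x.

Lemma cofinW (K : fieldType) (P Q : K -> Prop) :
  (forall x, P x -> Q x) -> cofin P -> cofin Q.
Proof. by move=> PQ [p p0 pP]; exists p => // x /pP/PQ. Qed.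

Lemma cofinT (K : fieldType) (P : K -> Prop) : (forall x, P x) -> cofin P.
Proof. by move=> PT; exists 1; rewrite ?oner_neq0. Qed.

Lemma cofin_and (K : fieldType) (P Q : K -> Prop) :
  cofin P -> cofin Q -> cofin (fun x => P x /\ Q x).
Proof.
move=> [p p0 pP] [q q0 qQ]; exists (p * q); first by rewrite mulf_neq0.
by move=> x; rewrite hornerM mulf_eq0 negb_or => /andP[/pP ? /qQ].
Qed.

Lemma cofin_seq (K : fieldType) (T : eqType) (s : seq T) (P : T -> K -> Prop) :
  (forall t, t \in s -> cofin (P t)) -> cofin (fun x => forall t, t \in s -> P t x).
Proof.
elim: s => [|t s IH] Ps; first exact: cofinT.
have /cofin_and := Ps t (mem_head _ _).
have /[swap]/[apply] : cofin (fun x => forall t, t \in s -> P t x).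
  by apply: IH => u us; apply: Ps; rewrite inE us orbT.
apply: cofinW => x [Pt Psx] u; rewrite inE => /predU1P[->//|]; exact: Psx.
Qed.

Lemma cofin_fin (K : fieldType) (T : finType) (P : T -> K -> Prop) :
  (forall t, cofin (P t)) -> cofin (fun x => forall t, P t x).
Proof.
move=> Pt; have := @cofin_seq K T (enum T) P (fun t _ => Pt t).
by apply: cofinW => x Px t; apply: Px; rewrite mem_enum.
Qed.

Lemma cofin_ex (K : numFieldType) (P : K -> Prop) : cofin P -> exists x, P x.
Proof.
case=> p p0 pP; apply: contrapT => nP; pose s := [seq i%:R : K | i <- iota 0 (size p)].
suff : (size s < size p)%N by rewrite size_map size_iota ltnn.
apply: max_poly_roots => //.
  apply/allP => _ /mapP[i _ ->]; rewrite /root; apply/negP => /negP pi.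
  by apply: nP; exists i%:R; apply: pP.
rewrite map_inj_uniq ?iota_uniq // => i j /eqP.
by rewrite eqr_nat => /eqP.
Qed.

(** A minor that is nonzero at [x0], taken after the changes of bases that
    normalize the matrix at [x0], is a nonzero polynomial in the parameter. *)
Lemma rank_open (K : fieldType) p n (M : 'M[{poly K}]_(p, n)) (x0 : K) :
  cofin (fun x => \rank (map_mx (horner_eval x0) M) <=
                  \rank (map_mx (horner_eval x) M))%N.
Proof.
set A := map_mx (horner_eval x0) M; set r := \rank A.
have rp : (r <= p)%N by apply: rank_leq_row.
have rn : (r <= n)%N by apply: rank_leq_col.
pose L : 'M[K]_(r, p) := pid_mx r *m invmx (col_ebase A).
pose R : 'M[K]_(n, r) := invmx (row_ebase A) *m pid_mx r.
have LAR : L *m A *m R = 1%:M.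
  transitivity (L *m (col_ebase A *m pid_mx r *m row_ebase A) *m R).
    by rewrite mulmx_ebase.
  rewrite /L /R !mulmxA.
  rewrite mulmxKV ?col_ebase_unit // mulmxK ?row_ebase_unit //.
  by rewrite pid_mx_id // pid_mx_id // pid_mx_1.
pose D := map_mx polyC L *m M *m map_mx polyC R.
have Dx x : map_mx (horner_eval x) D = L *m map_mx (horner_eval x) M *m R.
  have hC a b (N : 'M[K]_(a, b)) : map_mx (horner_eval x) (map_mx polyC N) = N.
    by apply/matrixP => i j; rewrite !mxE /horner_eval hornerC.
  by rewrite !map_mxM !hC.
exists (\det D) => [|x].
  apply: contra_neq (oner_neq0 K) => D0.
  by rewrite -(det1 K r) -LAR -Dx det_map_mx D0 rmorph0.
rewrite (_ : (\det D).[x] = horner_eval x (\det D)) // -det_map_mx Dx -unitfE.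
rewrite -unitmxE => /mxrank_unit <-.
exact: leq_trans (mxrankM_maxl _ _) (mxrankM_maxr _ _).
Qed.

Lemma rank_minor (K : fieldType) p n (M : 'M[K]_(p, n)) :
  exists (f : 'I_(\rank M) -> 'I_p) (g : 'I_(\rank M) -> 'I_n),
    \det (mxsub f g M) != 0.
Proof.
pose B := rowsub (maxrankfun M) M.
have Bfull : row_full B^T.
  by rewrite /row_full mxrank_tr; exact: maxrowsub_free.
exists (maxrankfun M), (fullrankfun Bfull).
have := fullrowsub_unit Bfull; rewrite unitmxE unitfE -det_tr.
by congr (\det _ != 0); apply/matrixP => i j; rewrite !mxE.
Qed.

(** * Dimension in the Zariski topology *)

Section ZariskiDimension.
Variables (K : fieldType) (m n : nat).
Implicit Types (X Y Z : set 'M[K]_(m, n)) (F G : 'M[K]_(m, n)).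
Implicit Types (P Q : {mpoly K[(m * n)%N]}).

Definition meval_mx P F : K := P.@[fun k => mxvec F 0 k].

Lemma zclosed_in_sub X Y : zclosed_in X Y -> Y `<=` X.
Proof. by case=> I _ -> F []. Qed.

Lemma zclosed_in_zero X P k : P \is k.-homog ->
  zclosed_in X [set F | X F /\ meval_mx P F = 0].
Proof.
move=> Ph; exists [set P] => [_ ->|]; first by exists k.
by apply/seteqP; split=> F [XF PF]; split=> //; [move=> _ -> | exact: PF].
Qed.

(** The zero loci of [P] and [Q] cover [Z]: the homogeneous coordinate ring of
    an irreducible set is a domain. *)
Lemma zirreducible_mul X Z P Q k l : Z `<=` X -> zirreducible_in X Z ->
  P \is k.-homog -> Q \is l.-homog ->
  (forall F, Z F -> meval_mx P F * meval_mx Q F = 0) ->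
  (forall F, Z F -> meval_mx P F = 0) \/ (forall F, Z F -> meval_mx Q F = 0).
Proof.
move=> ZX [_ irr] Ph Qh PQ0.
have [|ZP|ZQ] := irr _ _ (zclosed_in_zero X Ph) (zclosed_in_zero X Qh).
- move=> F ZF; have /eqP := PQ0 F ZF; rewrite mulf_eq0 => /orP[] /eqP ?.
    by left; split=> //; exact: ZX.
  by right; split=> //; exact: ZX.
- by left=> F /ZP[].
- by right=> F /ZQ[].
Qed.

Lemma zclosed_separate X Y Z : zclosed_in X Y -> Z `<=` X -> ~ Z `<=` Y ->
  exists P k, [/\ P \is k.-homog, forall F, Y F -> meval_mx P F = 0 &
                  exists2 F, Z F & meval_mx P F != 0].
Proof.
move=> [I hI ->] ZX /existsNP[F /not_implyP[ZF /not_andP[]]]; first by case; exact: ZX.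
move=> /existsNP[P /not_implyP[IP /eqP PF]]; have [k Pk] := hI P IP.
by exists P, k; split=> // [G [_]|]; [exact | exists F].
Qed.

(** [L] forms of degree [D] that are linearly independent as functions on [Z]: a
    lower bound for the Hilbert function of [Z] at [D]. *)
Definition indep_forms Z D L : Prop :=
  exists2 g : 'I_L -> {mpoly K[(m * n)%N]}, (forall i, g i \is D.-homog) &
    forall c : 'I_L -> K,
      (forall F, Z F -> \sum_i c i * meval_mx (g i) F = 0) -> forall i, c i = 0.

Lemma indep_formsS Y Z D L : Y `<=` Z -> indep_forms Y D L -> indep_forms Z D L.
Proof.
by move=> YZ [g gh gI]; exists g => // c Zc; apply: gI => F /YZ; exact: Zc.
Qed.

Lemma meval_mx_sum L (c : 'I_L -> K) (g : 'I_L -> {mpoly K[(m * n)%N]}) F :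
  meval_mx (\sum_i c i *: g i) F = \sum_i c i * meval_mx (g i) F.
Proof. by rewrite /meval_mx raddf_sum /=; apply: eq_bigr => i _; rewrite mevalZ. Qed.

(** Multiplication by [P] is injective on the homogeneous coordinate ring of
    [Z]. *)
Lemma indep_forms_pad X Z D L P e : Z `<=` X -> zirreducible_in X Z ->
  P \is e.-homog -> (exists2 F, Z F & meval_mx P F != 0) ->
  indep_forms Z D L -> indep_forms Z (D + e) L.
Proof.
move=> ZX irr Ph [F0 ZF0 PF0] [g gh gI].
exists (fun i => g i * P) => [i|c Zc]; first exact: dhomogM.
apply: gI; have Sh : \sum_i c i *: g i \is D.-homog.
  by apply: rpred_sum => i _; apply: rpredZ.
have [|S0|P0] := zirreducible_mul ZX irr Sh Ph.
- move=> F /Zc <-; rewrite meval_mx_sum // mulr_suml.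
  by apply: eq_bigr => i _; rewrite /meval_mx mevalM mulrA.
- by move=> F /S0; rewrite meval_mx_sum.
- by rewrite (P0 _ ZF0) eqxx in PF0.
Qed.

(** Graded pieces add up along a nonzerodivisor: the forms on [Y] lift to [Z],
    and the multiples of an equation [P] of [Y] in [Z] are independent of
    them. *)
Lemma indep_forms_add X Y Z D L L' P e :
  Y `<=` Z -> Z `<=` X -> zirreducible_in X Z -> P \is e.-homog ->
  (forall F, Y F -> meval_mx P F = 0) -> (exists2 F, Z F & meval_mx P F != 0) ->
  indep_forms Y (D + e) L -> indep_forms Z D L' -> indep_forms Z (D + e) (L + L').
Proof.
move=> YZ ZX irr Ph PY [F0 ZF0 PF0] [g gh gI] [h hh hI].
exists (fun i : 'I_(L + L') => match fintype.split i with inl a => g a | inr b => h b * P end).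
  by move=> i; case: fintype.split => j //; exact: dhomogM.
move=> c Zc.
have Zc' F : Z F -> \sum_i c (lshift L' i) * meval_mx (g i) F +
    (\sum_i c (rshift L i) * meval_mx (h i) F) * meval_mx P F = 0.
  move=> /Zc cF; rewrite -[RHS]cF big_split_ord /=; congr (_ + _).
    by apply: eq_bigr => i _; rewrite (fintype.unsplitK (inl _)).
  rewrite mulr_suml; apply: eq_bigr => i _; rewrite (fintype.unsplitK (inr _)).
  by rewrite /meval_mx mevalM mulrA.
have cl0 i : c (lshift L' i) = 0.
  apply: (gI (c \o lshift L')) => F YF /=.
  by rewrite -[RHS](Zc' F (YZ F YF)) (PY F YF) mulr0 addr0.
have Sh : \sum_i c (rshift L i) *: h i \is D.-homog.
  by apply: rpred_sum => i _; apply: rpredZ.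
have cr0 i : c (rshift L i) = 0.
  apply: (hI (fun j => c (rshift L j))) => F1 ZF1; move: F1 ZF1.
  have [|S0|P0] := zirreducible_mul ZX irr Sh Ph.
  - move=> F ZF; rewrite meval_mx_sum // -[RHS](Zc' F ZF).
    by rewrite [X in _ = X + _]big1 ?add0r // => j _; rewrite cl0 mul0r.
  - by move=> F /S0; rewrite meval_mx_sum.
  - by rewrite (P0 _ ZF0) eqxx in PF0.
by move=> i; rewrite -(fintype.splitK i); case: fintype.split => j /=.
Qed.

Lemma bin_le_expn D N : ('C(D + N, N) <= D.+1 ^ N)%N.
Proof.
elim: N => [|N IH]; first by rewrite bin0.
rewrite -(@leq_pmul2l N.+1) // -mul_bin_diag addnS /= expnS mulnA.
by apply: leq_mul IH; rewrite mulSn mulnC mulSn; lia.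
Qed.

(** Forms that are independent on [Z] are independent in the space of all forms
    of degree [D], whose dimension is a binomial coefficient. *)
Lemma indep_forms_bound Z D L : (0 < m * n)%N -> indep_forms Z D L ->
  (L <= D.+1 ^ (m * n).-1)%N.
Proof.
move=> mn0 [g gh gI]; pose pt (F : 'M[K]_(m, n)) k := mxvec F 0 k.
have {}gI (c : 'I_L -> K) :
    (forall F, Z F -> \sum_i c i * (g i).@[pt F] = 0) -> forall i, c i = 0.
  exact: gI.
clearbody pt; move: pt g gh gI mn0; move: (m * n)%N => [|N] // pt g gh gI _.
pose v : L.-tuple (dhomog N.+1 K D) := [tuple DHomog (gh i) | i < L].
have fv : free v.
  apply/freeP => c c0 i; apply: gI => F ZF.
  transitivity (mpoly_of_dhomog (\sum_i c i *: v`_i)).@[pt F]; last first.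
    by rewrite c0 (raddf0 (@mpoly_of_dhomog _ _ _)) meval0.
  rewrite (raddf_sum (@mpoly_of_dhomog _ _ _)) raddf_sum.
  apply: eq_bigr => j _; rewrite -[X in _ = meval _ (_ (_ *: X))](tnth_nth 0 v j).
  by rewrite tnth_mktuple linearZ.
rewrite -(size_tuple v) -(eqP fv : \dim <<v>> = size v).
apply: leq_trans (dimvS (subvf _)) _; rewrite dimvf.
by apply: leq_trans (bin_le_expn D N); rewrite -[X in (_ <= 'C(_, X))%N](addKn D) bin_sub ?leq_addr.
Qed.

(** Each step of a chain raises the order of growth of the Hilbert function by
    one: if [P] vanishes on the smaller set but not on the larger one, then
    [q + 1] families of forms on the smaller set, multiplied by different powers
    of [P], are independent on the larger one. Powers of a coordinate bring them
    all to the same degree. *)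
Lemma zchain_indep_forms X k : X `<=` [set F | F != 0] -> zchain X k ->
  exists E, forall q, exists2 Z, Z `<=` X & indep_forms Z (q * E) (q.+1 ^ k).
Proof.
move=> X0 [Z [ZX Zlt]].
have subX i : (i <= k)%N -> Z i `<=` X by move=> /ZX[/zclosed_in_sub].
have subZ i : (i <= k)%N -> Z 0%N `<=` Z i.
  elim: i => [|i IH] ik //; apply: subset_trans (IH (ltnW ik)) _.
  by have [] := Zlt i ik.
have [_ [[F0 ZF0] _]] := ZX 0%N isT.
have /matrix0Pn[i0 [j0 F00]] : F0 != 0 by exact: X0 (subX 0%N isT _ ZF0).
pose x : {mpoly K[(m * n)%N]} := 'X_(mxvec_index i0 j0).
have xh e : x ^+ e \is e.-homog.
  by rewrite -{2}[e]mul1n; apply: dhomogMn; rewrite dhomogX; apply/eqP; exact: mdeg1.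
have xF0 e : meval_mx (x ^+ e) F0 != 0.
  by rewrite /meval_mx rmorphXn /= mevalXU mxvecE expf_neq0.
suff [E hE] : exists E, forall q, indep_forms (Z k) (q * E) (q.+1 ^ k).
  by exists E => q; exists (Z k) => //; exact: subX.
elim: {1 3 4}k (leqnn k) => [|i IH] ik.
  exists 0%N => q; rewrite muln0 expn0; exists (fun=> 1).
    by move=> _; exact: dhomog1.
  move=> c /(_ F0 ZF0); rewrite big_ord1 /meval_mx meval1 mulr1 => c0 j.
  by rewrite ord1.
have [E hE] := IH (ltnW ik); have [Zsub Zneq] := Zlt i ik.
have [Pc Pirr] := ZX i.+1 ik; have [Qc Qirr] := ZX i (ltnW ik).
have [P [e [Ph PZ PZ']]] := zclosed_separate Qc (subX _ ik) Zneq.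
exists (E + e)%N => q.
have main a : indep_forms (Z i.+1) (q * E + a * e) (a.+1 * q.+1 ^ i).
  elim: a => [|a IHa].
    by rewrite mul0n addn0 mul1n; apply: indep_formsS (hE q).
  have -> : (q * E + a.+1 * e = q * E + a * e + e)%N by rewrite mulSn; lia.
  rewrite (mulSn a.+1); apply: (indep_forms_add Zsub (subX _ ik) Pirr Ph PZ PZ' _ IHa).
  have -> : (q * E + a * e + e = q * E + a.+1 * e)%N by rewrite mulSn; lia.
  apply: (@indep_forms_pad X _ _ _ (x ^+ (a.+1 * e))) => //; first exact/subX/ltnW.
  by exists F0 => //; exact: subZ (ltnW ik) _ ZF0.
by rewrite mulnDr expnS; exact: main.
Qed.

(** A chain of length [k] yields [(q + 1) ^ k] independent forms in degree
    [q * E], whereas the number of monomials of that degree grows as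
    [q ^ (m * n - 1)]. *)
Lemma zchain_bound X k : (0 < m * n)%N -> X `<=` [set F | F != 0] ->
  zchain X k -> (k <= (m * n).-1)%N.
Proof.
move=> mn0 X0 /(zchain_indep_forms X0)[E hE]; rewrite leqNgt; apply/negP => kN.
set N := (m * n).-1 in kN; pose q := (E.+1 ^ N)%N.
have [Z _ /(indep_forms_bound mn0)] := hE q; rewrite -/N; apply/negP; rewrite -ltnNge.
apply: (@leq_trans (q.+1 ^ N.+1)); last by rewrite leq_pexp2l.
apply: (@leq_ltn_trans ((E.+1 * q.+1) ^ N)).
  have [->|N0] := posnP N; first by rewrite !expn0.
  by rewrite leq_exp2r // mulSn mulnS mulnC; lia.
by rewrite expnMn -/q expnS ltn_pmul2r ?expn_gt0.
Qed.

(** The closures in [X] of the members of a chain of [Z] are irreducible, and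
    distinct because their traces on [Z] are the original sets. *)
Lemma zchain_closure X Z k : Z `<=` X -> zchain Z k -> zchain X k.
Proof.
move=> ZX [Y [YZ Ylt]].
pose J i := [set P : {mpoly K[(m * n)%N]} |
  (exists l, P \is l.-homog) /\ forall F, Y i F -> meval_mx P F = 0].
pose cl i := [set F | X F /\ forall P, J i P -> meval_mx P F = 0].
have Ysub i : (i <= k)%N -> Y i `<=` Z by move=> /YZ[/zclosed_in_sub].
have clY i : (i <= k)%N -> Y i `<=` cl i.
  by move=> ik F YF; split=> [|P [_]]; [exact/ZX/(Ysub i) | exact].
have clZ i F : (i <= k)%N -> cl i F -> Z F -> Y i F.
  move=> ik [_ clF] ZF; have [[I hI YE] _] := YZ i ik; rewrite YE; split=> // P IP.
  by apply: clF; split; [exact: hI | rewrite YE => G [_]; exact].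
have clmin i W : (i <= k)%N -> zclosed_in X W -> Y i `<=` W -> cl i `<=` W.
  move=> ik [I hI ->] YW F [XF clF]; split=> // P IP; apply: clF; split.
    exact: hI.
  by move=> G /YW[_]; exact.
exists cl; split=> [i ik|i ik].
  split; first by exists (J i) => // P [].
  have [_ [[F YF] irr]] := YZ i ik; split; first by exists F; exact: clY.
  move=> W1 W2 W1c W2c clW.
  have trace W : zclosed_in X W -> zclosed_in Z (Z `&` W).
    case=> I hI ->; exists I => //; apply/seteqP.
    by split=> G; [case=> ZG [_ ?]; split | case=> ZG ?; split => //; split=> //; exact: ZX].
  have [|Y1|Y2] := irr _ _ (trace _ W1c) (trace _ W2c).
  - move=> G YG; have ZG := Ysub i ik _ YG.
    by case: (clW G (clY i ik _ YG)) => ?; [left|right].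
  - by left; apply: clmin => // G /Y1[].
  - by right; apply: clmin => // G /Y2[].
have [sub nsub] := Ylt i ik; split.
  move=> F [XF clF]; split=> // P [Ph PY]; apply: clF; split=> // G /sub; exact: PY.
move=> cls; apply: nsub => F YF; apply: (clZ i) (ltnW ik) _ _.
  by apply: cls; exact: clY.
exact: (Ysub i.+1).
Qed.

Lemma zdim_exists X B k : (forall l, zchain X l -> (l <= B)%N) -> zchain X k ->
  exists l, [/\ zdim X l, (k <= l)%N & (l <= B)%N].
Proof.
move=> XB Xk; pose p l := `[< zchain X l >].
have ex : exists l, p l by exists k; apply/asboolP.
have bd l : p l -> (l <= B)%N by move=> /asboolP/XB.
case: (ex_maxnP ex bd) => l /asboolP Xl maxl; exists l; split.
- by split=> // j Xj; apply: maxl; apply/asboolP.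
- by apply: maxl; apply/asboolP.
- exact: XB.
Qed.

Lemma zcodim_le X Z l : (0 < m * n)%N -> X `<=` [set F | F != 0] -> Z `<=` X ->
  zchain Z l -> exists2 c, zcodim X Z c & (c + l < m * n)%N.
Proof.
move=> mn0 X0 ZX Zl.
have XB j : zchain X j -> (j <= (m * n).-1)%N by exact: zchain_bound.
have ZB j : zchain Z j -> (j <= (m * n).-1)%N by move/(zchain_closure ZX)/XB.
have [dZ [dZP ldZ _]] := zdim_exists ZB Zl.
have [dX [dXP dZX dXB]] := zdim_exists XB (zchain_closure ZX (proj1 dZP)).
by exists (dX - dZ)%N; [exists dX, dZ; split=> //; lia | lia].
Qed.

End ZariskiDimension.

(** * Chains through an open subset of a linear space *)

Section OpenChain.
Variables (K : numFieldType) (m n : nat).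
Implicit Types (X O : set 'M[K]_(m, n)) (F G : 'M[K]_(m, n)).

Lemma cofin_meval (P : {mpoly K[(m * n)%N]}) F G x0 :
  meval_mx P (F + x0 *: G) != 0 -> cofin (fun x => meval_mx P (F + x *: G) != 0).
Proof.
pose h k : {poly K} := (mxvec F 0 k)%:P + mxvec G 0 k *: 'X.
pose p := mmap (@polyC K) h P.
have pE x : p.[x] = meval_mx P (F + x *: G).
  rewrite /meval_mx mevalE /p /mmap -horner_evalE raddf_sum /=.
  apply: eq_bigr => mo _; rewrite horner_evalE hornerM hornerC; congr (_ * _).
  rewrite /mmap1 horner_prod; apply: eq_bigr => k _.
  rewrite hornerE /h !hornerE linearD linearZ !mxE; congr (_ ^+ _).
  by rewrite mulrC.
by rewrite -pE => p0; exists p => [|x]; [apply: contraNneq p0 => ->; rewrite horner0 | rewrite pE].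
Qed.

Variables (X O : set 'M[K]_(m, n)) (F0 : 'M[K]_(m, n)).
Variables (k0 : 'I_m * 'I_n) (cs : seq ('I_m * 'I_n)).

Definition coord_space : set 'M[K]_(m, n) :=
  [set F | forall k, k \notin k0 :: cs -> F k.1 k.2 = 0].

Hypothesis OX : O `<=` X.
Hypothesis OF0 : O F0.
Hypothesis UF0 : coord_space F0.
Hypothesis F00 : F0 k0.1 k0.2 != 0.
Hypothesis ucs : uniq (k0 :: cs).
(* the trace of [O] on any line of the linear space is empty or cofinite *)
Hypothesis Oopen : forall F G, O F -> coord_space F -> coord_space G ->
  cofin (fun x => O (F + x *: G)).

(* an increasing flag: [V 0] is the line of [F0], and each further coordinate in
   [cs] is freed in turn *)
Let V s : set 'M[K]_(m, n) := [set F | forall k, k \notin take s cs ->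
  F k.1 k.2 * F0 k0.1 k0.2 = F k0.1 k0.2 * F0 k.1 k.2].

Let VU s : V s `<=` coord_space.
Proof.
move=> F VF k kcs; have kt : k \notin take s cs.
  by apply: contra kcs => /mem_take; rewrite inE orbC => ->.
by apply: (mulIf F00); rewrite VF // UF0 // mul0r mulr0.
Qed.

Let VF0 s : V s F0.
Proof. by move=> k _; rewrite mulrC. Qed.

Let Vline s F G x : V s F -> V s G -> V s (F + x *: G).
Proof.
move=> VF VG k kt; rewrite !mxE !mulrDl VF // -!mulrA.
by congr (_ + _ * _); exact: VG.
Qed.

Let VB s F G : V s F -> V s G -> V s (G - F).
Proof. by move=> VF VG; rewrite -scaleN1r; exact: Vline. Qed.

Let Vclosed s : zclosed_in X (X `&` V s).
Proof.
pose P (k : 'I_m * 'I_n) : {mpoly K[(m * n)%N]} :=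
  F0 k0.1 k0.2 *: 'X_(mxvec_index k.1 k.2) - F0 k.1 k.2 *: 'X_(mxvec_index k0.1 k0.2).
exists [set Q | exists2 k, k \notin take s cs & Q = P k].
  move=> _ [k _ ->]; exists 1%N; apply: rpredB; apply: rpredZ;
  by rewrite dhomogX; apply/eqP; exact: mdeg1.
have PE k F : (P k).@[fun i => mxvec F 0 i] =
    F k.1 k.2 * F0 k0.1 k0.2 - F k0.1 k0.2 * F0 k.1 k.2.
  by rewrite mevalB !mevalZ !mevalXU !mxvecE; congr (_ - _); rewrite mulrC.
apply/seteqP; split=> F [XF VF]; split=> //.
  by move=> _ [k kt ->]; rewrite PE VF // subrr.
by move=> k kt; apply/eqP; rewrite -subr_eq0 -PE; apply/eqP/VF; exists k.
Qed.

(* Moving along the line towards [F0] brings [F] into [O] without making [P]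
   vanish. *)
Let open_witness s P : (exists2 F, (X `&` V s) F & meval_mx P F != 0) ->
  exists F, [/\ O F, V s F & meval_mx P F != 0].
Proof.
move=> [F [XF VF] PF].
have VD := VB (@VF0 s) VF.
have /cofin_and := Oopen OF0 UF0 (VU VD).
have /[swap]/[apply] : cofin (fun x => meval_mx P (F0 + x *: (F - F0)) != 0).
  by apply: (@cofin_meval _ _ _ 1); rewrite scale1r subrKC.
by case/cofin_ex => x [Ox Px]; exists (F0 + x *: (F - F0)); split=> //; exact: Vline.
Qed.

(* If neither of two closed sets covers the slice, then each of them misses a
   point of [O] in the slice, and almost every point of the line through these
   two points lies outside both. *)
Let Virr s : zirreducible_in X (X `&` V s).
Proof.
split; first by exists F0; split; [exact: OX | exact: VF0].
move=> Z1 Z2 Z1c Z2c Z12; apply: contrapT => /not_orP[n1 n2].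
have [P1 [_ [_ P1Z /open_witness]]] := zclosed_separate Z1c (@subIsetl _ _ _) n1.
case=> G1 [O1 V1 PG1].
have [P2 [_ [_ P2Z /open_witness]]] := zclosed_separate Z2c (@subIsetl _ _ _) n2.
case=> G2 [O2 V2 PG2].
have VD := VB V1 V2.
have /cofin_and := Oopen O1 (VU V1) (VU VD).
have /[swap]/[apply] : cofin (fun x => meval_mx P1 (G1 + x *: (G2 - G1)) != 0).
  by apply: (@cofin_meval _ _ _ 0); rewrite scale0r addr0.
move/cofin_and.
have /[swap]/[apply] : cofin (fun x => meval_mx P2 (G1 + x *: (G2 - G1)) != 0).
  by apply: (@cofin_meval _ _ _ 1); rewrite scale1r subrKC.
case/cofin_ex => x [[/OX Xx P1x] P2x].
have /Z12[/P1Z|/P2Z] : (X `&` V s) (G1 + x *: (G2 - G1)).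
  by split=> //; exact: Vline.
- by move/eqP; exact/negP.
- by move/eqP; exact/negP.
Qed.

(** The slices of [X] by the flag are irreducible, because the open set [O] is
    dense in each of them, and strictly increasing, because [F0] can be moved
    inside [O] in the direction of any coordinate. *)
Lemma zchain_open : zchain X (size cs).
Proof.
exists (fun s => X `&` V s); split=> [s _|s ss]; first by split; [exact: Vclosed | exact: Virr].
have [kcs us] : k0 \notin cs /\ uniq cs by apply/andP.
pose k := nth k0 cs s.
have kk0 : k0 != k by apply: contraNneq kcs => ->; exact: mem_nth.
split=> [F [XF VF]|sub].
  split=> // l lt; apply: VF; apply: contra lt.
  by rewrite (take_nth k0) // mem_rcons inE orbC => ->.
have Uk : coord_space (delta_mx k.1 k.2).
  move=> l lcs; rewrite mxE; case: andP => // -[/eqP l1 /eqP l2].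
  by move: lcs; rewrite [l]surjective_pairing l1 l2 -surjective_pairing inE mem_nth ?orbT.
have /cofin_and := Oopen OF0 UF0 Uk.
have /[swap]/[apply] : cofin (fun x : K => x != 0).
  by exists 'X; rewrite ?polyX_eq0 // => x; rewrite hornerX.
case/cofin_ex => x [Ox x0].
have k00 : (delta_mx k.1 k.2 : 'M[K]_(m, n)) k0.1 k0.2 = 0.
  rewrite mxE; case: andP => // -[/eqP l1 /eqP l2].
  by move: kk0; rewrite [k0]surjective_pairing l1 l2 -surjective_pairing eqxx.
have lineE (l : 'I_m * 'I_n) : (F0 + x *: delta_mx k.1 k.2) l.1 l.2 =
    F0 l.1 l.2 + x * (delta_mx k.1 k.2 : 'M[K]_(m, n)) l.1 l.2.
  by rewrite !mxE.
have /sub[_ /(_ k)] : (X `&` V s.+1) (F0 + x *: delta_mx k.1 k.2).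
  split; first exact: OX.
  move=> l; rewrite (take_nth k0) // mem_rcons inE negb_or => /andP[lk _].
  have l0 : (delta_mx k.1 k.2 : 'M[K]_(m, n)) l.1 l.2 = 0.
    rewrite mxE; case: andP => // -[/eqP l1 /eqP l2].
    by move: lk; rewrite [l]surjective_pairing l1 l2 -surjective_pairing eqxx.
  by rewrite !lineE k00 l0 mulr0 !addr0 mulrC.
have -> : k \notin take s cs by rewrite in_take_leq ?(ltnW ss) // index_uniq ?ltnn.
move/(_ isT); rewrite !lineE k00 [delta_mx _ _ _ _]mxE !eqxx mulr1.
rewrite mulr0 addr0 mulrDl [F0 k0.1 _ * _]mulrC => /eqP.
by rewrite -subr_eq0 addrC addKr mulf_eq0 (negPf x0) (negPf F00).
Qed.

End OpenChain.

(** * Power series *)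

Section FpsCoef.
Variable R : comNzRingType.
Implicit Types f g : fps R.

Lemma fpsD f g n : (f + g) n = f n + g n. Proof. by []. Qed.
Lemma fpsM f g n : (f * g) n = \sum_(i < n.+1) f i * g (n - i)%N.
Proof. by []. Qed.

Lemma fps_sum I (s : seq I) (P : pred I) (F : I -> fps R) n :
  (\sum_(i <- s | P i) F i) n = \sum_(i <- s | P i) F i n.
Proof. by apply: (big_morph (fun f : fps R => f n)). Qed.

Lemma fps_of_poly_is_zmod_morphism : zmod_morphism (@fps_of_poly R).
Proof. by move=> P Q; apply: fpsP => n /=; rewrite coefB. Qed.

Lemma fps_of_poly_is_monoid_morphism : monoid_morphism (@fps_of_poly R).
Proof.
split=> [|P Q]; apply: fpsP => n /=; first by rewrite coef1.
by rewrite coefM.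
Qed.

HB.instance Definition _ := GRing.isZmodMorphism.Build {poly R} (fps R)
  (@fps_of_poly R) fps_of_poly_is_zmod_morphism.
HB.instance Definition _ := GRing.isMonoidMorphism.Build {poly R} (fps R)
  (@fps_of_poly R) fps_of_poly_is_monoid_morphism.

Definition fpsC (c : R) : fps R := fps_of_poly c%:P.

Lemma fpsC_is_zmod_morphism : zmod_morphism fpsC.
Proof. by move=> a b; rewrite /fpsC !rmorphB. Qed.

Lemma fpsC_is_monoid_morphism : monoid_morphism fpsC.
Proof. by split=> [|a b]; rewrite /fpsC ?rmorph1 ?rmorphM. Qed.

HB.instance Definition _ := GRing.isZmodMorphism.Build R (fps R)
  fpsC fpsC_is_zmod_morphism.
HB.instance Definition _ := GRing.isMonoidMorphism.Build R (fps R)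
  fpsC fpsC_is_monoid_morphism.

Lemma fpsCM c f n : (fpsC c * f) n = c * f n.
Proof.
rewrite fpsM big_ord_recl /= coefC eqxx subn0 big1 ?addr0 // => i _.
by rewrite coefC mul0r.
Qed.

Lemma fps_evalE n (x : 'I_n -> fps R) : fps_eval x = mmap fpsC x.
Proof. by []. Qed.

Lemma fps_evalM n (x : 'I_n -> fps R) P Q : fps_eval x (P * Q) = fps_eval x P * fps_eval x Q.
Proof. by rewrite fps_evalE rmorphM. Qed.
Lemma fps_evalD n (x : 'I_n -> fps R) P Q : fps_eval x (P + Q) = fps_eval x P + fps_eval x Q.
Proof. by rewrite fps_evalE rmorphD. Qed.
Lemma fps_evalC n (x : 'I_n -> fps R) c : fps_eval x c%:MP = fpsC c.
Proof. by rewrite fps_evalE mmapC. Qed.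
Lemma fps_evalXU n (x : 'I_n -> fps R) i : fps_eval x 'X_i = x i.
Proof. by rewrite fps_evalE mmapX mmap1U. Qed.
Lemma fps_eval_prod n (x : 'I_n -> fps R) I (s : seq I) (P : pred I) F :
  fps_eval x (\prod_(i <- s | P i) F i) = \prod_(i <- s | P i) fps_eval x (F i).
Proof. by rewrite fps_evalE rmorph_prod. Qed.
Lemma fps_eval_sum n (x : 'I_n -> fps R) I (s : seq I) (P : pred I) F :
  fps_eval x (\sum_(i <- s | P i) F i) = \sum_(i <- s | P i) fps_eval x (F i).
Proof. by rewrite fps_evalE raddf_sum. Qed.
Lemma fps_evalXn n (x : 'I_n -> fps R) P k :
  fps_eval x (P ^+ k) = fps_eval x P ^+ k.
Proof. by rewrite fps_evalE rmorphXn. Qed.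

Lemma fps_eval_comp n n' (x : 'I_n -> fps R) (g : 'I_n' -> {mpoly R[n]}) G :
  fps_eval x (mmap (@mpolyC n R) g G) = fps_eval (fun i => fps_eval x (g i)) G.
Proof.
rewrite [mmap (@mpolyC n R) g G]/mmap fps_eval_sum.
apply: eq_bigr => m _; rewrite fps_evalM fps_evalC fps_eval_prod; congr (_ * _).
by apply: eq_bigr => i _; rewrite fps_evalXn.
Qed.

Definition fps_eq_upto (N : nat) f g : Prop := forall n, (n <= N)%N -> f n = g n.

Lemma fps_eq_uptoM N f f' g g' : fps_eq_upto N f f' -> fps_eq_upto N g g' ->
  fps_eq_upto N (f * g) (f' * g').
Proof.
move=> ff gg n nN; rewrite !fpsM; apply: eq_bigr => i _.
rewrite ff ?gg //; first by apply: leq_trans nN; rewrite leq_subr.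
by apply: leq_trans nN; rewrite -ltnS.
Qed.

Lemma fps_eq_uptoX N f f' k : fps_eq_upto N f f' -> fps_eq_upto N (f ^+ k) (f' ^+ k).
Proof.
by move=> ff; elim: k => [|k IH]; rewrite ?expr0 // !exprS; exact: fps_eq_uptoM.
Qed.

Definition fps_ord_ge (a : nat) f : Prop := forall i, (i < a)%N -> f i = 0.

Lemma fps_ord_geM a b f g : fps_ord_ge a f -> fps_ord_ge b g ->
  fps_ord_ge (a + b) (f * g) /\ (f * g) (a + b)%N = f a * g b.
Proof.
move=> fa gb; split=> [n nab|].
  rewrite fpsM big1 // => i _; have [ia|ai] := ltnP i a; first by rewrite fa ?mul0r.
  by rewrite gb ?mulr0 //; have := ltn_ord i; lia.
have la : (a < (a + b).+1)%N by rewrite ltnS leq_addr.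
rewrite fpsM (bigD1 (Ordinal la)) //= addKn big1 ?addr0 // => i ia.
have [ia'|ai] := ltnP i a; first by rewrite fa ?mul0r.
rewrite gb ?mulr0 //; have ne : (i != a :> nat) by rewrite -(inj_eq val_inj) in ia.
by have := ltn_ord i; lia.
Qed.

Lemma fps_ord_geX a f k : fps_ord_ge a f ->
  fps_ord_ge (a * k) (f ^+ k) /\ (f ^+ k) (a * k)%N = f a ^+ k.
Proof.
move=> fa; elim: k => [|k [IHg IHe]].
  by rewrite muln0 !expr0; split=> // i; rewrite ltn0.
by rewrite mulnS !exprS -IHe; exact: fps_ord_geM.
Qed.

Lemma fps_ord_geW a b f : (b <= a)%N -> fps_ord_ge a f -> fps_ord_ge b f.
Proof. by move=> ba fa i ib; apply: fa; apply: leq_trans ba. Qed.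

Lemma fps_ord_ge_prod n (x : 'I_n -> fps R) (r : 'I_n -> nat) :
  (forall i, fps_ord_ge (r i) (x i)) ->
  fps_ord_ge (\sum_i r i) (\prod_i x i) /\
  (\prod_i x i) (\sum_i r i)%N = \prod_i x i (r i).
Proof.
move=> xr; elim/big_rec3: _ => [|i p w q _ [wp wq]].
  by split=> // i; rewrite ltn0.
by rewrite -wq; exact: fps_ord_geM.
Qed.

End FpsCoef.

(** The coefficients of the quotient are determined one after the other; the
    lists [s n] of its first [n] coefficients are built by recursion. *)
Lemma fps_unit_div (K : fieldType) (f g : fps K) : g 0%N != 0 -> exists x, x * g = f.
Proof.
move=> g0.
pose step (s : seq K) := rcons s ((f (size s) - \sum_(i < size s) s`_i * g (size s - i)%N) / g 0%N).
pose s n := iter n step [::].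
have size_s n : size (s n) = n by elim: n => //= n IH; rewrite size_rcons IH.
pose x := FPS (fun n => (s n.+1)`_n).
have sx n i : (i < n)%N -> (s n)`_i = x i.
  elim: n => // n IH; rewrite ltnS leq_eqVlt => /predU1P[->//|lt].
  by rewrite /s iterS -/(s n) nth_rcons size_s lt IH.
exists x; apply: fpsP => n; rewrite fpsM big_ord_recr /= subnn.
rewrite -/(s n) nth_rcons size_s ltnn eqxx divfK // addrC.
rewrite [X in _ + X](eq_bigr (fun i : 'I_n => (s n)`_i * g (n - i)%N)) ?subrK // => i _.
by congr (_ * _); rewrite sx.
Qed.

(** * Values and truncated monomials *)

Section ValueSemigroup.
Variable K : fieldType.
Implicit Types f g : fps K.

Lemma fps_valM f g a b : fps_val f a -> fps_val g b -> fps_val (f * g) (a + b).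
Proof.
move=> [fa f0] [gb g0]; have [ge e] := fps_ord_geM f0 g0.
by split=> //; rewrite e; apply/eqP; rewrite mulf_neq0 //; apply/eqP.
Qed.

(** A series with nonzero constant term is a unit, whose inverse has valuation
    [0]. *)
Lemma fps_val_unitl g f k : g 0%N != 0 -> fps_val (g * f) k <-> fps_val f k.
Proof.
move=> g0; have vg : fps_val g 0 by split=> //; apply/eqP.
split=> [vgf|vf]; last by rewrite -[k]add0n; exact: fps_valM.
have [u ug] := fps_unit_div 1 g0.
have vu : fps_val u 0.
  split=> // u0; have := congr1 (fun h : fps K => h 0%N) ug.
  rewrite /= big_ord1 u0 mul0r => /eqP; rewrite eq_sym; exact/negP/oner_neq0.
by rewrite -[f]mul1r -ug -mulrA -[k]add0n; exact: fps_valM.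
Qed.

Variable n : nat.
Implicit Types x : 'I_n -> fps K.

Lemma value_semigroup0 x : value_semigroup x 0%N.
Proof.
by exists 1; rewrite fps_evalE rmorph1; split=> //; apply/eqP; rewrite oner_neq0.
Qed.

Lemma value_semigroupD x a b :
  value_semigroup x a -> value_semigroup x b -> value_semigroup x (a + b)%N.
Proof. by move=> [G Ga] [H Hb]; exists (G * H); rewrite fps_evalM; exact: fps_valM. Qed.

Lemma value_semigroup_gen x i a : fps_val (x i) a -> value_semigroup x a.
Proof. by exists 'X_i; rewrite fps_evalXU. Qed.

Lemma value_semigroup_subst x n' (y : 'I_n' -> fps K) (g : 'I_n' -> {mpoly K[n]}) :
  (forall i, y i = fps_eval x (g i)) -> value_semigroup y `<=` value_semigroup x.
Proof.
move=> yg k [G Gk]; exists (mmap (@mpolyC n K) g G); rewrite fps_eval_comp.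
by rewrite (_ : (fun i => _) = y) //; apply: funext => i; rewrite yg.
Qed.

(** The image of the evaluation is the ring generated by the constants and the
    [x i]. *)
Lemma fps_eval_ind x (P : fps K -> Prop) :
  (forall c, P (fpsC c)) -> (forall i, P (x i)) ->
  (forall f g, P f -> P g -> P (f + g)) -> (forall f g, P f -> P g -> P (f * g)) ->
  forall G, P (fps_eval x G).
Proof.
move=> PC Px PD PM G; rewrite /fps_eval /mmap.
have P0 : P 0 by have := PC 0; rewrite rmorph0.
have P1 : P 1 by have := PC 1; rewrite rmorph1.
apply: (big_ind P P0 PD) => m _; apply: (PM _ _ (PC _)).
apply: (big_ind P P1 PM) => i _.
by elim: (m i) => [|k IH]; rewrite ?expr0 // exprS; exact: PM.
Qed.

(** When the [x i] have no constant term, monomials with an exponent above [N]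
    vanish up to order [N]: the row space then consists of the truncations of
    all [fps_eval x G]. *)
Definition monom_mx x N : 'M[K]_(#|{ffun 'I_n -> 'I_N.+1}|, N.+1) :=
  \matrix_(s, j) (\prod_i x i ^+ ((enum_val s : {ffun 'I_n -> 'I_N.+1}) i)) j.

Lemma pval_row N (v : 'rV[K]_N.+1) f j : (j <= N)%N ->
  (forall i, v 0 i = f i) -> pval (rVpoly v) j <-> fps_val f j.
Proof.
move=> jN vf; have E l : (l <= N)%N -> (rVpoly v)`_l = f l.
  by move=> lN; rewrite -[l]/(val (Ordinal (lN : (l < N.+1)%N))) coef_rVpoly_ord vf.
split=> -[vj v0]; split; try by (rewrite ?E //; move: vj; rewrite ?E // => /eqP).
  by move=> i ij; rewrite -E ?v0 // ltnW // (leq_trans ij).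
by move=> i ij; rewrite E ?v0 // ltnW // (leq_trans ij).
Qed.

Lemma sub_monom_mx x N (v : 'rV[K]_N.+1) : (forall i, fps_ord_ge 1 (x i)) ->
  (v <= monom_mx x N)%MS <-> exists G, forall j, v 0 j = fps_eval x G j.
Proof.
move=> x1; split=> [/submxP[D ->]|[G vG]].
  pose mon (s : 'I_#|{ffun 'I_n -> 'I_N.+1}|) : 'X_{1..n} :=
    [multinom ((enum_val s : {ffun 'I_n -> 'I_N.+1}) i : nat) | i < n].
  exists (\sum_s D 0 s *: 'X_[mon s]) => j.
  rewrite fps_eval_sum fps_sum mxE; apply: eq_bigr => s _.
  rewrite -mul_mpolyC fps_evalM fps_evalC fpsCM mxE; congr (_ * _).
  rewrite fps_evalE mmapX /mmap1; congr (fps_coef _ j).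
  by apply: eq_bigr => i _; rewrite mnmE.
have -> : v = \sum_(m <- msupp G) G@_m *: (\row_j (\prod_i x i ^+ m i) j).
  apply/rowP => j; rewrite vG /fps_eval /mmap fps_sum summxE.
  by apply: eq_bigr => m _; rewrite -/(fpsC _) fpsCM !mxE.
apply: summx_sub => m _; apply: scalemx_sub.
have [/fintype.forallP mN|] := boolP [forall i, (m i <= N)%N].
  pose a : {ffun 'I_n -> 'I_N.+1} := [ffun i => inord (m i)].
  have -> : \row_j (\prod_i x i ^+ m i) j = row (enum_rank a) (monom_mx x N).
    apply/rowP => j; rewrite !mxE enum_rankK; congr (fps_coef _ j).
    by apply: eq_bigr => i _; rewrite ffunE inordK // ltnS.
  exact: row_sub.
rewrite negb_forall => /fintype.existsP[l]; rewrite -ltnNge => Nm.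
have xm k : fps_ord_ge (m k) (x k ^+ m k).
  by have [] := fps_ord_geX (m k) (x1 k); rewrite mul1n.
have [+ _] := fps_ord_ge_prod xm => p0.
rewrite (_ : \row_j _ = 0) ?sub0mx //; apply/rowP => j; rewrite !mxE p0 //.
by rewrite (bigD1 l) //= ltn_addr // (leq_trans (ltn_ord j)).
Qed.

Lemma leads_monom_mx x N j : (forall i, fps_ord_ge 1 (x i)) -> (j <= N)%N ->
  leads (monom_mx x N) j <-> value_semigroup x j.
Proof.
move=> x1 jN; split=> [[v /(sub_monom_mx _ x1)[G vG] vj]|[G Gj]].
  by exists G; apply/(pval_row jN vG).
exists (\row_i fps_eval x G i).
  by apply/(sub_monom_mx _ x1); exists G => i; rewrite mxE.
by apply/(pval_row jN (f := fps_eval x G)) => // i; rewrite mxE.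
Qed.

Lemma rank_monom_mx x N : (forall i, fps_ord_ge 1 (x i)) ->
  \rank (monom_mx x N) = cnt (value_semigroup x) N.+1.
Proof. by move=> x1; rewrite rank_leads; apply: eq_cnt => j jN; apply: leads_monom_mx. Qed.

Lemma rank_le_nonzero_rows p q (M : 'M[K]_(p, q)) (A : {pred 'I_p}) :
  (forall s, s \notin A -> row s M = 0) -> (\rank M <= #|A|)%N.
Proof.
move=> M0; apply: leq_trans (rank_leq_row (rowsub (enum_val : 'I_#|A| -> _) M)).
apply/mxrankS/row_subP => s; have [sA|/M0->] := boolP (s \in A); last exact: sub0mx.
by apply: (eq_row_sub (enum_rank_in sA s)); rewrite row_rowsub enum_rankK_in.
Qed.

(** The values up to [N] are counted by the rank of the truncated monomials, and
    the monomials of weight above [N] are zero after truncation. *)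
Lemma cnt_value_semigroup_le x (r : 'I_n -> nat) N :
  (forall i, 0 < r i)%N -> (forall i, fps_ord_ge (r i) (x i)) ->
  (cnt (value_semigroup x) N.+1 <=
   #|[set e : {ffun 'I_n -> 'I_N.+1} | \sum_i r i * e i <= N]%SET|)%N.
Proof.
move=> r0 xr; have x1 i : fps_ord_ge 1 (x i) by apply: fps_ord_geW (r0 i) (xr i).
rewrite -rank_monom_mx //.
apply: leq_trans (rank_le_nonzero_rows (A := [pred s | \sum_i r i * (enum_val s : {ffun 'I_n -> 'I_N.+1}) i <= N]%N) _) _.
  move=> s; rewrite inE -ltnNge => Ns; apply/rowP => j; rewrite !mxE.
  apply: (proj1 (fps_ord_ge_prod (fun i => proj1 (fps_ord_geX ((enum_val s : {ffun 'I_n -> 'I_N.+1}) i) (xr i))))).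
  by apply: leq_trans Ns; rewrite ltn_ord.
rewrite -(card_imset _ (@enum_val_inj _ _)); apply/subset_leq_card/fintype.subsetP => e.
by move=> /imsetP[s]; rewrite inE => es ->.
Qed.

End ValueSemigroup.

(** * Generic series have the most values *)

Section GenericMaximality.
Variables (K : fieldType) (n : nat) (r : n.-tuple nat) (N : nat).

Let free_pos := {p : 'I_n * 'I_N.+1 | (tnth r p.1 < p.2)%N}.
Let M := #|{: free_pos}|.

Let pos (k : 'I_M) : {j : 'I_n * nat | (tnth r j.1 < j.2)%N} :=
  exist _ ((val (enum_val k : free_pos)).1, nat_of_ord (val (enum_val k : free_pos)).2) (valP (enum_val k : free_pos)).

Let pos_inj : injective pos.
Proof.
move=> k l [] e1 /val_inj e2; apply: enum_val_inj; apply: val_inj.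
by rewrite [LHS]surjective_pairing [RHS]surjective_pairing e1 e2.
Qed.

Let at_ (x : 'I_n -> fps K) (k : 'I_M) : K := x (val (pos k)).1 (val (pos k)).2.

Section Universal.
Variable lead : 'I_n -> K.

(** The universal parametrization up to order [N]: the given leading
    coefficients, followed by one indeterminate for each coefficient of higher
    order. *)
Definition univ_coef (i : 'I_n) (l : 'I_N.+1) : {mpoly K[M]} :=
  if (insub (i, l) : option free_pos) is Some t then 'X_(enum_rank t)
  else if l == tnth r i :> nat then (lead i)%:MP else 0.

Definition univ_poly (i : 'I_n) : {poly {mpoly K[M]}} :=
  \sum_(l < N.+1) univ_coef i l *: 'X^l.

Definition univ_mx : 'M[{mpoly K[M]}]_(#|{ffun 'I_n -> 'I_N.+1}|, N.+1) :=
  \matrix_(s, j) (\prod_i univ_poly i ^+ ((enum_val s : {ffun 'I_n -> 'I_N.+1}) i))`_j.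

Lemma univ_mx_eval (x : 'I_n -> fps K) :
  (forall i, fps_ord_ge (tnth r i) (x i)) -> (forall i, x i (tnth r i) = lead i) ->
  map_mx (meval (at_ x)) univ_mx = monom_mx x N.
Proof.
move=> xr xl.
have coefE i l : (univ_coef i l).@[at_ x] = x i l.
  rewrite /univ_coef; case: insubP => [t _ tE|] /=.
    by rewrite mevalXU /at_ /= enum_rankK tE.
  rewrite -leqNgt leq_eqVlt; case: eqP => [-> _|_ /=]; first by rewrite mevalC.
  by move=> lr; rewrite meval0 xr.
have polyE i : fps_eq_upto N (fps_of_poly (map_poly (meval (at_ x)) (univ_poly i))) (x i).
  move=> j jN /=; rewrite coef_map /univ_poly coef_sum.
  rewrite (bigD1 (Ordinal (jN : (j < N.+1)%N))) //= big1 ?addr0 => [|l lj].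
    by rewrite coefZ coefXn eqxx mulr1 coefE.
  rewrite coefZ coefXn; case: eqP => [jl|_]; last by rewrite mulr0.
  by case/eqP: lj; apply: val_inj; rewrite /= jl.
apply/matrixP => s j; rewrite !mxE -coef_map rmorph_prod.
rewrite -[LHS]/(fps_of_poly _ j) rmorph_prod.
suff P : fps_eq_upto N
    (\prod_i fps_of_poly (map_poly (meval (at_ x)) (univ_poly i ^+ (enum_val s : {ffun 'I_n -> 'I_N.+1}) i)))
    (\prod_i x i ^+ (enum_val s : {ffun 'I_n -> 'I_N.+1}) i).
  by apply: P; rewrite -ltnS.
elim/big_rec2: _ => [//|i u v _ uv]; apply: fps_eq_uptoM => //.
by rewrite !rmorphXn; apply: fps_eq_uptoX; exact: polyE.
Qed.

(** The entries of the matrix are sums of products of indeterminates and leading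
    coefficients. *)
Lemma univ_minor_over q (f : 'I_q -> _) (g : 'I_q -> _) mo :
  subfield_generated [set lead i | i in [set: 'I_n]] (\det (mxsub f g univ_mx))@_mo.
Proof.
move=> L divL leadL.
have subL : GRing.subring_closed L by case: divL => ? ? ?; exact: GRing.divring_closedBM.
pose Ls : subringClosed K := HB.pack L (GRing.isSubringClosed.Build K L subL).
have coefL i l : univ_coef i l \is a mpolyOver M Ls.
  rewrite /univ_coef; case: insubP => [t _ _|_].
    by apply/mpolyOverP => m; rewrite mcoeffX; case: eqP; rewrite ?rpred1 ?rpred0.
  case: ifP => _; last exact: rpred0.
  by rewrite mpolyOverC; apply: leadL; exists i.
have mxL s j : univ_mx s j \is a mpolyOver M Ls.
  rewrite mxE; apply/polyOverP; apply: rpred_prod => i _; apply: rpredX.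
  apply: rpred_sum => l _; apply/polyOverP => k; rewrite coefZ coefXn.
  by apply: rpredM => //; case: eqP; rewrite ?rpred1 ?rpred0.
have : \det (mxsub f g univ_mx) \is a mpolyOver M Ls.
  apply: rpred_sum => p _; rewrite rpredMsign; apply: rpred_prod => i _.
  by rewrite mxE.
by move/mpolyOverP.
Qed.

End Universal.

(** Every minor is a polynomial in the free coefficients over the field of the
    leading ones: a minor that vanishes at the algebraically independent
    coefficients of [f] vanishes identically, hence also at those of [x]. *)
Lemma rank_generic_max (f x : 'I_n -> fps K) : generic_adapted r f ->
  (forall i, fps_val (x i) (tnth r i)) ->
  (forall i, x i (tnth r i) = f i (tnth r i)) ->
  (\rank (monom_mx x N) <= \rank (monom_mx f N))%N.
Proof.
move=> [fr fi] xr xf; pose lead i := f i (tnth r i).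
have [rows [cols]] := rank_minor (monom_mx x N).
have xE : map_mx _ (univ_mx lead) = monom_mx x N := univ_mx_eval (fun i => (xr i).2) xf.
have fE : map_mx _ (univ_mx lead) = monom_mx f N := univ_mx_eval (fun i => (fr i).2) (fun=> erefl).
set q := \rank (monom_mx x N) in rows cols *; rewrite -{1}xE -map_mxsub det_map_mx => Dx.
pose D := \det (mxsub rows cols (univ_mx lead)).
have Df : D.@[at_ f] != 0.
  apply: contraNneq Dx => Df; rewrite -/D (_ : D = 0) ?rmorph0 //.
  by apply: (fi _ pos pos_inj) => // mo; exact: univ_minor_over.
move: Df; rewrite /D -[X in X != 0]/(meval (at_ f) _) -det_map_mx map_mxsub fE.
rewrite -unitfE -unitmxE => /mxrank_unit {1}<-.
have -> : mxsub rows cols (monom_mx f N) =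
    rowsub rows 1%:M *m monom_mx f N *m colsub cols 1%:M.
  by rewrite -rowsubE mulmx_colsub mulmx1; apply/matrixP => i j; rewrite !mxE.
exact: leq_trans (mxrankM_maxl _ _) (mxrankM_maxr _ _).
Qed.

End GenericMaximality.

(** The number of values below [k] is a rank, which is largest for generic
    coefficients. *)
Lemma cnt_value_semigroup_generic (K : fieldType) n (r : n.-tuple nat)
    (f x : 'I_n -> fps K) k : (forall i, 0 < tnth r i)%N ->
  generic_adapted r f -> (forall i, fps_val (x i) (tnth r i)) ->
  (cnt (value_semigroup x) k <= cnt (value_semigroup f) k)%N.
Proof.
move=> r0 fgen xr; case: k => [|N]; first by rewrite [X in (X <= _)%N]cnt0.
have fr := fgen.1.
(* rescaling the coordinates, which keeps the values, achieves the leading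
   coefficients of [f] *)
pose c i := f i (tnth r i) / x i (tnth r i).
have c0 i : c i != 0.
  by rewrite mulf_neq0 ?invr_eq0 //; apply/eqP; [case: (fr i)|case: (xr i)].
pose y i := fpsC (c i) * x i.
have ylead i : y i (tnth r i) = f i (tnth r i).
  by rewrite fpsCM /c divfK //; apply/eqP; case: (xr i).
have yr i : fps_val (y i) (tnth r i).
  by apply/fps_val_unitl; [rewrite /= coefC eqxx c0 | exact: xr].
have xy : value_semigroup x `<=` value_semigroup y.
  apply: (@value_semigroup_subst _ _ _ _ _ (fun i => (c i)^-1 *: 'X_i)) => i.
  rewrite -mul_mpolyC fps_evalM fps_evalC fps_evalXU /y mulrA -rmorphM /=.
  by rewrite mulVf // rmorph1 mul1r.
have ord1 (z : 'I_n -> fps K) : (forall i, fps_val (z i) (tnth r i)) ->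
    forall i, fps_ord_ge 1 (z i).
  by move=> zr i; apply: fps_ord_geW (r0 i) (zr i).2.
apply: leq_trans (cnt_subset (fun j _ => xy j)) _.
apply: leq_trans (eq_leq (esym (rank_monom_mx N (ord1 y yr)))) _.
apply: leq_trans _ (eq_leq (rank_monom_mx N (ord1 f fr))).
exact: rank_generic_max fgen yr ylead.
Qed.

(** * Numerical semigroups and their genus *)

Section NumericalSemigroup.
Implicit Types S X : set nat.

Lemma cntS S k : cnt S k.+1 = (cnt S k + `[< S k >])%N.
Proof. by rewrite /cnt big_ord_recr. Qed.

Lemma cnt_addn S k l : (cnt S (k + l) <= cnt S k + l)%N.
Proof. by elim: l => [|l IH]; rewrite ?addn0 // addnS cntS; case: asboolP => _; lia. Qed.

Lemma genus_cnt S : numerical_semigroup S ->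
  exists B, forall k, (B <= k)%N -> (cnt S k + genus S = k)%N.
Proof.
case=> _ _ fS; pose A := fset_set (~` S).
have AE j : (j \in A) = ~~ `[< S j >].
  rewrite in_fset_set //; apply/idP/idP => [/set_mem nSj|/asboolPn nSj].
    exact/asboolPn.
  exact: mem_set.
exists (\max_(j <- A) j).+1 => k Bk.
have cntE : cnt S k = count (fun j => `[< S j >]) (iota 0 k).
  elim: k {Bk} => [|k IH]; first by rewrite /cnt big_ord0.
  by rewrite cntS IH -[in iota 0 k.+1]addn1 iotaD count_cat /= addn0.
suff -> : genus S = count (predC (fun j => `[< S j >])) (iota 0 k).
  by rewrite cntE count_predC size_iota.
rewrite /genus -/A -size_filter.
apply/perm_size/uniq_perm; rewrite ?fset_uniq ?filter_uniq ?iota_uniq // => j.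
rewrite mem_filter mem_iota /= add0n -AE; case: (boolP (j \in A)) => //= jA.
by apply/esym; apply: leq_trans Bk; rewrite ltnS; exact: leq_bigmax_seq.
Qed.

Lemma leq_cnt_genus S k : numerical_semigroup S -> (k <= cnt S k + genus S)%N.
Proof.
move=> /genus_cnt[B hB]; have := hB (k + B)%N (leq_addl _ _).
by have := cnt_addn S k B; lia.
Qed.

(** If [n] is missing, then at most one of [j] and [n - j] belongs to [X] for
    every [j <= n]. *)
Lemma half_dense_mem X n : (forall x y, X x -> X y -> X (x + y)%N) ->
  (n.+1 < 2 * cnt X n.+1)%N -> X n.
Proof.
move=> XD; apply: contraPP => nX; apply/negP; rewrite -leqNgt mul2n -addnn.
rewrite {2}/cnt (reindex_inj rev_ord_inj) /= -big_split /=.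
apply: leq_trans (_ : \sum_(j < n.+1) 1 <= _)%N; last by rewrite sum1_card card_ord.
apply: leq_sum => j _; rewrite subSS.
case: asboolP => // Xj; case: asboolP => // Xj'; case: nX.
have jn : (j <= n)%N by rewrite -ltnS.
by have := XD _ _ Xj Xj'; rewrite subnKC.
Qed.

Lemma conductor_le S n : numerical_semigroup S -> (2 * genus S <= n)%N -> S n.
Proof.
move=> nS gn; case: (nS) => _ SD _; apply: half_dense_mem SD _.
by have := leq_cnt_genus n.+1 nS; lia.
Qed.

(** Additivity propagates the agreement: past [2 * genus S + 1], more than half
    of the smaller numbers are common elements, so that [half_dense_mem]
    applies. *)
Lemma semigroup_eq S X : numerical_semigroup S ->
  (forall x y, X x -> X y -> X (x + y)%N) ->
  (forall n, (n <= (2 * genus S).+1)%N -> X n <-> S n) -> X = S.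
Proof.
move=> nS XD XS; apply/seteqP; suff E n : X n <-> S n by split=> n /E.
have [m] := ubnP n; elim: m n => // m IH n; rewrite ltnS => nm.
have [/XS//|ng] := leqP n (2 * genus S).+1.
have Sn : S n by apply: conductor_le => //; lia.
split=> // _; apply: half_dense_mem XD _.
have := leq_cnt_genus n nS; rewrite cntS (@eq_cnt X S) => [|j jn]; first lia.
by apply: IH; lia.
Qed.

Lemma semigroup_mul S n x : S 0%N -> (forall x y, S x -> S y -> S (x + y)%N) ->
  S x -> S (n * x)%N.
Proof. by move=> S0 SD Sx; elim: n => // n IH; rewrite mulSn; exact: SD. Qed.

Lemma coprime_repr a b n : coprime a b -> (0 < a)%N -> (0 < b)%N -> (a * b <= n)%N ->
  exists y z, (y < b)%N /\ n = (y * a + z * b)%N.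
Proof.
(* [w] is the multiple of [a] below [a * b] that is congruent to [n] modulo
   [b]. *)
move=> cab a0 b0 abn; pose w := (chinese a b 0 n %% (a * b))%N.
have wab : (w < a * b)%N by rewrite ltn_mod muln_gt0 a0.
have wa : (w = 0 %[mod a])%N by rewrite modn_dvdm ?dvdn_mulr // chinese_modl.
have wb : (w = n %[mod b])%N by rewrite modn_dvdm ?dvdn_mull // chinese_modr.
have /dvdnP[y wy] : (a %| w)%N by rewrite /dvdn wa mod0n.
have wn : (w <= n)%N by lia.
have /dvdnP[z nz] : (b %| n - w)%N by rewrite -eqn_mod_dvd // wb.
exists y, z; split; last by rewrite -wy -nz subnKC.
by rewrite -(ltn_pmul2r a0) -wy mulnC.
Qed.

(** A number [n] is congruent to a small multiple [x * (a * b)] modulo [c], and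
    the quotient of the difference by [c] is large enough to be a combination of
    [a] and [b]. *)
Lemma semigroup_cofinite S a b c : S 0%N -> (forall x y, S x -> S y -> S (x + y)%N) ->
  S (a * b)%N -> S (a * c)%N -> S (b * c)%N ->
  (0 < a)%N -> (0 < b)%N -> (0 < c)%N ->
  coprime a b -> coprime a c -> coprime b c -> numerical_semigroup S.
Proof.
move=> S0 SD Sab Sac Sbc a0 b0 c0 cab cac cbc; split=> //.
apply: (@sub_finite_set _ _ `I_(2 * (a * b * c))); last exact: finite_II.
move=> n; apply: contraPP => /= /negP; rewrite -leqNgt => nN; apply.
have cabc : coprime (a * b) c by rewrite coprimeMl cac.
have abcn : (a * b * c <= n)%N by apply: leq_trans nN; lia.
have ab0 : (0 < a * b)%N by rewrite muln_gt0 a0.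
have [x [z [xc nE]]] := coprime_repr cabc ab0 c0 abcn.
have abz : (b * a <= z)%N.
  rewrite -(leq_pmul2r c0); move: nN; rewrite nE.
  suff : (x * (a * b) <= c * (a * b))%N by lia.
  by rewrite leq_mul2r (ltnW xc) orbT.
have cba : coprime b a by rewrite coprime_sym.
have [y [w [_ zE]]] := coprime_repr cba b0 a0 abz.
rewrite nE zE mulnDl -!(mulnA _ _ c).
have SM := semigroup_mul _ S0 SD.
by apply: (SD _ _ (SM _ _ Sab) (SD _ _ (SM _ _ Sbc) (SM _ _ Sac))).
Qed.

End NumericalSemigroup.

(** Below [a * b * c] there are at most as many values as monomials of weight
    less than [a * b * c], that is [tetra a b c]; all the other numbers below
    [a * b * c] are gaps. *)
Lemma genus_lower_bound (K : fieldType) (a b c : nat) (f : 'I_3 -> fps K) :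
  let r := [tuple (a * b)%N; (a * c)%N; (b * c)%N] in
  (4 <= a)%N -> (a < b)%N -> (b < c)%N ->
  coprime a b -> coprime a c -> numerical_semigroup (value_semigroup f) ->
  (forall i, fps_val (f i) (tnth r i)) ->
  (a * b + a * c + b * c < genus (value_semigroup f))%N.
Proof.
move=> r a4 ab bc cab cac nS fr.
have r0 i : (0 < tnth r i)%N.
  by rewrite (tnth_nth 0%N); case: i => [[|[|[|]]]] //= _; rewrite muln_gt0; lia.
have [N NE] : exists N, (a * b * c)%N = N.+1.
  by exists (a * b * c).-1; rewrite prednK // !muln_gt0; lia.
have T := tetra_lt a4 ab bc cab cac.
suff cntT : (cnt (value_semigroup f) N.+1 <= tetra a b c)%N.
  by have := leq_cnt_genus N.+1 nS; rewrite -NE in cntT *; lia.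
apply: leq_trans (cnt_value_semigroup_le N r0 (fun i => (fr i).2)) _.
pose A := [set t : 'I_a * ('I_b * 'I_c) | (t.2.2 * (a * b) + (t.2.1 * (a * c) + t.1 * (b * c)) < a * b * c)%N]%SET.
have -> : tetra a b c = #|A|.
  rewrite /tetra /A -sum1dep_card [RHS]big_mkcond /=.
  under eq_bigr => z _ do rewrite pair_bigA /=.
  by rewrite pair_bigA /=; apply: eq_bigr => t _; case: ltnP.
pose psi (t : 'I_a * ('I_b * 'I_c)) : {ffun 'I_3 -> 'I_N.+1} :=
  [ffun i : 'I_3 => inord (nth 0%N [:: (t.2.2 : nat); (t.2.1 : nat); (t.1 : nat)] (i : nat))].
apply: leq_trans (leq_imset_card psi A); apply/subset_leq_card/fintype.subsetP => e.
rewrite inE !big_ord_recl big_ord0 /= !(tnth_nth 0%N) /= addn0 => eN.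
have {}eN : (e ord0 * (a * b) + (e (lift ord0 ord0) * (a * c) +
    e (lift ord0 (lift ord0 ord0)) * (b * c)) < a * b * c)%N.
  by rewrite NE ltnS; apply: leq_trans eN; apply/eq_leq; ring.
have x_lt : (e ord0 < c)%N.
  by rewrite -(@ltn_pmul2r (a * b)) ?muln_gt0; lia.
have y_lt : (e (lift ord0 ord0) < b)%N.
  by rewrite -(@ltn_pmul2r (a * c)) ?muln_gt0; lia.
have z_lt : (e (lift ord0 (lift ord0 ord0)) < a)%N.
  by rewrite -(@ltn_pmul2r (b * c)) ?muln_gt0; lia.
apply/imsetP; exists (Ordinal z_lt, (Ordinal y_lt, Ordinal x_lt)); first by rewrite inE.
apply/ffunP => i; rewrite ffunE; apply: val_inj => /=.
case: i => [[|[|[|]]]] //= i3; rewrite inordK //;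
by congr (nat_of_ord (e _)); apply: val_inj.
Qed.

(** * Binary forms and products of forms *)

Section Homogenization.
Variables (K : comNzRingType) (A : comNzRingType) (phi : {rmorphism K -> A}).

(** The value at [(u, v)] of the binary form of degree [n] whose
    dehomogenization, at [v = 1], is [P]. *)
Definition homog_eval n (P : {poly K}) (u v : A) : A :=
  \sum_(j < n.+1) phi P`_j * (u ^+ j * v ^+ (n - j)).

Lemma homog_evalD n P Q u v :
  homog_eval n (P + Q) u v = homog_eval n P u v + homog_eval n Q u v.
Proof.
rewrite /homog_eval -big_split /=; apply: eq_bigr => j _.
by rewrite coefD rmorphD mulrDl.
Qed.

Lemma homog_eval0 n u v : homog_eval n 0 u v = 0.
Proof. by rewrite /homog_eval big1 // => j _; rewrite coef0 rmorph0 mul0r. Qed.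

Lemma homog_evalZ n c P u v : homog_eval n (c *: P) u v = phi c * homog_eval n P u v.
Proof.
rewrite /homog_eval mulr_sumr; apply: eq_bigr => j _.
by rewrite coefZ rmorphM -!mulrA.
Qed.

Lemma homog_eval_sum n I (s : seq I) (Q : pred I) (P : I -> {poly K}) u v :
  homog_eval n (\sum_(i <- s | Q i) P i) u v = \sum_(i <- s | Q i) homog_eval n (P i) u v.
Proof.
by apply: (big_morph (fun P => homog_eval n P u v)) => [P1 P2|]; rewrite ?homog_evalD ?homog_eval0.
Qed.

Lemma homog_evalXn n i u v : (i <= n)%N ->
  homog_eval n 'X^i u v = u ^+ i * v ^+ (n - i).
Proof.
move=> iN; rewrite /homog_eval (bigD1 (Ordinal (iN : (i < n.+1)%N))) //=.
rewrite coefXn eqxx rmorph1 mul1r big1 ?addr0 // => j ji.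
rewrite coefXn; case: eqP => [e|_]; last by rewrite rmorph0 mul0r.
by case/eqP: ji; apply: val_inj; rewrite /= e.
Qed.

Lemma homog_evalM n n' (P Q : {poly K}) u v : (size P <= n.+1)%N -> (size Q <= n'.+1)%N ->
  homog_eval (n + n') (P * Q) u v = homog_eval n P u v * homog_eval n' Q u v.
Proof.
move=> sP sQ.
have polyE k (R : {poly K}) : (size R <= k)%N -> R = \sum_(i < k) R`_i *: 'X^i.
  move=> sR; rewrite -poly_def; apply/polyP => i; rewrite coef_poly.
  by case: ltnP => // ki; rewrite nth_default // (leq_trans sR).
rewrite {1}(polyE _ _ sP) {1}(polyE _ _ sQ) mulr_suml homog_eval_sum.
rewrite [homog_eval n P u v]/homog_eval mulr_suml; apply: eq_bigr => i _.
rewrite mulr_sumr homog_eval_sum [homog_eval n' Q u v]/homog_eval mulr_sumr.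
apply: eq_bigr => j _.
rewrite -scalerAl -scalerAr -exprD !homog_evalZ homog_evalXn; last first.
  by apply: leq_add; rewrite -ltnS.
have -> : (n + n' - (i + j) = (n - i) + (n' - j))%N.
  by have := ltn_ord i; have := ltn_ord j; lia.
by rewrite !exprD; ring.
Qed.

End Homogenization.

Section Forms.
Variables (n d : nat).

Definition form (K : comNzRingType) (F : 'M[K]_(n.+1, d.+1)) (k : 'I_n.+1) : {poly K} :=
  rVpoly (row k F).

Definition form_prod (K : comNzRingType) (F : 'M[K]_(n.+1, d.+1)) m
    (s : {ffun 'I_m -> 'I_n.+1}) : {poly K} :=
  \prod_(k < m) form F (s k).

Definition hilbert_mx (K : comNzRingType) (F : 'M[K]_(n.+1, d.+1)) m :
    'M[K]_(#|{ffun 'I_m -> 'I_n.+1}|, (m * d).+1) :=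
  \matrix_(s < #|{ffun 'I_m -> 'I_n.+1}|) poly_rV (form_prod F (enum_val s)).

Lemma form_coef (K : comNzRingType) (F : 'M[K]_(n.+1, d.+1)) k (j : 'I_d.+1) :
  (form F k)`_j = F k j.
Proof. by rewrite coef_rVpoly_ord mxE. Qed.

Lemma size_form (K : comNzRingType) (F : 'M[K]_(n.+1, d.+1)) k :
  (size (form F k) <= d.+1)%N.
Proof. exact: size_poly. Qed.

Lemma size_form_prod (K : comNzRingType) (F : 'M[K]_(n.+1, d.+1)) m s :
  (size (@form_prod K F m s) <= (m * d).+1)%N.
Proof.
rewrite /form_prod; elim: m s => [|m IH] s; first by rewrite big_ord0 size_poly1.
rewrite big_ord_recl; apply: leq_trans (size_polyMleq _ _) _.
have := IH [ffun k => s (lift ord0 k)].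
rewrite (eq_bigr (fun k => form F (s (lift ord0 k)))) => [h|k _]; last by rewrite ffunE.
apply: (@leq_trans (d.+1 + (m * d).+1).-1); last by rewrite mulSn; lia.
by rewrite -!subn1 leq_sub2r // leq_add // size_form.
Qed.

Lemma map_hilbert_mx (K L : comNzRingType) (phi : {rmorphism K -> L})
    (F : 'M[K]_(n.+1, d.+1)) m :
  map_mx phi (hilbert_mx F m) = hilbert_mx (map_mx phi F) m.
Proof.
have formE k : map_poly phi (form F k) = form (map_mx phi F) k.
  apply/polyP => j; rewrite coef_map !coef_rVpoly.
  case: insub => [l|]; last exact: rmorph0.
  by rewrite !mxE.
apply/matrixP => s j; rewrite !mxE -coef_map rmorph_prod /form_prod.
by rewrite (eq_bigr _ (fun k _ => formE (enum_val s k))).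
Qed.

Variable K : fieldType.
Implicit Types (F : 'M[K]_(n.+1, d.+1)) (P Q : {poly K}).

Lemma hilbert_functionE F m : hilbert_function F m = \rank (hilbert_mx F m).
Proof. by []. Qed.

(** The part of degree [m] of the homogeneous coordinate ring of the image,
    dehomogenized. *)
Definition span_prod F m P : Prop :=
  exists c : {ffun 'I_m -> 'I_n.+1} -> K, P = \sum_(s : {ffun 'I_m -> 'I_n.+1}) c s *: form_prod F s.

Lemma span_prod_gen F m (s : {ffun 'I_m -> 'I_n.+1}) : span_prod F m (form_prod F s).
Proof.
exists (fun t => (t == s)%:R); rewrite (bigD1 s) //= eqxx scale1r big1 ?addr0 //.
by move=> t /negPf ->; rewrite scale0r.
Qed.

Lemma span_prod0 F m : span_prod F m 0.
Proof. by exists (fun=> 0); rewrite big1 // => s _; rewrite scale0r. Qed.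

Lemma span_prodD F m P Q : span_prod F m P -> span_prod F m Q -> span_prod F m (P + Q).
Proof.
move=> [c ->] [e ->]; exists (fun s => c s + e s).
by rewrite -big_split; apply: eq_bigr => s _; rewrite scalerDl.
Qed.

Lemma span_prodZ F m a P : span_prod F m P -> span_prod F m (a *: P).
Proof.
move=> [c ->]; exists (fun s => a * c s).
by rewrite scaler_sumr; apply: eq_bigr => s _; rewrite scalerA.
Qed.

Lemma span_prod_sum F m I (s : seq I) (Q : pred I) (P : I -> {poly K}) :
  (forall i, Q i -> span_prod F m (P i)) -> span_prod F m (\sum_(i <- s | Q i) P i).
Proof.
by move=> Ps; apply: big_ind => //; [exact: span_prod0 | exact: span_prodD].
Qed.

Lemma size_span_prod F m P : span_prod F m P -> (size P <= (m * d).+1)%N.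
Proof.
case=> c ->; apply: (big_ind (fun P => (size P <= (m * d).+1)%N)).
- by rewrite size_poly0.
- by move=> P1 P2 s1 s2; apply: leq_trans (size_polyD _ _) _; rewrite geq_max s1.
- by move=> s _; apply: leq_trans (size_scale_leq _ _) (size_form_prod _ _).
Qed.

Lemma span_prodM F m k P : span_prod F m P -> span_prod F m.+1 (form F k * P).
Proof.
case=> c ->; rewrite mulr_sumr; apply: span_prod_sum => s _.
rewrite -scalerAr; apply: span_prodZ.
pose t : {ffun 'I_m.+1 -> 'I_n.+1} := [ffun i => if unlift ord0 i is Some j then s j else k].
suff -> : form F k * form_prod F s = form_prod F t by exact: span_prod_gen.
rewrite /form_prod big_ord_recl ffunE unlift_none; congr (_ * _).
by apply: eq_bigr => j _; rewrite ffunE liftK.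
Qed.

Lemma span_prodS_ex F m P : span_prod F m.+1 P ->
  exists2 Q : 'I_n.+1 -> {poly K}, (forall k, span_prod F m (Q k)) &
    P = \sum_k form F k * Q k.
Proof.
case=> c ->.
pose tl (s : {ffun 'I_m.+1 -> 'I_n.+1}) : {ffun 'I_m -> 'I_n.+1} :=
  [ffun j => s (lift ord0 j)].
exists (fun k => \sum_(s : {ffun 'I_m.+1 -> 'I_n.+1} | s ord0 == k) c s *: form_prod F (tl s)).
  by move=> k; apply: span_prod_sum => s _; apply/span_prodZ/span_prod_gen.
under [RHS]eq_bigr => k _ do rewrite mulr_sumr.
rewrite (partition_big (fun s : {ffun 'I_m.+1 -> 'I_n.+1} => s ord0) xpredT) //=.
apply: eq_bigr => k _; apply: eq_bigr => s /eqP <-.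
rewrite -scalerAr /form_prod big_ord_recl; congr (_ *: (_ * _)).
by apply: eq_bigr => j _; rewrite ffunE.
Qed.

Lemma span_prod_sub F m P : (size P <= (m * d).+1)%N ->
  span_prod F m P <-> (poly_rV P <= hilbert_mx F m)%MS.
Proof.
move=> sP; split=> [[c PE]|/submxP[D PE]].
  rewrite PE linear_sum; apply: summx_sub => s _; rewrite linearZ; apply: scalemx_sub.
  by apply: (eq_row_sub (enum_rank s)); rewrite rowK enum_rankK.
exists (fun s => D 0 (enum_rank s)); rewrite -[LHS](poly_rV_K sP) PE mulmx_sum_row linear_sum.
rewrite (reindex (@enum_rank _)) /=; last by apply: onW_bij; exact: enum_rank_bij.
by apply: eq_bigr => s _; rewrite linearZ /= rowK enum_rankK poly_rV_K ?size_form_prod.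
Qed.

Lemma leads_hilbert F m j : leads (hilbert_mx F m) j <->
  exists2 P, span_prod F m P & pval P j.
Proof.
split=> [[v vH vj]|[P PW Pj]].
  by exists (rVpoly v) => //; apply/span_prod_sub; rewrite ?size_poly // rVpolyK.
have sP := size_span_prod PW; exists (poly_rV P); first exact/span_prod_sub.
by rewrite poly_rV_K.
Qed.

(** The order of a row is raised step by step, subtracting a multiple of an
    element of the row space with the same order. *)
Lemma leads_conductor p q (M : 'M[K]_(p, q)) c :
  (forall j, (c <= j < q)%N -> leads M j) ->
  forall v : 'rV_q, (forall i, (i < c)%N -> (rVpoly v)`_i = 0) -> (v <= M)%MS.
Proof.
move=> Mc v; have [k] := ubnP (q - c); elim: k c Mc v => // k IH c Mc v.
rewrite ltnS => qck vc; have [qc|cq] := leqP q c.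
  rewrite (_ : v = 0) ?sub0mx //; apply/rowP => i; rewrite -coef_rVpoly_ord mxE.
  by apply: vc; apply: leq_trans qc.
have [w wM [wc w0]] := Mc c (introT andP (conj (leqnn c) cq)).
pose u := v - ((rVpoly v)`_c / (rVpoly w)`_c) *: w.
have -> : v = u + ((rVpoly v)`_c / (rVpoly w)`_c) *: w by rewrite subrK.
apply: addmx_sub (scalemx_sub _ wM); apply: (IH c.+1) => [j /andP[cj jq]||i].
- by apply: Mc; rewrite ltnW.
- lia.
rewrite ltnS leq_eqVlt linearB linearZ /= coefB coefZ => /predU1P[->|ic].
  by rewrite divfK // subrr.
by rewrite (vc _ ic) (w0 _ ic) mulr0 subrr.
Qed.

Lemma homog_eval_form_prod (A : comNzRingType) (phi : {rmorphism K -> A}) F m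
    (s : {ffun 'I_m -> 'I_n.+1}) u v :
  homog_eval phi (m * d) (form_prod F s) u v =
  \prod_k homog_eval phi d (form F (s k)) u v.
Proof.
rewrite /form_prod; elim: m s => [|m IH] s.
  by rewrite !big_ord0 -(expr0 'X) homog_evalXn // !expr0 mulr1.
rewrite !big_ord_recl mulSn homog_evalM ?size_form //.
  congr (_ * _); have := IH [ffun k => s (lift ord0 k)].
  rewrite (eq_bigr (fun k => form F (s (lift ord0 k)))) => [->|k _]; last by rewrite ffunE.
  by apply: eq_bigr => k _; rewrite ffunE.
have := size_form_prod F [ffun k => s (lift ord0 k)]; rewrite /form_prod.
by rewrite (eq_bigr (fun k => form F (s (lift ord0 k)))) => [|k _]; rewrite ?ffunE.
Qed.

Lemma mor_evalE F (q : 'cV[K]_2) k :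
  mor_eval F q k 0 = homog_eval idfun d (form F k) (q 0 0) (q 1 0).
Proof.
by rewrite mxE; apply: eq_bigr => j _; rewrite form_coef mxE.
Qed.

Lemma expandE F (p q : 'cV[K]_2) k :
  expand F p q k 0 = fps_of_poly (homog_eval polyC d (form F k)
    ((p 0 0)%:P + q 0 0 *: 'X) ((p 1 0)%:P + q 1 0 *: 'X)).
Proof.
rewrite !mxE; congr fps_of_poly.
by apply: eq_bigr => j _; rewrite !mxE form_coef.
Qed.

Lemma expand_mull (A : 'M[K]_n.+1) F p q k :
  expand (A *m F) p q k 0 = \sum_j fpsC (A k j) * expand F p q j 0.
Proof.
rewrite expandE; under [RHS]eq_bigr => j _ do rewrite expandE /fpsC -rmorphM.
rewrite -[RHS]raddf_sum; congr fps_of_poly.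
rewrite -[RHS](eq_bigr _ (fun j _ => homog_evalZ polyC d (A k j) (form F j) _ _)).
rewrite -homog_eval_sum; congr (homog_eval _ _ _ _ _).
apply/polyP => j; rewrite coef_sum; under eq_bigr do rewrite coefZ.
case: (ltnP j d.+1) => jd; last first.
  rewrite nth_default ?(leq_trans (size_form _ _)) // big1 // => i _.
  by rewrite nth_default ?mulr0 // (leq_trans (size_form _ _)).
rewrite -[j]/(val (Ordinal jd)) form_coef mxE.
by apply: eq_bigr => i _; rewrite form_coef.
Qed.

End Forms.

(** * Curves in the Severi variety *)

Definition pt (K : Type) (u v : K) : 'cV[K]_2 := \col_i (if i == 0 then u else v).

Lemma homog_eval_X (K : comNzRingType) n (P : {poly K}) : (size P <= n.+1)%N ->
  homog_eval polyC n P 'X 1 = P.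
Proof.
move=> sP; rewrite /homog_eval; apply/polyP => j.
rewrite (eq_bigr (fun j : 'I_n.+1 => P`_j *: 'X^j)) => [|i _]; last first.
  by rewrite expr1n mulr1 mul_polyC.
rewrite -poly_def coef_poly; case: ltnP => // nj.
by rewrite nth_default // (leq_trans sP).
Qed.

Lemma row_mx2_unit (K : fieldType) (p q : 'cV[K]_2) :
  p 0 0 * q 1 0 - p 1 0 * q 0 0 != 0 -> row_mx p q \in unitmx.
Proof.
move=> D0; pose M : 'M[K]_2 := \matrix_(i, j) if j == 0 then p i 0 else q i 0.
have -> : row_mx p q = M.
  apply/matrixP => i j; rewrite !mxE; case: splitP => k; rewrite !ord1 => jk.
    by rewrite (_ : j = 0) //; apply: val_inj.
  by rewrite (_ : j = 1) //; apply: val_inj.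
rewrite unitmxE unitfE (expand_det_col _ 0) !big_ord_recl big_ord0.
rewrite /cofactor !det_mx11 !mxE /= addr0 expr0 mul1r expr1 mulN1r mulrN.
have e1 : lift ord0 (0 : 'I_1) = 1 :> 'I_2 by apply: val_inj.
have e0 : lift (1 : 'I_2) (0 : 'I_1) = 0 by apply: val_inj.
by rewrite !e1 e0.
Qed.

Section Transfer.
Variable K : fieldType.

(** A homogeneous expression of degree [m] in the [y k] is divisible by
    [y0 ^ m], with a polynomial in the affine coordinates [x] as quotient. *)
Lemma prod_transfer n n' m (y : 'I_n -> fps K) (x : 'I_n' -> fps K)
    (g : 'I_n -> {mpoly K[n']}) (y0 : fps K) (c : {ffun 'I_m -> 'I_n} -> K) :
  (forall k, y k = y0 * fps_eval x (g k)) ->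
  \sum_(s : {ffun 'I_m -> 'I_n}) fpsC (c s) * \prod_k y (s k) =
  y0 ^+ m * fps_eval x (\sum_(s : {ffun 'I_m -> 'I_n}) c s *: \prod_k g (s k)).
Proof.
move=> yg; rewrite fps_eval_sum mulr_sumr; apply: eq_bigr => s _.
rewrite -mul_mpolyC fps_evalM fps_evalC fps_eval_prod mulrCA; congr (_ * _).
under eq_bigr do rewrite yg; rewrite big_split /=; congr (_ * _).
by rewrite prodr_const card_ord.
Qed.

Lemma fps_of_poly_sum I (s : seq I) (Q : pred I) (P : I -> {poly K}) :
  fps_of_poly (\sum_(i <- s | Q i) P i) = \sum_(i <- s | Q i) fps_of_poly (P i).
Proof. exact: raddf_sum. Qed.

Lemma fps_of_polyM (P Q : {poly K}) :
  fps_of_poly (P * Q) = fps_of_poly P * fps_of_poly Q.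
Proof. exact: rmorphM. Qed.

Lemma fps_of_polyZ c (P : {poly K}) : fps_of_poly (c *: P) = fpsC c * fps_of_poly P.
Proof. by rewrite -mul_polyC rmorphM. Qed.

Lemma fps_of_poly_prod I (s : seq I) (Q : pred I) (P : I -> {poly K}) :
  fps_of_poly (\prod_(i <- s | Q i) P i) = \prod_(i <- s | Q i) fps_of_poly (P i).
Proof. exact: rmorph_prod. Qed.

Lemma pval_fps (P : {poly K}) j : pval P j <-> fps_val (fps_of_poly P) j.
Proof. by split=> -[Pj P0]; split=> //; apply/eqP. Qed.

End Transfer.

Lemma homog_eval_horner (K : comNzRingType) n (P U V : {poly K}) z :
  (homog_eval polyC n P U V).[z] = homog_eval idfun n P U.[z] V.[z].
Proof.
rewrite /homog_eval horner_sum; apply: eq_bigr => j _.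
by rewrite hornerM hornerC hornerM !horner_exp.
Qed.

Section Cusp.
Variables (K : fieldType) (n d : nat).
Implicit Types F : 'M[K]_(n.+1, d.+1).

Lemma expand_cusp F k :
  expand F (pt 0 1) (pt 1 0) k 0 = fps_of_poly (form F k).
Proof.
by rewrite expandE !mxE /= scale1r scale0r add0r addr0 homog_eval_X ?size_form.
Qed.

Lemma expand_coef0 F p q k : expand F p q k 0 0%N = mor_eval F p k 0.
Proof.
rewrite expandE /= -horner_coef0 homog_eval_horner mor_evalE.
by rewrite !hornerE.
Qed.

Lemma span_prod_affine F (x : 'I_n -> fps K) m P :
  (forall i, x i * fps_of_poly (form F 0) = fps_of_poly (form F (lift ord0 i))) ->
  span_prod F m P ->
  exists G, fps_of_poly P = fps_of_poly (form F 0) ^+ m * fps_eval x G.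
Proof.
move=> xF [c ->]; pose g k : {mpoly K[n]} := if unlift ord0 k is Some i then 'X_i else 1.
exists (\sum_(s : {ffun 'I_m -> 'I_n.+1}) c s *: \prod_k g (s k)).
rewrite -(prod_transfer (y := fun k => fps_of_poly (form F k))) => [|k].
  by rewrite fps_of_poly_sum; apply: eq_bigr => s _; rewrite fps_of_polyZ fps_of_poly_prod.
rewrite /g; case: unliftP => [i ->|->]; first by rewrite fps_evalXU -xF mulrC.
by rewrite fps_evalE rmorph1 mulr1.
Qed.

Lemma affine_coordinates F : F 0 0 != 0 -> exists x : 'I_n -> fps K,
  forall i, x i * fps_of_poly (form F 0) = fps_of_poly (form F (lift ord0 i)).
Proof.
move=> F00; have f0 : fps_of_poly (form F 0) 0%N != 0.
  by rewrite /= -[0%N]/(val (0 : 'I_d.+1)) form_coef.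
have H (i : 'I_n) : exists y : fps K,
    y * fps_of_poly (form F 0) = fps_of_poly (form F (lift ord0 i)).
  exact: fps_unit_div.
by have [x xP] := boolp.choice H; exists x.
Qed.

(* Two opposite bounds: [Smax], from above, is a property of generic semigroups,
   and [rankF], from below, an open condition on the curve. *)
Variables (r : n.-tuple nat) (S : set nat) (m : nat) (F : 'M[K]_(n.+1, d.+1)).
Hypothesis nS : numerical_semigroup S.
Hypothesis gd : (2 * genus S <= d)%N.
Hypothesis d0 : (0 < d)%N.
Hypothesis m2 : (2 <= m)%N.
Hypothesis r2 : forall i, (2 <= tnth r i)%N.
Hypothesis Smax : forall x : 'I_n -> fps K, (forall i, fps_val (x i) (tnth r i)) ->
  forall k, (cnt (value_semigroup x) k <= cnt S k)%N.
Hypothesis F00 : F 0 0 != 0.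
Hypothesis Fr : forall i, pval (form F (lift ord0 i)) (tnth r i).
Hypothesis rankF : forall k, (k <= (m * d).+1)%N ->
  (cnt S k <= \rank (hilbert_mx F m *m (pid_mx k : 'M_((m * d).+1))))%N.

Let f k := fps_of_poly (form F k).

Let f00 : f 0 0%N != 0.
Proof. by rewrite /f /= -[0%N]/(val (0 : 'I_d.+1)) form_coef. Qed.

Let f0X k : (f 0 ^+ k) 0%N != 0.
Proof.
elim: k => [|k IH]; first by rewrite expr0 oner_neq0.
by rewrite exprS fpsM big_ord1 mulf_neq0.
Qed.

Variable x : 'I_n -> fps K.
Hypothesis xF : forall i, x i * f 0 = f (lift ord0 i).

Let xr i : fps_val (x i) (tnth r i).
Proof.
have /pval_fps := Fr i; rewrite -/(f _) -xF mulrC.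
by move/(fps_val_unitl _ _ f00).
Qed.

Let span_value k P j : span_prod F k P -> pval P j -> value_semigroup x j.
Proof.
move=> /(span_prod_affine xF)[G PE] /pval_fps; rewrite PE.
by move/(fps_val_unitl _ _ (f0X k)); exists G.
Qed.

(* Every order realized by a product of forms is a value of the branch: the
   three numbers are squeezed between [rankF] and [Smax]. *)
Let cnt_leads k : (k <= (m * d).+1)%N ->
  cnt (leads (hilbert_mx F m)) k = cnt S k /\ cnt (value_semigroup x) k = cnt S k.
Proof.
move=> km; have := rankF km; rewrite rank_pid_leads // => le1.
have le3 := Smax xr k.
suff le2 : (cnt (leads (hilbert_mx F m)) k <= cnt (value_semigroup x) k)%N by lia.
by apply: cnt_subset => j _ /leads_hilbert[P PW Pj]; exact: (span_value PW Pj).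
Qed.

Let md_gt : ((2 * genus S).+1 <= m * d)%N.
Proof. by move: gd d0 m2; nia. Qed.

Let leads_S j : (j <= m * d)%N -> leads (hilbert_mx F m) j <-> S j.
Proof.
move=> jm; have [|l1 _] := @cnt_leads j; first lia.
have [|l2 _] := @cnt_leads j.+1; first lia.
by move: l2; rewrite !cntS l1; case: asboolP => ?; case: asboolP => ?; split=> //; lia.
Qed.

Let value_S : value_semigroup x = S.
Proof.
apply: semigroup_eq nS (@value_semigroupD _ _ _) _ => j jg.
have [|_ l1] := @cnt_leads j; first lia.
have [|_ l2] := @cnt_leads j.+1; first lia.
by move: l2; rewrite !cntS l1; case: asboolP => ?; case: asboolP => ?; split=> //; lia.
Qed.

Let c0 := (2 * genus S)%N.

(* All orders from [c0] on are realized by products of [m] forms. *)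
Let span_conductor (P : {poly K}) : (size P <= (m * d).+1)%N ->
  (forall i, (i < c0)%N -> P`_i = 0) -> span_prod F m P.
Proof.
move=> sP P0; apply/span_prod_sub => //; apply: (@leads_conductor _ _ _ _ c0) => [j /andP[cj jm]|i ic].
  by apply/leads_S; [rewrite -ltnS | exact: conductor_le].
by rewrite poly_rV_K // P0.
Qed.

Let size_Xn_mul (P : {poly K}) k l : (size P + k <= l)%N -> (size ('X^k * P)%R <= l)%N.
Proof.
move=> sP; apply: leq_trans (size_polyMleq _ _) _.
by rewrite size_polyXn; lia.
Qed.

Let split_low (P : {poly K}) k : (forall i, (i < k)%N -> P`_i = 0) ->
  exists2 Q : {poly K}, P = 'X^k * Q & (size Q + k <= maxn (size P) k)%N.
Proof.
move=> P0; exists (drop_poly k P); last by rewrite size_drop_poly; lia.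
rewrite -{1}(poly_take_drop k P) (_ : take_poly k P = 0) ?add0r 1?mulrC //.
by apply/polyP => i; rewrite coef_take_poly coef0; case: ltnP => // /P0.
Qed.

(* Division of [P] by the form number [0] as a power series, stopped at order
   [c0], leaves a polynomial of order at least [c0], hence a combination of
   products of forms. *)
Let bezout_base (P : {poly K}) : (size P <= (m * d).+1)%N ->
  exists2 a : 'I_n.+1 -> {poly K}, (forall k, (size (a k) <= ((m - 1) * d).+1)%N) &
    P = \sum_k form F k * a k.
Proof.
move=> sP; have [y yP] := fps_unit_div (fps_of_poly P) f00.
pose b := \poly_(i < c0) y i.
have sb : (size b <= c0)%N by exact: size_poly.
have c0m : (c0 <= (m - 1) * d)%N.
  by case: (m) m2 => [|[|m']] // _; rewrite subn1 /= mulSn; move: gd; rewrite /c0; lia.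
have mE : (m * d = d + (m - 1) * d)%N by case: (m) m2 => // m' _; rewrite subn1 mulSn.
have sfb : (size (form F 0 * b)%R <= (m * d).+1)%N.
  apply: leq_trans (size_polyMleq _ _) _.
  by have := size_form F 0; move: sb c0m; rewrite mE; lia.
have W0 : span_prod F m (P - form F 0 * b).
  apply: span_conductor => [|i ic].
    by apply: leq_trans (size_polyD _ _) _; rewrite size_polyN geq_max sP.
  apply/eqP; rewrite coefB subr_eq0; apply/eqP.
  rewrite -[LHS]/(fps_of_poly P i) -yP (mulrC y) coefM; apply: eq_bigr => j _.
  by rewrite [b`__]coef_poly ifT //; apply: leq_ltn_trans _ ic; rewrite leq_subr.
have m1 : m = (m - 1).+1 by lia.
rewrite m1 in W0; have [Q QW QE] := span_prodS_ex W0.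
exists (fun k => Q k + (k == 0)%:R *: b).
  move=> k; apply: leq_trans (size_polyD _ _) _; rewrite geq_max.
  rewrite (size_span_prod (QW k)) /=; apply: leq_trans (size_scale_leq _ _) _.
  exact: leq_trans sb (leq_trans c0m (leqnSn _)).
under eq_bigr => k _ do rewrite mulrDr -scalerAr.
rewrite big_split /= -QE [X in _ + X](bigD1 0) // eqxx scale1r big1 /= => [|k /negPf ->].
  by rewrite addr0 subrK.
by rewrite scale0r.
Qed.

(* The forms have no common zero, hence generate every form of large degree. The
   degree is raised by splitting off the constant coefficient. *)
Let bezout k (P : {poly K}) : (size P <= (m * d + k).+1)%N ->
  exists2 a : 'I_n.+1 -> {poly K}, (forall i, (size (a i) <= ((m - 1) * d + k).+1)%N) &
    P = \sum_i form F i * a i.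
Proof.
elim: k P => [|k IH] P sP.
  by rewrite addn0; apply: bezout_base; rewrite addn0 in sP.
have [|a sa aE] := IH (drop_poly 1 P); first by rewrite size_drop_poly; lia.
have [|b sb bE] := IH (take_poly 1 P).
  by apply: leq_trans (size_take_poly _ _) _; lia.
exists (fun i => b i + 'X * a i) => [i|].
  apply: leq_trans (size_polyD _ _) _; rewrite geq_max; apply/andP; split.
    by have := sb i; lia.
  by rewrite -['X]expr1; apply: size_Xn_mul; have := sa i; lia.
under eq_bigr => i _ do rewrite mulrDr mulrCA.
rewrite big_split -mulr_sumr -aE -bE /= -{1}(poly_take_drop 1 P).
by rewrite mulrC expr1.
Qed.

(* A form of degree [k * d] and order at least [c0] is [X ^ c0] times a
   combination of the forms, whose coefficients times [X ^ c0] are forms of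
   lower degree and of order at least [c0] again. *)
Let span_all k : (m <= k)%N ->
  (forall P : {poly K}, (size P <= (k * d).+1)%N -> (forall i, (i < c0)%N -> P`_i = 0) ->
    span_prod F k P) /\
  (forall j, (j < c0)%N -> S j -> exists2 P, span_prod F k P & pval P j).
Proof.
move=> mk; rewrite -(subnKC mk); elim: (k - m)%N => [|l [IHa IHb]].
  rewrite addn0; split=> [|j jc Sj]; first exact: span_conductor.
  by apply/leads_hilbert/leads_S => //; move: jc md_gt; rewrite /c0; lia.
rewrite addnS; split=> [P sP P0|j jc Sj]; last first.
  have [P PW [Pj Pl]] := IHb j jc Sj; exists (form F 0 * P); first exact: span_prodM.
  apply/pval_fps; rewrite rmorphM; apply/(fps_val_unitl _ _ f00).
  exact/pval_fps.
have [Q PE sQ] := split_low P0.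
have lE : ((m + l).+1 * d = m * d + l * d + d)%N by rewrite mulSn mulnDl; lia.
have mE : (m * d = d + (m - 1) * d)%N by case: (m) m2 => // m' _; rewrite subn1 mulSn.
have cmd : (c0 <= d)%N by rewrite /c0.
have [|a sa aE] := @bezout (l * d + d - c0) Q.
  by move: sQ sP; rewrite lE; lia.
rewrite PE aE mulr_sumr; apply: span_prod_sum => i _; rewrite mulrCA.
apply: span_prodM; apply: IHa => [|j jc]; last by rewrite coefXnM jc.
by apply: size_Xn_mul; have := sa i; rewrite mulnDl; lia.
Qed.

(* The orders at the cusp of the elements of degree [k] are the elements of [S]
   up to [k * d]: all of these numbers but [genus S]. *)
Let hilbert_rank k : (m <= k)%N -> (\rank (hilbert_mx F k) + genus S = d * k + 1)%N.
Proof.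
move=> mk; have [Wa Wb] := span_all mk.
have kd : (m * d <= k * d)%N by rewrite leq_mul2r mk orbT.
rewrite rank_leads (@eq_cnt _ S) => [|j jk].
  have [B cB] := genus_cnt nS.
  have cntB l : (cnt S (c0 + l) + genus S = c0 + l)%N.
    have E u : cnt S (c0 + l + u) = (cnt S (c0 + l) + u)%N.
      elim: u => [|u IH]; first by rewrite !addn0.
      rewrite !addnS cntS IH; case: asboolP => [_|[]]; first by rewrite addn1.
      by apply: conductor_le => //; rewrite -addnA leq_addr.
    by have := cB (c0 + l + B)%N; rewrite E; lia.
  have [l lE] : exists l, ((k * d).+1 = c0 + l)%N.
    by exists ((k * d).+1 - c0)%N; move: md_gt kd; rewrite /c0; lia.
  by rewrite lE cntB -lE mulnC addn1.
split=> [/leads_hilbert[P PW Pj]|Sj].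
  by rewrite -value_S; exact: (span_value PW Pj).
apply/leads_hilbert; have [/Wb|cj] := ltnP j c0; first exact.
exists 'X^j; last by split=> [|i ij]; rewrite coefXn ?eqxx ?oner_neq0 // ltn_eqF.
by apply: Wa => [|i ic]; rewrite ?size_polyXn // coefXn ltn_eqF // (leq_trans ic).
Qed.

Let span_Xn j : (c0 <= j <= m * d)%N -> span_prod F m 'X^j.
Proof.
move=> /andP[cj jm]; apply: span_conductor => [|i ic]; first by rewrite size_polyXn.
by rewrite coefXn ltn_eqF // (leq_trans ic).
Qed.

(* At [(u', v')] this form takes the value
   [u' ^ (m * d - 1) * (v * u' - u * v')]: outside the cusp [u' = 0] it vanishes
   at the point [(u, v)] only, and there to first order. It is a combination of
   products of forms, so it separates [(u, v)] from the other points and shows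
   that the branch is smooth. *)
Let sep (u v : K) : {poly K} := v *: 'X^(m * d) - u *: 'X^(m * d - 1).

Let sep_span u v : span_prod F m (sep u v).
Proof.
rewrite /sep -scaleNr; apply: span_prodD; apply: span_prodZ; apply: span_Xn;
by move: md_gt; rewrite /c0; lia.
Qed.

Let homog_sep (A : comNzRingType) (phi : {rmorphism K -> A}) u v u' v' :
  homog_eval phi (m * d) (sep u v) u' v' = u' ^+ (m * d - 1) * (phi v * u' - phi u * v').
Proof.
have md1 : (m * d = (m * d - 1).+1)%N by move: md_gt; lia.
rewrite /sep -scaleNr homog_evalD !homog_evalZ !homog_evalXn ?leq_subr //.
rewrite subnn expr0 mulr1 (_ : (m * d - (m * d - 1) = 1)%N); last by lia.
rewrite {1}md1 exprSr expr1 rmorphN; ring.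
Qed.

Let homog_top (A : comNzRingType) (phi : {rmorphism K -> A}) u v :
  homog_eval phi (m * d) 'X^(m * d) u v = u ^+ (m * d).
Proof. by rewrite homog_evalXn // subnn expr0 mulr1. Qed.

Let span_eval P (q : 'cV[K]_2) : span_prod F m P -> exists c : {ffun 'I_m -> 'I_n.+1} -> K,
  homog_eval idfun (m * d) P (q 0 0) (q 1 0) =
  \sum_(s : {ffun 'I_m -> 'I_n.+1}) c s * \prod_k mor_eval F q (s k) 0.
Proof.
case=> c ->; exists c; rewrite homog_eval_sum; apply: eq_bigr => s _.
rewrite homog_evalZ homog_eval_form_prod; congr (_ * _).
by apply: eq_bigr => k _; rewrite mor_evalE.
Qed.

Let md1_gt0 : (0 < m * d)%N.
Proof. by move: md_gt; lia. Qed.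

Let morphisms_F : @morphisms K n d F.
Proof.
move=> q q0; apply/eqP => Fq0.
have zero P : span_prod F m P -> homog_eval idfun (m * d) P (q 0 0) (q 1 0) = 0.
  move=> /(span_eval q)[c ->]; rewrite big1 // => s _.
  have m0 : (0 < m)%N by lia.
  by rewrite (bigD1 (Ordinal m0)) //= Fq0 mxE mul0r mulr0.
have u0 : q 0 0 = 0.
  have := zero 'X^(m * d); rewrite homog_top => H; apply/eqP.
  have /eqP : q 0 0 ^+ (m * d) = 0.
    by apply: H; apply: span_Xn; move: md_gt; rewrite /c0; lia.
  by rewrite expf_eq0 => /andP[].
have v0 : q 1 0 = 0.
  have := congr1 (fun w : 'cV[K]_n.+1 => w 0 0) Fq0; rewrite mor_evalE mxE u0.
  rewrite /homog_eval (bigD1 0) //= expr0 mul1r subn0 big1 => [|j j0]; last first.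
    by rewrite expr0n (_ : (j == 0%N :> nat) = false) ?mul0r ?mulr0 //; apply/negbTE.
  rewrite addr0 -[0%N]/(val (0 : 'I_d.+1)) form_coef => /eqP.
  by rewrite mulf_eq0 (negPf F00) expf_eq0 => /andP[_ /eqP].
case/eqP: q0; apply/colP => i; rewrite mxE.
by case: i => [[|[|]]] //= i2; [rewrite -u0|rewrite -v0]; congr (q _ _); apply: val_inj.
Qed.

Let scale_eval P q q' c : span_prod F m P -> mor_eval F q' = c *: mor_eval F q ->
  homog_eval idfun (m * d) P (q' 0 0) (q' 1 0) =
  c ^+ m * homog_eval idfun (m * d) P (q 0 0) (q 1 0).
Proof.
move=> [e ->] qq'; rewrite !homog_eval_sum mulr_sumr; apply: eq_bigr => s _.
rewrite !homog_evalZ mulrCA; congr (_ * _); rewrite !homog_eval_form_prod.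
under eq_bigr => k _ do rewrite -mor_evalE qq' mxE.
rewrite big_split prodr_const card_ord /=; congr (_ * _).
by apply: eq_bigr => k _; rewrite mor_evalE.
Qed.

Let colE2 (q q' : 'cV[K]_2) : q 0 0 = q' 0 0 -> q 1 0 = q' 1 0 -> q = q'.
Proof.
move=> e0 e1; apply/colP => i; case: i => [[|[|//]] i2].
  by rewrite (_ : Ordinal i2 = 0) //; apply: val_inj.
by rewrite (_ : Ordinal i2 = 1) //; apply: val_inj.
Qed.

Let span_top : span_prod F m 'X^(m * d).
Proof. by apply: span_Xn; move: md_gt; rewrite /c0; lia. Qed.

Let injective_F (q q' : 'cV[K]_2) : q != 0 -> q' != 0 ->
  same_point (mor_eval F q) (mor_eval F q') -> same_point q q'.
Proof.
move=> q0 q'0 [c c_0 qq']; have top := scale_eval span_top qq'.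
have := scale_eval (sep_span (q 0 0) (q 1 0)) qq'.
rewrite !homog_sep (mulrC (q 1 0) (q 0 0)) subrr !mulr0 => sepq.
rewrite !homog_top in top.
have [u0|u0] := eqVneq (q 0 0) 0.
  have u'0 : q' 0 0 = 0.
    apply/eqP; have /eqP := top; rewrite u0 expr0n (gtn_eqF md1_gt0) mulr0.
    by rewrite expf_eq0 => /andP[].
  have v0 : q 1 0 != 0.
    by apply: contraNneq q0 => v0; apply/eqP/colE2; rewrite mxE.
  have v'0 : q' 1 0 != 0.
    by apply: contraNneq q'0 => v'0; apply/eqP/colE2; rewrite mxE.
  exists (q' 1 0 / q 1 0); first by rewrite mulf_neq0 ?invr_eq0.
  by apply: colE2; rewrite mxE ?u0 ?u'0 ?mulr0 // divfK.
have u'0 : q' 0 0 != 0.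
  apply: contra_neq (_ : c ^+ m * q 0 0 ^+ (m * d) != 0); last first.
    by rewrite mulf_neq0 ?expf_neq0.
  by move=> u'0; rewrite -top u'0 expr0n (gtn_eqF md1_gt0).
exists (q' 0 0 / q 0 0); first by rewrite mulf_neq0 ?invr_eq0.
apply: colE2; rewrite mxE ?divfK //.
move/eqP: sepq; rewrite mulf_eq0 expf_eq0 (negPf u'0) andbF /= subr_eq0 => /eqP e.
by rewrite mulrAC -[q' 0 0 * _]mulrC e mulrAC divff // mul1r.
Qed.

Let off_cusp (q : 'cV[K]_2) : q != 0 -> ~ same_point (pt 0 1) q -> q 0 0 != 0.
Proof.
move=> q0 npq; apply/eqP => u0; apply: npq; exists (q 1 0).
  by apply: contraNneq q0 => v0; apply/eqP/colE2; rewrite mxE.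
by apply: colE2; rewrite !mxE /= ?mulr0 ?mulr1.
Qed.

(* Linear coordinates for which the form number [0] is the only one not
   vanishing at [q] are provided by a base adapted to the column
   [mor_eval F q]. *)
Let smooth_off_cusp (q : 'cV[K]_2) : q != 0 -> ~ same_point (pt 0 1) q -> smooth_branch F q.
Proof.
move=> q0 /(off_cusp q0) u0; set w := mor_eval F q.
have w0 : w != 0 by exact: morphisms_F.
have rw : \rank w = 1%N.
  by apply/eqP; rewrite eqn_leq rank_leq_col lt0n mxrank_eq0.
pose A := invmx (col_ebase w).
have Au : A \in unitmx by rewrite unitmx_inv col_ebase_unit.
have Aw k : (A *m w) k 0 = (k == 0)%:R * row_ebase w 0 0.
  rewrite -{1}(mulmx_ebase w) rw /A !mulmxA mulVmx ?col_ebase_unit // mul1mx.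
  rewrite mxE big_ord1 mxE; congr (_%:R * _); rewrite andbC.
  by case: k => [[|k]].
have e0 : row_ebase w 0 0 != 0.
  by have := row_ebase_unit w; rewrite unitmxE det_mx11 unitfE.
pose y := expand (A *m F) q (pt 0 1).
have y0 k : y k 0 0%N = (A *m w) k 0 by rewrite expand_coef0 /mor_eval -mulmxA.
have y00 : y 0 0 0%N != 0 by rewrite y0 Aw mul1r.
have H (i : 'I_n) : exists z : fps K, z * y 0 0 = y (lift ord0 i) 0 by exact: fps_unit_div.
have [z zP] := boolp.choice H.
exists z.
  exists A, (pt 0 1); split=> // [|i].
    by apply: row_mx2_unit; rewrite !mxE /= mulr1 mulr0 subr0.
  split=> //; apply/eqP; have /eqP := congr1 (fun g : fps K => g 0%N) (zP i).
  by rewrite fpsM big_ord1 y0 Aw mul0r mulf_eq0 (negPf y00) orbF.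
pose g k : {mpoly K[n]} := (invmx A k 0)%:MP + \sum_i invmx A k (lift ord0 i) *: 'X_i.
have yg k : expand F q (pt 0 1) k 0 = y 0 0 * fps_eval z (g k).
  rewrite -[F in LHS](mulKmx Au) expand_mull big_ord_recl /g.
  rewrite fps_evalD fps_evalC fps_eval_sum mulrDr mulr_sumr.
  congr (_ + _); first by rewrite mulrC.
  apply: eq_bigr => i _; rewrite -mul_mpolyC fps_evalM fps_evalC fps_evalXU.
  by rewrite -[expand _ _ _ _ _]/(y _ _) -zP; ring.
have [c cE] := sep_span (q 0 0) (q 1 0).
pose G := \sum_(s : {ffun 'I_m -> 'I_n.+1}) c s *: \prod_k g (s k).
have := prod_transfer c yg; rewrite -/G => GE.
have {}GE : y 0 0 ^+ m * fps_eval z G =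
    fps_of_poly (homog_eval polyC (m * d) (sep (q 0 0) (q 1 0))
      ((q 0 0)%:P + pt 0 1 0 0 *: 'X) ((q 1 0)%:P + pt 0 1 1 0 *: 'X)).
  rewrite -GE cE homog_eval_sum fps_of_poly_sum; apply: eq_bigr => s _.
  rewrite homog_evalZ homog_eval_form_prod fps_of_polyM fps_of_poly_prod.
  congr (_ * _).
  by apply: eq_bigr => k _; rewrite expandE.
have y0m : (y 0 0 ^+ m) 0%N != 0.
  by elim: (m) => [|k IH]; rewrite ?expr0 ?oner_neq0 // exprS fpsM big_ord1 mulf_neq0.
exists G; apply/(fps_val_unitl _ _ y0m); rewrite GE homog_sep.
rewrite (_ : _ * _ = - (q 0 0) ^+ (m * d) *: 'X); last first.
  rewrite !mxE /= scale0r addr0 scale1r -mul_polyC.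
  have mdE : (m * d = (m * d - 1).+1)%N by rewrite subn1 prednK.
  rewrite [X in - _ ^+ X]mdE exprSr polyCN polyCM polyC_exp; ring.
split=> [|i]; rewrite /= coefZ coefX; first by apply/eqP; rewrite mulr1 oppr_eq0 expf_neq0.
by case: i => // _; rewrite mulr0.
Qed.

(* All the forms but the number [0] have order at least [2] at the cusp, so that
   no element of the local ring has valuation [1]. *)
Let not_smooth_cusp : ~ smooth_branch F (pt 0 1).
Proof.
case=> z [A [q]] /=; set y := expand _ _ _ => -[Au _ y00 zy] [G Gz].
pose phi := expand F (pt 0 1) q 0 0.
have low k t : (t < 2)%N -> expand F (pt 0 1) q (lift ord0 k) 0 t = 0.
  move=> t2; rewrite expandE /homog_eval fps_of_poly_sum fps_sum big1 // => j _.
  rewrite !mxE /= add0r; have [jr|rj] := ltnP j (tnth r k).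
    by have [_ ->] := Fr k; rewrite ?mul0r ?coef0.
  rewrite coefCM exprZn -scalerAl coefZ coefXnM ifT ?mulr0 //.
  by apply: leq_trans rj; apply: leq_trans t2 (r2 k).
have yt k t : (t < 2)%N -> y k 0 t = A k 0 * phi t.
  move=> t2; rewrite /y expand_mull big_ord_recl fpsD fps_sum fpsCM.
  by rewrite big1 ?addr0 // => i _; rewrite fpsCM low ?mulr0.
have [A0 phi0] : A 0 0 != 0 /\ phi 0%N != 0.
  by apply/andP; rewrite -negb_or -mulf_eq0 -yt.
have z1 i : z i 1%N = 0.
  have [zi0 zyi] := zy i.
  have Ai : A (lift ord0 i) 0 = 0.
    have := congr1 (fun g : fps K => g 0%N) zyi.
    rewrite fpsM big_ord1 zi0 mul0r yt // => /esym/eqP.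
    by rewrite mulf_eq0 (negPf phi0) orbF => /eqP.
  have := congr1 (fun g : fps K => g 1%N) zyi.
  rewrite fpsM big_ord_recl big_ord1 zi0 mul0r add0r yt // Ai mul0r => /eqP.
  by rewrite mulf_eq0 (negPf y00) orbF => /eqP.
have : fps_eval z G 1%N = 0.
  apply: (@fps_eval_ind _ _ z (fun g => g 1%N = 0)) => //.
  - by move=> c; rewrite /= coefC.
  - by move=> g h g1 h1; rewrite fpsD g1 h1 addr0.
  - move=> g h g1 h1; rewrite fpsM big_ord_recl big_ord1 /= subn0 h1 mulr0 add0r.
    by rewrite g1 mul0r.
by case: Gz.
Qed.

(** The rank condition alone determines the value semigroup, and makes the
    products of [m] forms span all forms of degree [m * d] of order at least
    [2 * genus S] at the cusp. These are numerous enough to separate points and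
    tangents outside the cusp and to compute the Hilbert polynomial. *)
Lemma severi_cusp : sorted ltn r -> @severi K n d (genus S) S r F.
Proof.
move=> sr; split=> //; exists (pt 0 1).
  by apply/eqP => /(congr1 (fun w : 'cV[K]_2 => w 1 0)) /eqP; rewrite !mxE /= oner_eq0.
split; first by split; [exact: injective_F | exact: smooth_off_cusp | exact: not_smooth_cusp].
  by exists d, m => k mk; rewrite hilbert_functionE hilbert_rank.
exists x; split=> //.
exists 1%:M, (pt 1 0); rewrite mul1mx; split=> [|||i].
- exact: unitmx1.
- by apply: row_mx2_unit; rewrite !mxE /= mul0r mul1r sub0r oppr_eq0 oner_eq0.
- by rewrite expand_cusp.
rewrite !expand_cusp; split=> //; have [_ ->] := xr i => //.
exact: leq_trans (r2 i).
Qed.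

End Cusp.

(** * Jets determine the values *)

Lemma repr_digit p c x x' q q' : coprime c p -> (x < c)%N -> (x' < c)%N ->
  (x * p + c * q = x' * p + c * q')%N -> x = x'.
Proof.
wlog xx' : x x' q q' / (x <= x')%N.
  move=> H cp xc x'c e; have [/H h|/ltnW/H h] := leqP x x'; first exact: (h q q').
  by apply/esym; apply: (h q' q).
move=> cp xc x'c e; have : (c %| (x' - x) * p)%N.
  rewrite mulnBl; have -> : (x' * p - x * p = c * q - c * q')%N by lia.
  by rewrite -mulnBr dvdn_mulr.
rewrite Gauss_dvdl // => /dvdnP[[|k] kE]; first lia.
by move: kE; rewrite mulSn; lia.
Qed.

(** In a product of two series of order at least [a], a coefficient of either
    factor is multiplied by coefficients of order at least [a] only. *)
Lemma fps_eq_upto_mul (R : comNzRingType) a N (f f' g g' : fps R) :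
  fps_ord_ge a f -> fps_ord_ge a f' -> fps_ord_ge a g -> fps_ord_ge a g' ->
  fps_eq_upto N f f' -> fps_eq_upto N g g' -> fps_eq_upto (N + a) (f * g) (f' * g').
Proof.
move=> fa f'a ga g'a ff gg l lN; rewrite !fpsM; apply: eq_bigr => i _.
have il : (i <= l)%N by rewrite -ltnS.
have [iN|Ni] := leqP i N; last first.
  by rewrite ga ?g'a ?mulr0 //; lia.
have [lN'|Nl] := leqP (l - i) N; first by rewrite ff ?gg.
by rewrite fa ?f'a ?mul0r //; lia.
Qed.

Section Jets.
Variables (K : fieldType) (a b c : nat).
Hypothesis a2 : (2 <= a)%N.
Hypothesis ab : (a < b)%N.
Hypothesis bc : (b < c)%N.
Hypothesis cab : coprime a b.
Hypothesis cac : coprime a c.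
Hypothesis cbc : coprime b c.

Let r := [tuple (a * b)%N; (a * c)%N; (b * c)%N].

Definition weight (m : 'X_{1..3}) : nat := (\sum_i tnth r i * m i)%N.

Lemma weightE m : weight m =
  (m ord0 * (a * b) + (m (lift ord0 ord0) * (a * c) +
   m (lift ord0 (lift ord0 ord0)) * (b * c)))%N.
Proof.
by rewrite /weight !big_ord_recl big_ord0 /= !(tnth_nth 0%N) /=; lia.
Qed.

(** The weight determines the three exponents modulo [c], [b] and [a], and they
    are less than [c], [b] and [a]. *)
Lemma weight_inj m m' : (weight m < a * b * c)%N -> weight m = weight m' -> m = m'.
Proof.
move=> wl e; have wl' : (weight m' < a * b * c)%N by rewrite -e.
have bound u : (weight u < a * b * c)%N -> [/\ (u ord0 < c)%N,
    (u (lift ord0 ord0) < b)%N & (u (lift ord0 (lift ord0 ord0)) < a)%N].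
  rewrite weightE => h; split.
  - by rewrite -(@ltn_pmul2r (a * b)) ?muln_gt0; lia.
  - by rewrite -(@ltn_pmul2r (a * c)) ?muln_gt0; lia.
  - by rewrite -(@ltn_pmul2r (b * c)) ?muln_gt0; lia.
have [x1 y1 z1] := bound _ wl; have [x2 y2 z2] := bound _ wl'.
rewrite !weightE in e.
have ex : m ord0 = m' ord0.
  apply: (@repr_digit (a * b) c _ _
    (m (lift ord0 ord0) * a + m (lift ord0 (lift ord0 ord0)) * b)
    (m' (lift ord0 ord0) * a + m' (lift ord0 (lift ord0 ord0)) * b)) => //.
    by rewrite coprimeMr coprime_sym cac coprime_sym cbc.
  by move: e; lia.
have ey : m (lift ord0 ord0) = m' (lift ord0 ord0).
  apply: (@repr_digit (a * c) b _ _
    (m ord0 * a + m (lift ord0 (lift ord0 ord0)) * c)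
    (m' ord0 * a + m' (lift ord0 (lift ord0 ord0)) * c)) => //.
    by rewrite coprimeMr coprime_sym cab cbc.
  by move: e; lia.
have ez : m (lift ord0 (lift ord0 ord0)) = m' (lift ord0 (lift ord0 ord0)).
  apply: (@repr_digit (b * c) a _ _
    (m ord0 * b + m (lift ord0 ord0) * c)
    (m' ord0 * b + m' (lift ord0 ord0) * c)) => //.
    by rewrite coprimeMr cab cac.
  by move: e; lia.
apply/mnmP => i; case: (unliftP ord0 i) => [j ->|->] //.
case: (unliftP ord0 j) => [k ->|->] //.
by case: (unliftP ord0 k) => [[]|->].
Qed.

Lemma fps_eval_monom (x : 'I_3 -> fps K) (m : 'X_{1..3}) :
  fps_eval x 'X_[m] = \prod_i x i ^+ m i.
Proof. by rewrite fps_evalE mmapX. Qed.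

Lemma monom_order (x : 'I_3 -> fps K) m : (forall i, fps_ord_ge (tnth r i) (x i)) ->
  fps_ord_ge (weight m) (fps_eval x 'X_[m]) /\
  fps_eval x 'X_[m] (weight m) = \prod_i x i (tnth r i) ^+ m i.
Proof.
move=> xr; rewrite fps_eval_monom.
have [H1 H2] := fps_ord_ge_prod (fun i => proj1 (fps_ord_geX (m i) (xr i))).
split=> //; rewrite H2; apply: eq_bigr => i _.
by have [] := fps_ord_geX (m i) (xr i).
Qed.

Lemma fps_eval_coef (x : 'I_3 -> fps K) G l :
  fps_eval x G l = \sum_(m <- msupp G) G@_m * fps_eval x 'X_[m] l.
Proof.
rewrite [in LHS]/fps_eval [in LHS]/mmap fps_sum; apply: eq_bigr => m _.
by rewrite fpsCM fps_eval_monom.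
Qed.

Lemma eq_fps_eval_coef (x y : 'I_3 -> fps K) G l :
  (forall m, m \in msupp G -> fps_eval x 'X_[m] l = fps_eval y 'X_[m] l) ->
  fps_eval x G l = fps_eval y G l.
Proof.
move=> xy; apply: etrans (fps_eval_coef x G l) (etrans _ (esym (fps_eval_coef y G l))).
by apply: eq_big_seq => m mG; exact: (congr1 (fun u => G@_m * u) (xy m mG)).
Qed.

(** Monomials of weight at most [b * c] have pairwise distinct orders, so the
    lightest of them in [G] would be the value. *)
Lemma no_light_monomial (x : 'I_3 -> fps K) G k :
  (forall i, fps_val (x i) (tnth r i)) -> (b * c < k)%N ->
  fps_ord_ge k (fps_eval x G) -> forall m, m \in msupp G -> (b * c < weight m)%N.
Proof.
move=> xr bk Gk m; rewrite ltnNge; apply: contraL => wm.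
have xo i : fps_ord_ge (tnth r i) (x i) by have [] := xr i.
have [l lE] : exists l, weight m = l by exists (weight m).
elim/ltn_ind: l m lE wm => l IH m lE wm; apply/negP => mG.
have : fps_eval x G l = G@_m * \prod_i x i (tnth r i) ^+ m i.
  suff tail : \sum_(m' <- msupp G | m' != m) G@_m' * fps_eval x 'X_[m'] l = 0.
    rewrite fps_eval_coef (bigD1_seq m mG (msupp_uniq _)) tail [LHS]addr0.
    by rewrite -lE (monom_order m xo).2.
  rewrite big_seq_cond big1 // => m' /andP[m'G m'm].
  have [lt|le] := ltnP l (weight m').
    by rewrite (monom_order m' xo).1 ?mulr0.
  move: le; rewrite leq_eqVlt => /predU1P[e|lt].
    case/eqP: m'm; apply: weight_inj; last by rewrite e lE.
    rewrite e -lE; apply: leq_ltn_trans wm _.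
    by rewrite -mulnA ltn_Pmull // muln_gt0; lia.
  have wm' : (weight m' <= b * c)%N by rewrite ltnW // (leq_trans lt) // -lE.
  by move: m'G; rewrite (negPf (IH _ lt m' erefl wm')).
rewrite Gk; last by rewrite -lE (leq_ltn_trans wm).
move/esym/eqP; rewrite mulf_eq0 mcoeff_eq0 mG /=; apply/negP.
rewrite prodf_seq_neq0; apply/allP => i _ /=; apply: expf_neq0; apply/eqP.
by have [] := xr i.
Qed.

(** Beyond the order [N] only monomials of weight more than [b * c] contribute.
    They have at least two factors, hence are products of two series of order at
    least [a * b], which gains [a * b] orders of agreement. *)
Lemma eval_jets (x y : 'I_3 -> fps K) N G k :
  (forall i, fps_val (x i) (tnth r i)) -> (forall i, fps_val (y i) (tnth r i)) ->
  (forall i, fps_eq_upto N (x i) (y i)) ->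
  (b * c <= N)%N -> (k <= N + a * b)%N ->
  fps_ord_ge k (fps_eval x G) -> fps_eq_upto k (fps_eval x G) (fps_eval y G).
Proof.
move=> xr yr xy bN kN Gk.
have xyM (m : 'X_{1..3}) : fps_eq_upto N (fps_eval x 'X_[m]) (fps_eval y 'X_[m]).
  rewrite !fps_eval_monom; apply: (big_rec2 (fun u v => fps_eq_upto N u v)) => // i u v _ uv.
  by apply: fps_eq_uptoM uv; apply: fps_eq_uptoX.
have [kN'|Nk] := leqP k N.
  by move=> l lk; apply: eq_fps_eval_coef => m _; exact: xyM (leq_trans lk kN').
have light := no_light_monomial xr (leq_ltn_trans bN Nk) Gk.
have xo i : fps_ord_ge (tnth r i) (x i) by have [] := xr i.
have yo i : fps_ord_ge (tnth r i) (y i) by have [] := yr i.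
move=> l lk; apply: eq_fps_eval_coef => m mG.
have rab i : (a * b <= tnth r i <= b * c)%N.
  by rewrite (tnth_nth 0%N); case: i => [[|[|[|]]]] //= _; apply/andP; split; nia.
have ord_gen i : weight U_(i)%MM = tnth r i.
  rewrite /weight (bigD1 i) //= mnm1E eqxx muln1 big1 ?addn0 // => j ji.
  by rewrite mnm1E eq_sym (negPf ji) muln0.
have split_gen (u : 'X_{1..3}) : u != 0%MM -> exists i v, u = (U_(i) + v)%MM.
  move=> u0; have /fintype.existsP[l1 ul] : [exists i, u i != 0%N].
    apply: contraNT u0 => /fintype.existsPn h; apply/eqP/mnmP => i.
    by rewrite mnm0E; apply/eqP; have := h i; rewrite negbK.
  exists l1, (u - U_(l1))%MM; rewrite addmC submK //.
  by apply/mnm_lepP => j; rewrite mnm1E; case: eqP => // <-; rewrite lt0n.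
have weightD (u v : 'X_{1..3}) : weight (u + v)%MM = (weight u + weight v)%N.
  by rewrite /weight -big_split; apply: eq_bigr => i _; rewrite mnmDE mulnDr.
have wm := light m mG.
have [|i [v mE]] := split_gen m.
  by apply: contraTneq wm => ->; rewrite /weight big1 // => i _; rewrite mnm0E muln0.
have [|j [w vE]] := split_gen v.
  apply: contraTneq wm => v0; rewrite mE v0 addm0 ord_gen -leqNgt.
  by have /andP[] := rab i.
have ord_ab (z : 'I_3 -> fps K) (zo : forall i, fps_ord_ge (tnth r i) (z i)) :
    fps_ord_ge (a * b) (fps_eval z 'X_i) /\ fps_ord_ge (a * b) (fps_eval z 'X_[v]).
  split; [have [+ _] := monom_order U_(i)%MM zo | have [+ _] := monom_order v zo].
    by rewrite ord_gen; apply: fps_ord_geW; have /andP[] := rab i.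
  apply: fps_ord_geW; rewrite vE weightD ord_gen.
  by have /andP[+ _] := rab j; move/leq_trans; apply; rewrite leq_addr.
rewrite mE mpolyXD !fps_evalM.
have [x1 x2] := ord_ab x xo; have [y1 y2] := ord_ab y yo.
by apply: (fps_eq_upto_mul x1 y1 x2 y2 (xyM _) (xyM _)); apply: leq_trans kN.
Qed.

(** The orders gained over [N] matter: for a curve of degree [d] they leave the
    coefficients in degrees [d - 1] and [d] free, although values up to about
    [d] have to be controlled. *)
Lemma value_jets (x y : 'I_3 -> fps K) N k :
  (forall i, fps_val (x i) (tnth r i)) -> (forall i, fps_val (y i) (tnth r i)) ->
  (forall i, fps_eq_upto N (x i) (y i)) ->
  (b * c <= N)%N -> (k <= N + a * b)%N ->
  value_semigroup x k <-> value_semigroup y k.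
Proof.
move=> xr yr xy bN kN; split=> -[G [Gk G0]]; exists G.
  have E := eval_jets xr yr xy bN kN G0; split=> [|l lk]; first by rewrite -E.
  by rewrite -E ?G0 // ltnW.
have yx i : fps_eq_upto N (y i) (x i) by move=> l lN; rewrite xy.
have E := eval_jets yr xr yx bN kN G0; split=> [|l lk]; first by rewrite -E.
by rewrite -E ?G0 // ltnW.
Qed.

End Jets.

(** * Subalgebras of the polynomial ring *)

Lemma size_sub_lead (K : fieldType) (P Q : {poly K}) : P != 0 -> size Q = size P ->
  (size (P - (lead_coef P / lead_coef Q) *: Q)%R < size P)%N.
Proof.
move=> P0 sQ; set R := P - _.
have lQ : lead_coef Q != 0 by rewrite lead_coef_eq0 -size_poly_eq0 sQ size_poly_eq0.
have sR : (size R <= size P)%N.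
  apply: leq_trans (size_polyD _ _) _.
  by rewrite geq_max leqnn size_polyN (leq_trans (size_scale_leq _ _)) // sQ.
rewrite ltn_neqAle sR andbT; apply/negP => /eqP eq_s.
have : lead_coef R = 0.
  by rewrite lead_coefE eq_s coefB coefZ -{2}sQ -!lead_coefE divfK ?subrr.
by move/eqP; rewrite lead_coef_eq0 -size_poly_eq0 eq_s size_poly_eq0 (negPf P0).
Qed.

Section Subalgebra.
Variable K : fieldType.
Implicit Types (A : {poly K} -> Prop) (P Q : {poly K}).

Definition subalg A : Prop :=
  [/\ forall c, A c%:P, forall P Q, A P -> A Q -> A (P + Q) &
      forall P Q, A P -> A Q -> A (P * Q)].

Variable A : {poly K} -> Prop.
Hypothesis sA : subalg A.

Let AC c : A c%:P. Proof. by case: sA. Qed.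
Let AD P Q : A P -> A Q -> A (P + Q). Proof. by case: sA => _ + _; apply. Qed.
Let AM P Q : A P -> A Q -> A (P * Q). Proof. by case: sA => _ _; apply. Qed.

Lemma subalgZ c P : A P -> A (c *: P).
Proof. by rewrite -mul_polyC; exact: AM. Qed.

Lemma subalg_sum I (s : seq I) (D : pred I) (P : I -> {poly K}) :
  (forall i, D i -> A (P i)) -> A (\sum_(i <- s | D i) P i).
Proof. by move=> AP; apply: big_ind => //; rewrite -polyC0. Qed.

Lemma subalgX P k : A P -> A (P ^+ k).
Proof.
by move=> AP; elim: k => [|k IH]; rewrite ?expr0 ?exprS; [rewrite -polyC1 | exact: AM].
Qed.

Lemma subalg_comp P Q : A P -> A (Q \Po P).
Proof.
by move=> AP; rewrite comp_polyE; apply: subalg_sum => i _; apply/subalgZ/subalgX.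
Qed.

Variables (d : nat) (P1 P2 : {poly K}).
Hypotheses (d2 : (2 <= d)%N) (sP1 : size P1 = d.+1) (sP2 : size P2 = d).
Hypotheses (AP1 : A P1) (AP2 : A P2).

Let P10 : P1 != 0. Proof. by rewrite -size_poly_eq0 sP1. Qed.
Let P20 : P2 != 0. Proof. by rewrite -size_poly_eq0 sP2; lia. Qed.

Lemma size_monom2 i j : size (P1 ^+ i * P2 ^+ j) = (i * d + j * (d - 1)).+1.
Proof.
rewrite size_mul ?expf_neq0 //.
have szX (P : {poly K}) k : P != 0 -> size (P ^+ k) = (k * (size P).-1).+1.
  move=> P0; elim: k => [|k IH]; first by rewrite expr0 size_poly1 mul0n.
  rewrite exprS size_mul ?expf_neq0 // IH mulSn; have : (0 < size P)%N by rewrite size_poly_gt0.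
  by case: (size P) => // s _ /=; lia.
by rewrite !szX // sP1 sP2 /= subn1; lia.
Qed.

(** The degrees [d] and [d - 1] are consecutive: [k = q * (d - 1) + s] is the
    degree of [P1 ^ s * P2 ^ (q - s)] when [s <= q]. *)
Lemma subalg_degrees k : (d * d <= k)%N -> exists2 P, A P & size P = k.+1.
Proof.
move=> dk; pose q := (k %/ (d - 1))%N; pose s := (k %% (d - 1))%N.
have kE : (k = q * (d - 1) + s)%N by exact: divn_eq.
have sd : (s < d - 1)%N by rewrite ltn_mod; lia.
have sq : (s <= q)%N.
  rewrite leqNgt; apply/negP => qs; move: dk; rewrite kE; apply/negP; rewrite -ltnNge.
  have [e dE] : exists e, d = (s + e.+2)%N by exists (d - s - 2)%N; lia.
  have [e' sE] : exists e', s = (q + e'.+1)%N by exists (s - q - 1)%N; lia.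
  have -> : (d - 1 = s + e.+1)%N by lia.
  by rewrite dE sE; nia.
exists (P1 ^+ s * P2 ^+ (q - s)); first by apply: AM; exact: subalgX.
rewrite size_monom2 kE; congr _.+1.
have [e qE] : exists e, q = (s + e)%N by exists (q - s)%N; lia.
have [d' dE] : exists d', d = d'.+1 by exists d.-1; lia.
by rewrite qE dE subn1 /= addKn; nia.
Qed.

Lemma subalg_reduce P : exists2 R, A (P - R) & (size R <= d * d)%N.
Proof.
have [k] := ubnP (size P); elim: k P => // k IH P; rewrite ltnS => sP.
have [le|lt] := leqP (size P) (d * d).
  by exists P; rewrite ?subrr // -polyC0.
have P0 : P != 0 by rewrite -size_poly_gt0; lia.
have [|Q AQ sQ] := @subalg_degrees (size P).-1; first lia.
have sPQ : size Q = size P by rewrite sQ prednK // size_poly_gt0.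
pose e := lead_coef P / lead_coef Q.
have [|R AR sR] := IH (P - e *: Q); first exact: leq_trans (size_sub_lead P0 sPQ) sP.
exists R => //; have -> : P - R = (P - e *: Q - R) + e *: Q by ring.
by apply: AD => //; exact: subalgZ.
Qed.

(** [A] has finite codimension in the polynomial ring, hence contains a nonzero
    ideal: among sufficiently many elements of [A], some combination multiplies
    the finitely many missing monomials into [A]. *)
Lemma conductor_exists : exists2 j, j != 0 & forall Q, A (j * Q).
Proof.
pose M := (d * d)%N; pose L := (M * M).+1.
have Hp (l : 'I_L) : exists P, A P /\ size P = (M + l).+1.
  by have [|P AP sP] := @subalg_degrees (M + l); [exact: leq_addr | exists P].
have [p pP] := boolp.choice Hp.
have Hr P : exists R, A (P - R) /\ (size R <= M)%N.
  by have [R ? ?] := subalg_reduce P; exists R.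
have [rho rhoP] := boolp.choice Hr.
pose T : 'M[K]_(L, M * M) := \matrix_l mxvec (\matrix_(i < M, k < M) (rho (p l * 'X^i))`_k).
have /rowV0Pn[w /sub_kermxP wT w0] : kermx T != 0.
  rewrite kermx_eq0 /row_free neq_ltn; apply/orP; left.
  exact: leq_ltn_trans (rank_leq_col T) (ltnSn _).
pose j := \sum_l w 0 l *: p l.
have Aj : A j by apply: subalg_sum => l _; apply: subalgZ; case: (pP l).
have AjX (i : 'I_M) : A (j * 'X^i).
  have -> : j * 'X^i = \sum_l w 0 l *: (p l * 'X^i - rho (p l * 'X^i)).
    rewrite /j mulr_suml -[LHS]subr0; under [RHS]eq_bigr do rewrite scalerBr.
    rewrite sumrB; congr (_ - _); first by apply: eq_bigr => l _; rewrite scalerAl.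
    apply/esym/polyP => k; rewrite coef0 coef_sum.
    have [kM|Mk] := ltnP k M; last first.
      rewrite big1 // => l _; rewrite coefZ nth_default ?mulr0 //.
      by apply: leq_trans Mk; case: (rhoP (p l * 'X^i)).
    have wT0 := congr1 (fun u : 'rV[K]_(M * M) => u 0 (mxvec_index i (Ordinal kM))) wT.
    rewrite !mxE in wT0; rewrite -[RHS]wT0; apply: eq_bigr => l _.
    by rewrite coefZ !mxE mxvecE mxE.
  by apply: subalg_sum => l _; apply: subalgZ; case: (rhoP (p l * 'X^i)).
exists j.
  have /rV0Pn[l0 wl0] := w0.
  pose l1 := [arg max_(l > l0 | w 0 l != 0) (l : nat)].
  have [wl1 max1] : w 0 l1 != 0 /\ forall l, w 0 l != 0 -> (l <= l1)%N.
    by rewrite /l1; case: arg_maxnP => // l wl h; split=> // l' /h.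
  apply: contraNneq wl1 => j0.
  have : j`_(M + l1) = 0 by rewrite j0 coef0.
  rewrite coef_sum (bigD1 l1) //= coefZ big1 ?addr0 => [/eqP|l ll1].
    have [_ sp] := pP l1; rewrite mulf_eq0 => /orP[//|].
    rewrite (_ : (M + l1)%N = (size (p l1)).-1); last by rewrite sp.
    by rewrite -lead_coefE lead_coef_eq0 -size_poly_eq0 sp.
  rewrite coefZ; have [->|wl] := eqVneq (w 0 l) 0; first by rewrite mul0r.
  rewrite nth_default ?mulr0 //; have [_ ->] := pP l.
  rewrite ltn_add2l ltn_neqAle max1 // andbT; by [].
move=> Q; have -> : Q = (Q - rho Q) + rho Q by rewrite subrK.
have [AQ sQ] := rhoP Q; rewrite mulrDr; apply: AD; first exact: AM.
have -> : rho Q = \sum_(i < M) (rho Q)`_i *: 'X^i.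
  rewrite -poly_def; apply/polyP => i; rewrite coef_poly; case: ltnP => // Mi.
  by rewrite nth_default // (leq_trans sQ).
rewrite mulr_sumr; apply: subalg_sum => i _; rewrite -scalerAr; exact: subalgZ.
Qed.

End Subalgebra.

Section Interpolation.
Variable K : fieldType.
Implicit Types (P Q G h : {poly K}).

(** Induction on [rs], in which points may be repeated. As [P] separates the
    points and is unramified, the composite [H \Po P] is the divisor of the
    points treated so far, up to a factor that does not vanish at the next point
    [q]: a multiple of it adjusts the remainder at [q]. *)
Lemma interpolation P G (rs : seq K) :
  (forall z, z \in rs -> G.[z] != 0) -> (forall z, z \in rs -> P^`().[z] != 0) ->
  {in rs &, injective (horner P)} ->
  forall Q, exists h R, Q = G * (h \Po P) + \prod_(z <- rs) ('X - z%:P) * R.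
Proof.
elim: rs => [|q rs IH] G0 P0 Pinj Q.
  by exists 0, Q; rewrite comp_poly0 mulr0 add0r big_nil mul1r.
have [z zrs|z zrs|z z' zrs z'rs|h [R QE]] := IH _ _ _ Q.
- by apply: G0; rewrite inE zrs orbT.
- by apply: P0; rewrite inE zrs orbT.
- by apply: Pinj; rewrite inE ?zrs ?z'rs orbT.
pose H := \prod_(z <- rs) ('X - (P.[z])%:P : {poly K}).
have [U HU Uq] : exists2 U, H \Po P = \prod_(z <- rs) ('X - z%:P) * U & U.[q] != 0.
  suff main s : {subset s <= q :: rs} -> exists2 U,
      \prod_(z <- s) (('X - (P.[z])%:P) \Po P) = \prod_(z <- s) ('X - z%:P) * U & U.[q] != 0.
    have [z zrs|U HU Uq] := main rs; first by rewrite inE zrs orbT.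
    by exists U => //; rewrite /H rmorph_prod.
  elim: s => [_|z s IHs sub]; first by exists 1; rewrite ?big_nil ?mulr1 // hornerC oner_neq0.
  have [|U sU Uq] := IHs; first by move=> u us; apply: sub; rewrite inE us orbT.
  have /factor_theorem[V VE] : root (P - (P.[z])%:P) z.
    by rewrite /root !hornerE subrr.
  have zin : z \in q :: rs by apply: sub; exact: mem_head.
  have Vq : V.[q] != 0.
    have [qz|qz] := eqVneq q z; last first.
      have : (P - (P.[z])%:P).[q] != 0.
        rewrite !hornerE subr_eq0; apply: contraNneq qz => /Pinj ->//.
        exact: mem_head.
      by rewrite VE hornerM mulf_eq0 negb_or => /andP[].
    have := P0 q (mem_head _ _).
    have -> : P^`() = (P - (P.[z])%:P)^`() by rewrite derivB derivC subr0.
    by rewrite VE derivM derivXsubC !hornerE qz subrr mulr0 add0r.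
  exists (V * U); last by rewrite hornerM mulf_neq0.
  rewrite !big_cons sU rmorphB /= comp_polyX comp_polyC VE; ring.
pose k := R.[q] / (G * U).[q].
have GUq : (G * U).[q] != 0 by rewrite hornerM mulf_neq0 // G0 // mem_head.
have /factor_theorem[R' R'E] : root (R - k *: (G * U)) q.
  by rewrite /root hornerD hornerN hornerZ divfK // subrr.
exists (h + k *: H), R'.
rewrite big_cons QE rmorphD /= linearZ /= HU.
have -> : R = R' * ('X - q%:P) + k *: (G * U) by rewrite -R'E subrK.
by rewrite -!mul_polyC; ring.
Qed.

End Interpolation.

(** Let [e] be the multiplicity of [0] in [j]. As [P ^ e] is [X ^ e] times a
    function invertible on the other zeros of [j], interpolation writes
    [X ^ e * Q] as [P ^ e] times a polynomial in [P], modulo [j]. *)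
Lemma subalg_local_conductor (K : closedFieldType) (A : {poly K} -> Prop)
    (j P : {poly K}) :
  subalg A -> A P -> j != 0 -> (forall Q, A (j * Q)) -> root P 0 ->
  (forall z, root j z -> z != 0 -> P.[z] != 0) ->
  (forall z, root j z -> z != 0 -> P^`().[z] != 0) ->
  (forall z z', root j z -> root j z' -> z != 0 -> z' != 0 -> P.[z] = P.[z'] -> z = z') ->
  exists e, forall Q, A ('X^e * Q).
Proof.
move=> sA AP j0 Aj P0 Pz P'z Pinj; have [AC AD AM] := sA.
have [rs jE] := closed_field_poly_normal j.
pose nz := [seq z <- rs | z != 0]; pose e := count (pred1 0) rs.
have jE' : j = lead_coef j *: ('X^e * \prod_(z <- nz) ('X - z%:P)).
  rewrite {1}jE; congr (_ *: _); rewrite (bigID (fun z => z == 0)) /=; congr (_ * _).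
    rewrite (eq_bigr (fun=> 'X)) => [|z /eqP ->]; last by rewrite subr0.
    by rewrite big_const_seq iter_mulr_1; congr (_ ^+ _); apply: eq_count.
  by rewrite /nz big_filter.
have lj : lead_coef j != 0 by rewrite lead_coef_eq0.
have nzP z : z \in nz -> root j z /\ z != 0.
  rewrite mem_filter => /andP[z0 zrs]; split=> //.
  by rewrite jE rootZ // root_prod_XsubC.
have /factor_theorem[G GE] := P0; rewrite subr0 in GE.
have Gz z : z \in nz -> (G ^+ e).[z] != 0.
  move=> /nzP[jz z0]; rewrite horner_exp expf_neq0 //.
  by have := Pz z jz z0; rewrite GE hornerM mulf_eq0 negb_or => /andP[].
exists e => Q.
have P'nz z : z \in nz -> P^`().[z] != 0 by move=> /nzP[]; exact: P'z.
have inj : {in nz &, injective (horner P)}.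
  by move=> z z' /nzP[jz z0] /nzP[jz' z'0]; exact: Pinj.
have [h [R QE]] := interpolation Gz P'nz inj Q.
have -> : 'X^e * Q = P ^+ e * (h \Po P) + j * ((lead_coef j)^-1 *: R).
  rewrite {1}jE' QE GE exprMn -scalerAl -scalerAr scalerA mulfV // scale1r.
  by rewrite mulrDr !mulrA (mulrC 'X^e).
apply: AD => //; apply: AM; first exact: subalgX.
exact: subalg_comp.
Qed.

Lemma cofin_affine (K : fieldType) (u v : K) : (u != 0) || (v != 0) ->
  cofin (fun x => u + x * v != 0).
Proof.
move=> uv; exists (u%:P + v *: 'X); last by move=> x; rewrite !hornerE mulrC.
apply: contraL uv => /eqP uvX; rewrite negb_or !negbK.
have := congr1 (fun p : {poly K} => p`_0) uvX.
rewrite coefD coefZ coefX coefC coef0 /= mulr0 addr0 => ->.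
have := congr1 (fun p : {poly K} => p`_1) uvX.
by rewrite coefD coefZ coefX coefC coef0 /= add0r mulr1 => ->; rewrite !eqxx.
Qed.

(** First [al] is chosen off the finitely many equations that do not involve
    [be], then [be] off the others. *)
Lemma avoid_lines (K : numFieldType) (T : eqType) (s : seq T) (h l1 l2 : T -> K) :
  (forall t, t \in s -> (l1 t != 0) || (l2 t != 0)) ->
  exists al be, forall t, t \in s -> h t + al * l1 t + be * l2 t != 0.
Proof.
move=> l12.
have [al alP] : exists al, forall t, t \in s -> l2 t = 0 -> h t + al * l1 t != 0.
  apply: cofin_ex; apply: cofin_seq => t ts.
  have [l20|l20] := eqVneq (l2 t) 0; last by apply: cofinT => x /eqP; rewrite (negPf l20).
  have : cofin (fun x => h t + x * l1 t != 0).
    by apply: cofin_affine; have := l12 t ts; rewrite l20 eqxx orbF => ->; rewrite orbT.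
  by apply: cofinW => x ? _.
exists al; apply: cofin_ex; apply: cofin_seq => t ts.
apply: cofin_affine; have [l20|l20] := eqVneq (l2 t) 0; last by rewrite orbT.
by rewrite alP.
Qed.

(** * Curves with an affine coordinate ring *)

Lemma subalg_span (K : fieldType) n d (F : 'M[K]_(n.+1, d.+1)) (A : {poly K} -> Prop) m P :
  subalg A -> (forall k, A (form F k)) -> span_prod F m P -> A P.
Proof.
move=> sA AF [c ->]; apply: (subalg_sum sA) => s _; apply: (subalgZ sA).
have [AC _ AM] := sA; apply: (big_ind A) => //; by rewrite -polyC1.
Qed.

Section AffineForms.
Variables (K : fieldType) (n d : nat) (F : 'M[K]_(n.+1, d.+1)).
Hypothesis F1 : form F 0 = 1.

Lemma span_prod_le m m' P : (m <= m')%N -> span_prod F m P -> span_prod F m' P.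
Proof.
move=> mm' FP; rewrite -(subnKC mm'); elim: (m' - m)%N => [|k IH]; rewrite ?addn0 ?addnS //.
by rewrite -[P]mul1r -F1; exact: span_prodM.
Qed.

Lemma span_prod_const c : span_prod F 0 c%:P.
Proof.
rewrite -[c]mulr1 polyCM mul_polyC; apply: span_prodZ.
by have := span_prod_gen F [ffun _ : 'I_0 => 0]; rewrite /form_prod big_ord0 polyC1.
Qed.

Lemma span_prodMM m m' P Q : span_prod F m P -> span_prod F m' Q ->
  span_prod F (m + m') (P * Q).
Proof.
elim: m P => [|m IH] P; last first.
  move=> /span_prodS_ex[R RF ->] QF; rewrite mulr_suml addSn.
  by apply: span_prod_sum => k _; rewrite -mulrA; apply: span_prodM; exact: IH.
move=> [c ->] QF; rewrite mulr_suml; apply: span_prod_sum => s _.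
by rewrite /form_prod big_ord0 -scalerAl mul1r; exact: span_prodZ.
Qed.

Lemma span_prod_form k : span_prod F 1 (form F k).
Proof. by rewrite -[form F k]mulr1 -polyC1; apply/span_prodM/span_prod_const. Qed.

Lemma span_prodX m k P : span_prod F m P -> span_prod F (k * m) (P ^+ k).
Proof.
move=> FP; elim: k => [|k IH]; first by rewrite expr0 -polyC1; exact: span_prod_const.
by rewrite exprS mulSn; exact: span_prodMM.
Qed.

Lemma subalg_forms : subalg (fun P => exists m, span_prod F m P).
Proof.
split=> [c|P Q [m Pm] [m' Qm]|P Q [m Pm] [m' Qm]].
- by exists 0%N; exact: span_prod_const.
- exists (maxn m m'); apply: span_prodD; [apply: span_prod_le Pm|apply: span_prod_le Qm].
    exact: leq_maxl.
  exact: leq_maxr.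
- by exists (m + m')%N; exact: span_prodMM.
Qed.

Lemma span_prod_uniform (I : finType) (Q : I -> nat -> Prop) :
  (forall i m m', (m <= m')%N -> Q i m -> Q i m') -> (forall i, exists m, Q i m) ->
  exists m, forall i, Q i m.
Proof.
move=> Qle /boolp.choice[h hQ]; exists (\max_i h i)%N => i.
by apply: Qle (hQ i); exact: leq_bigmax.
Qed.

Variables (k1 k2 : 'I_n.+1) (e : nat).
Hypotheses (d2 : (2 <= d)%N) (s1 : size (form F k1) = d.+1) (s2 : size (form F k2) = d).
Hypotheses (r1 : root (form F k1) 0) (r2 : root (form F k2) 0).
Hypothesis Fe : forall Q, exists m, span_prod F m ('X^e * Q).

(** Multiplying by the form [k1], of exact degree [d], gives all degrees but
    boundedly many of the highest ones. There [f ^ (m - i) * g ^ i] has degree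
    [m * d - i] for [f], [g] of degrees [d], [d - 1], and leading terms can be
    cancelled. *)
Lemma span_prod_conductor : exists m0, forall m, (m0 <= m)%N ->
  forall Q : {poly K}, (size Q + e <= (m * d).+1)%N -> span_prod F m ('X^e * Q).
Proof.
have [m1 Fm1] : exists m, forall i : 'I_d, span_prod F m ('X^e * 'X^i).
  by apply: span_prod_uniform => [i m m'|i]; [exact: span_prod_le | exact: Fe].
have base l (Q : {poly K}) : (size Q <= l.+1 * d)%N -> span_prod F (m1 + l) ('X^e * Q).
  elim: l Q => [|l IH] Q sQ.
    rewrite addn0; have -> : Q = \sum_(i < d) Q`_i *: 'X^i.
      rewrite -poly_def; apply/polyP => i; rewrite coef_poly; case: ltnP => // di.
      by rewrite nth_default //; apply: leq_trans sQ _; rewrite mul1n.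
    rewrite mulr_sumr; apply: span_prod_sum => i _.
    by rewrite -scalerAr; apply: span_prodZ.
  have f10 : form F k1 != 0 by rewrite -size_poly_eq0 s1.
  rewrite (divp_eq Q (form F k1)) mulrDr mulrA (mulrC _ (form F k1)) addnS.
  apply: span_prodD; first apply: span_prodM.
    by apply: IH; rewrite size_divp // s1 leq_subLR -mulSn.
  apply: (@span_prod_le (m1 + l)); first exact: leqnSn.
  apply: IH; have := ltn_modp Q (form F k1); rewrite f10 s1 ltnS => /leq_trans; apply.
  by rewrite mulSn leq_addr.
have /factor_theorem[g1 g1E] := r1; have /factor_theorem[g2 g2E] := r2.
rewrite !subr0 in g1E g2E.
exists (m1 + m1 * d + e)%N => m mm Q.
have [k] := ubnP (size Q); elim: k Q => // k IH Q sk sQ.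
have [l mE] : exists l, m = (m1 + l)%N by exists (m - m1)%N; lia.
have [le|lt] := leqP (size Q) (l.+1 * d); first by rewrite mE; exact: base.
have mdE : (m * d = m1 * d + l * d)%N by rewrite mE mulnDl.
have [i iE] : exists i, (size Q + e + i = (m * d).+1)%N.
  by exists ((m * d).+1 - (size Q + e))%N; lia.
have im : (i <= m)%N by move: lt; rewrite mulSn; lia.
have [m' m'E] : exists m', (m = e + m')%N by exists (m - e)%N; lia.
pose T := form F k1 ^+ (m - i) * form F k2 ^+ i.
pose T' := 'X^m' * (g1 ^+ (m - i) * g2 ^+ i).
have TE : T = 'X^e * T'.
  have XE : 'X^(m - i) * 'X^i = 'X^e * 'X^m' :> {poly K}.
    by rewrite -!exprD subnK // m'E.
  rewrite /T /T' g1E g2E !exprMn mulrACA XE; ring.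
have sT : size T = (size Q + e)%N.
  rewrite /T (size_monom2 d2 s1 s2).
  have [u mu] : exists u, (m = u + i)%N by exists (m - i)%N; lia.
  have [v dv] : exists v, (d = v.+1)%N by exists d.-1; lia.
  by move: iE; rewrite mu addnK dv subn1 /=; nia.
have Q0 : Q != 0 by rewrite -size_poly_gt0; lia.
have T0 : T' != 0.
  apply/eqP => T'0; move: sT; rewrite TE T'0 mulr0 size_poly0; lia.
have sT' : size T' = size Q.
  by move: sT; rewrite TE mulrC size_mulXn // addnC => /addIn.
have -> : Q = (Q - (lead_coef Q / lead_coef T') *: T') + (lead_coef Q / lead_coef T') *: T'.
  by rewrite subrK.
have lt_s := size_sub_lead Q0 sT'.
rewrite mulrDr; apply: span_prodD.
  by apply: IH; [exact: leq_trans lt_s _ | apply: leq_trans sQ; rewrite leq_add2r ltnW].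
rewrite -scalerAr -TE; apply: span_prodZ.
have formX kk j : span_prod F j (form F kk ^+ j).
  by have := span_prodX j (span_prod_form kk); rewrite muln1.
by have := span_prodMM (formX k1 (m - i)%N) (formX k2 i); rewrite subnK.
Qed.

End AffineForms.

(** * A curve with given jets *)

Section AffineLeads.
Variables (K : fieldType) (n d : nat) (F : 'M[K]_(n.+1, d.+1)).
Hypothesis F1 : form F 0 = 1.

Let x (i : 'I_n) : fps K := fps_of_poly (form F (lift ord0 i)).

Lemma span_prod_eval G : exists m, exists2 P, span_prod F m P &
  fps_of_poly P = fps_eval x G.
Proof.
have [AC AD AM] := subalg_forms F1.
apply: (@fps_eval_ind _ _ x (fun g => exists m, exists2 P, span_prod F m P & fps_of_poly P = g)).
- by move=> c; have [m cm] := AC c; exists m, c%:P.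
- by move=> i; exists 1%N, (form F (lift ord0 i)) => //; exact: span_prod_form.
- move=> _ _ [m [P Pm <-]] [m' [Q Qm <-]].
  have [||l PQl] := AD P Q; [by exists m | by exists m' |].
  by exists l, (P + Q) => //; exact: rmorphD.
- move=> _ _ [m [P Pm <-]] [m' [Q Qm <-]].
  have [||l PQl] := AM P Q; [by exists m | by exists m' |].
  by exists l, (P * Q) => //; exact: rmorphM.
Qed.

(** The orders from [e] on come from the ideal of [X ^ e], and the finitely many
    smaller values are realized one at a time. *)
Lemma hilbert_leads_all e m0 :
  (forall m, (m0 <= m)%N -> forall Q : {poly K}, (size Q + e <= (m * d).+1)%N ->
    span_prod F m ('X^e * Q)) ->
  exists2 m, (2 <= m)%N & forall j, (j <= m * d)%N -> value_semigroup x j ->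
    leads (hilbert_mx F m) j.
Proof.
move=> Fm0.
have [m1 Fm1] : exists m, forall i : 'I_e, value_semigroup x i ->
    exists2 P, span_prod F m P & pval P i.
  apply: span_prod_uniform => [i m m' mm' H /H[P Pm Pi]|i].
    by exists P => //; apply: span_prod_le Pm.
  have [[G Gi]|nS] := pselect (value_semigroup x i); last by exists 0%N.
  have [m [P Pm PG]] := span_prod_eval G; exists m => _; exists P => //.
  by apply/pval_fps; rewrite PG.
exists (m0 + m1 + 2)%N => [|j jm xj]; first by rewrite leq_addl.
apply/leads_hilbert; have [je|ej] := ltnP j e.
  have [P Pm Pj] := Fm1 (Ordinal je) xj; exists P => //; apply: span_prod_le Pm => //.
  by rewrite -addnA addnCA leq_addr.
exists 'X^j; last first.
  by split=> [|i ij]; rewrite coefXn ?eqxx ?oner_neq0 // ltn_eqF.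
rewrite -(subnKC ej) exprD; apply: Fm0; first by rewrite -addnA leq_addr.
by rewrite size_polyXn addSn subnK.
Qed.

End AffineLeads.

Definition mx_of_polys (K : fieldType) n d (g : 'I_n.+1 -> {poly K}) : 'M[K]_(n.+1, d.+1) :=
  \matrix_(k, j) (g k)`_j.

Lemma form_mx_of_polys (K : fieldType) n d (g : 'I_n.+1 -> {poly K}) k :
  (size (g k) <= d.+1)%N -> form (mx_of_polys d g) k = g k.
Proof.
move=> sg; apply/polyP => j; rewrite coef_rVpoly; case: insubP => [i _ <-|]; first by rewrite !mxE.
by rewrite -leqNgt => dj; rewrite nth_default // (leq_trans sg).
Qed.

Section GenericCurve.
Variables (K : numClosedFieldType) (d : nat).
Hypothesis d2 : (2 <= d)%N.

(** Failing to separate two points, or to be unramified at one, is a linear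
    condition on the coefficients in degrees [d - 1] and [d], which are therefore
    chosen off finitely many lines. The point [0] is included among those to be separated
    from the others. *)
Lemma separating_top (h : {poly K}) (rs : seq K) : h.[0] = 0 ->
  exists al be, let P := h + al *: 'X^(d - 1) + be *: 'X^d in
  [/\ forall z, z \in rs -> z != 0 -> P.[z] != 0,
      forall z, z \in rs -> z != 0 -> P^`().[z] != 0 &
      forall z z', z \in rs -> z' \in rs -> z != 0 -> z' != 0 -> P.[z] = P.[z'] -> z = z'].
Proof.
move=> h0; pose ell (t : K * K) (P : {poly K}) : K :=
  if t.1 == t.2 then P^`().[t.1] else P.[t.1] - P.[t.2].
pose s := [seq t <- [seq (z, z') | z <- 0 :: rs, z' <- 0 :: rs] | t.1 != 0].
have ellP t P Q R al be :
    ell t (P + al *: Q + be *: R) = ell t P + al * ell t Q + be * ell t R.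
  rewrite /ell; case: eqP => _; first by rewrite !derivE !hornerE.
  by rewrite !hornerE; ring.
have [t|al [be abP]] := @avoid_lines K _ s (fun t => ell t h) (fun t => ell t 'X^(d - 1))
    (fun t => ell t 'X^d).
  rewrite mem_filter => /andP[t0 _]; rewrite /ell; have [_|t12] := eqVneq t.1 t.2.
    apply/orP; right; rewrite derivXn hornerMn hornerXn -mulr_natr.
    by rewrite mulf_neq0 ?expf_neq0 // pnatr_eq0 -lt0n; lia.
  rewrite !hornerXn !subr_eq0 -negb_and; apply: contra t12 => /andP[/eqP e1 /eqP e2].
  have dE : d = (d - 1).+1 by lia.
  have : t.1 ^+ (d - 1) * (t.1 - t.2) == 0.
    by rewrite mulrBr -exprSr e1 -exprSr -dE e2 subrr.
  by rewrite mulf_eq0 expf_eq0 (negPf t0) andbF /= subr_eq0.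
have zeroX k : (0 < k)%N -> (0 : K) ^+ k = 0 by rewrite expr0n => /gtn_eqF ->.
exists al, be => P; have P0 : P.[0] = 0.
  by rewrite /P !hornerD !hornerZ !hornerXn h0 !zeroX ?mulr0 ?addr0 //; lia.
have mem z z' : z \in 0 :: rs -> z' \in 0 :: rs -> z != 0 -> ell (z, z') P != 0.
  move=> zrs z'rs z0; rewrite ellP; apply: abP; rewrite mem_filter z0.
  by apply: allpairs_f.
have up z : z \in rs -> z \in 0 :: rs by rewrite inE orbC => ->.
split=> [z zrs z0|z zrs z0|z z' zrs z'rs z0 z'0 e].
- have := mem z 0 (up _ zrs) (mem_head _ _) z0.
  by rewrite /ell /= (negPf z0) P0 subr0.
- by have := mem z z (up _ zrs) (up _ zrs) z0; rewrite /ell /= eqxx.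
- apply/eqP; have := mem z z' (up _ zrs) (up _ z'rs) z0.
  by rewrite /ell /= e subrr; have [//|_] := eqVneq z z'; rewrite eqxx.
Qed.

(** The coefficients in degrees [d - 1] and [d] of the three coordinates are
    free. In the first two they make the degrees equal to [d] and [d - 1], so
    that finitely many points remain to be separated, and in the third they
    separate these points. *)
Lemma curve_with_jets (t : 'I_3 -> {poly K}) : (3 <= d)%N ->
  (forall i, (size (t i) <= d - 1)%N) -> (forall i, (t i).[0] = 0) ->
  exists F : 'M[K]_(4, d.+1), [/\ form F 0 = 1,
    forall i l, (l < d - 1)%N -> (form F (lift ord0 i))`_l = (t i)`_l &
    exists e m0, forall m, (m0 <= m)%N -> forall Q : {poly K},
      (size Q + e <= (m * d).+1)%N -> span_prod F m ('X^e * Q)].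
Proof.
move=> d3 st t0.
have zX : (0 : K) ^+ d = 0 by rewrite expr0n gtn_eqF //; lia.
have zX1 : (0 : K) ^+ (d - 1) = 0 by rewrite expr0n gtn_eqF //; lia.
pose g1 := t ord0 + 'X^d; pose g2 := t (lift ord0 ord0) + 'X^(d - 1).
have sg1 : size g1 = d.+1.
  by rewrite /g1 addrC size_polyDl ?size_polyXn // ltnS (leq_trans (st _)) ?leq_subr.
have sg2 : size g2 = d.
  rewrite /g2 addrC size_polyDl ?size_polyXn; first lia.
  by rewrite ltnS.
have root_g1 : root g1 0 by rewrite /root hornerD hornerXn t0 zX addr0.
have root_g2 : root g2 0 by rewrite /root hornerD hornerXn t0 zX1 addr0.
(* A plane curve: coordinates of degrees [d] and [d - 1] generate a subalgebra
   with a nonzero conductor [j], whose zeros are the points where a third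
   coordinate is needed. *)
pose F2 : 'M[K]_(3, d.+1) := mx_of_polys d (fun k => nth 0 [:: 1; g1; g2] k).
have F2E (k : 'I_3) : form F2 k = nth 0 [:: 1; g1; g2] k.
  apply: form_mx_of_polys; case: k => [[|[|[|]]]] //= _.
  - by rewrite size_poly1.
  - by rewrite sg1.
  - by rewrite sg2.
have F21 : form F2 0 = 1 by rewrite F2E.
have A2f i (i3 : (i < 3)%N) : exists m, span_prod F2 m (nth 0 [:: 1; g1; g2] i).
  by exists 1%N; rewrite -(F2E (Ordinal i3)); exact: span_prod_form.
have [j j0 jA2] := conductor_exists (subalg_forms F21) d2 sg1 sg2 (A2f 1%N isT) (A2f 2%N isT).
have [rs rsE] := closed_field_poly_normal j.
have rsP z : root j z -> z \in rs.
  by rewrite rsE rootZ ?root_prod_XsubC // lead_coef_eq0.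
have [al [be]] := separating_top rs (t0 (lift ord0 (lift ord0 ord0))).
set g3 := (_ + _) => -[g3z g3'z g3inj].
have sg3 : (size g3 <= d.+1)%N.
  rewrite /g3; apply: leq_trans (size_polyD _ _) _; rewrite geq_max; apply/andP; split.
    apply: leq_trans (size_polyD _ _) _; rewrite geq_max; apply/andP; split.
      by apply: leq_trans (st _) _; lia.
    by apply: leq_trans (size_scale_leq _ _) _; rewrite size_polyXn; lia.
  by apply: leq_trans (size_scale_leq _ _) _; rewrite size_polyXn.
have root_g3 : root g3 0.
  by rewrite /root /g3 !hornerD !hornerZ !hornerXn t0 zX zX1 !mulr0 !addr0.
pose F : 'M[K]_(4, d.+1) := mx_of_polys d (fun k => nth 0 [:: 1; g1; g2; g3] k).
have FE (k : 'I_4) : form F k = nth 0 [:: 1; g1; g2; g3] k.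
  apply: form_mx_of_polys; case: k => [[|[|[|[|]]]]] //= _.
  - by rewrite size_poly1.
  - by rewrite sg1.
  - by rewrite sg2.
have F1 : form F 0 = 1 by rewrite FE.
have A := subalg_forms F1.
have Af i (i4 : (i < 4)%N) : exists m, span_prod F m (nth 0 [:: 1; g1; g2; g3] i).
  by exists 1%N; rewrite -(FE (Ordinal i4)); exact: span_prod_form.
have jA Q : exists m, span_prod F m (j * Q).
  have [m jQ] := jA2 Q; apply: (subalg_span A _ jQ) => k; rewrite F2E.
  case: k => [[|[|[|//]]] k3].
  - exact: (Af 0%N isT).
  - exact: (Af 1%N isT).
  - exact: (Af 2%N isT).
have [e Ae] : exists e, forall Q, exists m, span_prod F m ('X^e * Q).
  apply: (subalg_local_conductor A (Af 3%N isT) j0 jA root_g3).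
  - by move=> z /rsP; exact: g3z.
  - by move=> z /rsP; exact: g3'z.
  - by move=> z z' /rsP zr /rsP z'r; exact: g3inj.
exists F; split=> //; last first.
  have FE1 := FE (Ordinal (isT : (1 < 4)%N)); have FE2 := FE (Ordinal (isT : (2 < 4)%N)).
  have sF1 := congr1 (fun P : {poly K} => size P) FE1; rewrite sg1 in sF1.
  have sF2 := congr1 (fun P : {poly K} => size P) FE2; rewrite sg2 in sF2.
  have rF1 : root (form F (Ordinal (isT : (1 < 4)%N))) 0 by rewrite FE1.
  have rF2 : root (form F (Ordinal (isT : (2 < 4)%N))) 0 by rewrite FE2.
  have [m0 Fm0] := span_prod_conductor F1 d2 sF1 sF2 rF1 rF2 Ae.
  by exists e, m0.
move=> i l ld; have lX k : (d - 1 <= k)%N -> ('X^k : {poly K})`_l = 0.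
  by move=> dk; rewrite coefXn ltn_eqF // (leq_trans ld).
rewrite FE; case: i => [[|[|[|//]]] i3] /=.
- rewrite coefD lX ?addr0 ?leq_subr //; congr (t _)`_l; exact: val_inj.
- rewrite coefD lX ?addr0 //; congr (t _)`_l; exact: val_inj.
- rewrite !coefD !coefZ !lX ?leq_subr // !mulr0 !addr0; congr (t _)`_l; exact: val_inj.
Qed.

End GenericCurve.

(** The jets of [f] of order [d - 2] are realized by polynomials of degree at
    most [d] whose affine coordinate ring has its conductor at the cusp alone.
    These jets determine the values up to [2 * genus S + 1], hence the
    semigroup; and for suitable [m] all the values up to [m * d] are orders of
    combinations of products of [m] forms. *)
Lemma good_curve (K : numClosedFieldType) (a b c d : nat) (f : 'I_3 -> fps K) :
  let r := [tuple (a * b)%N; (a * c)%N; (b * c)%N] in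
  let S := value_semigroup f in
  (4 <= a)%N -> (a < b)%N -> (b < c)%N ->
  coprime a b -> coprime a c -> coprime b c ->
  (forall i, fps_val (f i) (tnth r i)) -> numerical_semigroup S ->
  (2 * genus S <= d)%N ->
  exists (F : 'M[K]_(4, d.+1)) m,
  [/\ (2 <= m)%N, F 0 0 != 0,
      forall i : 'I_3, pval (form F (lift ord0 i)) (tnth r i) &
      forall k, (k <= (m * d).+1)%N ->
        (cnt S k <= \rank (hilbert_mx F m *m (pid_mx k : 'M_((m * d).+1))))%N].
Proof.
move=> r S a4 ab bc cab cac cbc fr nS gd.
have gS : (a * b + a * c + b * c < genus S)%N := genus_lower_bound a4 ab bc cab cac nS fr.
have bc0 : (0 < b * c)%N by rewrite muln_gt0; lia.
have bcd : (b * c + 2 < d)%N by lia.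
have ab3 : (3 <= a * b)%N by apply: leq_trans (leq_pmulr _ _); lia.
have rbc i : (1 <= tnth r i <= b * c)%N.
  by rewrite (tnth_nth 0%N); case: i => [[|[|[|]]]] //= _; apply/andP; split; nia.
pose t i : {poly K} := \poly_(j < d - 1) f i j.
have [||||F [F1 Ft [e [m0 Fm0]]]] := @curve_with_jets K d _ t _ _ _.
- lia.
- lia.
- by move=> i; exact: size_poly.
- move=> i; rewrite horner_coef0 coef_poly; case: ifP => // _.
  by have [_ ->] := fr i; last by case/andP: (rbc i).
pose x (i : 'I_3) : fps K := fps_of_poly (form F (lift ord0 i)).
have xE (i : 'I_3) : fps_eq_upto (d - 2) (f i) (x i).
  by move=> l ld; have ld' : (l < d - 1)%N by [lia]; rewrite /x /= Ft // coef_poly ld'.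
have Fp (i : 'I_3) : pval (form F (lift ord0 i)) (tnth r i).
  have /andP[_ rb] := rbc i; have [fi f0] := fr i.
  have Fl l : (l <= tnth r i)%N -> (form F (lift ord0 i))`_l = f i l.
    by move=> lr; rewrite [RHS](xE i) //; lia.
  split=> [|l lr]; first by rewrite Fl //; exact/eqP.
  by rewrite Fl ?f0 // ltnW.
have xr i : fps_val (x i) (tnth r i) by apply/pval_fps; exact: Fp.
have xS : value_semigroup x = S.
  apply: semigroup_eq nS (@value_semigroupD _ _ _) _ => k kg.
  by apply: iff_sym; apply: (value_jets _ ab bc cab cac cbc fr xr xE); lia.
have [m m2 mP] := hilbert_leads_all F1 Fm0.
exists F, m; split; [exact: m2 | | exact: Fp | move=> k km].
  by rewrite -form_coef F1 coef1 oner_neq0.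
rewrite (rank_pid_leads _ km); apply: cnt_subset => l lk Sl; apply: mP.
  by rewrite -ltnS (leq_trans lk).
by rewrite -/x xS.
Qed.

(** * The open family of curves and its codimension *)

Section OpenCurves.
Variables (K : numClosedFieldType) (n d : nat) (r : n.-tuple nat) (S : set nat) (m : nat).
Hypothesis rd : forall i, (tnth r i <= d)%N.

Definition free_coord (k : 'I_n.+1 * 'I_d.+1) : bool :=
  if unlift ord0 k.1 is Some i then (tnth r i <= k.2)%N else true.

Definition free_coords : seq ('I_n.+1 * 'I_d.+1) :=
  [seq k <- enum [set: 'I_n.+1 * 'I_d.+1]%SET | free_coord k && (k != (0, 0))].

Lemma mem_free_coords k : (k \in (0, 0) :: free_coords) = free_coord k.
Proof.
rewrite inE mem_filter mem_enum finset.in_setT andbT.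
by case: eqVneq => [->|_]; rewrite ?andbT //= /free_coord /= unlift_none.
Qed.

Lemma free_coords_uniq : uniq ((0, 0) :: free_coords).
Proof. by rewrite /= filter_uniq ?enum_uniq // mem_filter eqxx andbF. Qed.

(** A form of order [r] at the cusp has [r] vanishing coefficients. *)
Lemma size_free_coords :
  (n.+1 * d.+1 <= (size free_coords).+1 + \sum_i tnth r i)%N.
Proof.
have -> : ((size free_coords).+1 = #|[pred k | free_coord k]|)%N.
  rewrite -[LHS]/(size ((0, 0) :: free_coords)) -(card_uniqP free_coords_uniq).
  by apply: eq_card => k; rewrite mem_free_coords inE.
have -> : (n.+1 * d.+1 = #|[pred k | free_coord k]| + #|[predC [pred k | free_coord k]]|)%N.
  by rewrite cardC card_prod !card_ord.
rewrite leq_add2l -sum1_card big_mkcond /=.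
rewrite (eq_bigr (fun k : 'I_n.+1 * 'I_d.+1 => nat_of_bool (~~ free_coord k))) => [|k _]; last first.
  by rewrite !inE; case: free_coord.
rewrite -(pair_bigA _ (fun i j => nat_of_bool (~~ free_coord (i, j)))) /= big_ord_recl.
rewrite big1 => [|j _]; last by rewrite /free_coord /= unlift_none.
rewrite add0n; apply: leq_sum => i _; rewrite /free_coord /=.
under eq_bigr => j _ do rewrite liftK -ltnNge.
have := @sum_ltn_bound d.+1 1 0 (tnth r i) isT; rewrite mul1n subn0 subnn mul0n addn0.
by apply: leq_trans; apply: leq_sum => j _; rewrite muln1 addn0.
Qed.

Definition profile_space : set 'M[K]_(n.+1, d.+1) :=
  @coord_space K n.+1 d.+1 (0, 0) free_coords.

(** The rank of a truncation counts the orders below [k] of the combinations of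
    products of [m] forms: there must be as many as elements of [S]. *)
Definition open_curves : set 'M[K]_(n.+1, d.+1) :=
  [set F | [/\ profile_space F, F 0 0 != 0,
     forall i, F (lift ord0 i) (Ordinal (rd i : (tnth r i < d.+1)%N)) != 0 &
     forall k : 'I_(m * d).+2,
       (cnt S k <= \rank (hilbert_mx F m *m (pid_mx k : 'M_((m * d).+1))))%N]].

Lemma coord_space_pval F : profile_space F ->
  (forall i, F (lift ord0 i) (Ordinal (rd i : (tnth r i < d.+1)%N)) != 0) <->
  (forall i, pval (form F (lift ord0 i)) (tnth r i)).
Proof.
move=> F0; split=> [Fr i|Fr i]; last first.
  by rewrite -form_coef; case: (Fr i).
split=> [|j jr].
  by rewrite -[tnth r i]/(val (Ordinal (rd i : (tnth r i < d.+1)%N))) form_coef.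
have jd : (j < d.+1)%N by rewrite (leq_trans jr) // ltnW // ltnS.
rewrite -[j]/(val (Ordinal jd)) form_coef; apply: (F0 (lift ord0 i, Ordinal jd)).
by rewrite mem_free_coords /free_coord /= liftK -ltnNge.
Qed.

Lemma coord_space_line (F G : 'M[K]_(n.+1, d.+1)) x : profile_space F ->
  profile_space G -> profile_space (F + x *: G).
Proof. by move=> F0 G0 k kf; rewrite !mxE F0 // G0 // mulr0 addr0. Qed.

Lemma open_curves_open F G : open_curves F -> profile_space F ->
  profile_space G -> cofin (fun x => open_curves (F + x *: G)).
Proof.
move=> [_ F00 Fr rankF] F0 G0.
have entry i j : F i j != 0 -> cofin (fun x => (F + x *: G) i j != 0).
  move=> Fij; have := @cofin_affine _ (F i j) (G i j); rewrite Fij => /(_ isT).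
  by apply: cofinW => x; rewrite !mxE.
have rank (k : 'I_(m * d).+2) : cofin (fun x => (cnt S k <=
    \rank (hilbert_mx (F + x *: G) m *m (pid_mx k : 'M_((m * d).+1))))%N).
  pose FG : 'M[{poly K}]_(n.+1, d.+1) := map_mx polyC F + 'X *: map_mx polyC G.
  pose M := hilbert_mx FG m *m (pid_mx k : 'M_((m * d).+1)).
  have ME x : map_mx (horner_eval x) M =
      hilbert_mx (F + x *: G) m *m (pid_mx k : 'M_((m * d).+1)).
    rewrite map_mxM map_pid_mx map_hilbert_mx; congr (hilbert_mx _ _ *m _).
    apply/matrixP => i j; rewrite !mxE -[LHS]/(horner_eval x _) /horner_eval.
    by rewrite !hornerE.
  have := rank_open M 0; apply: cofinW => x; rewrite !ME scale0r addr0.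
  exact: leq_trans (rankF k).
have := cofin_and (entry _ _ F00) (cofin_and (cofin_fin (fun i => entry _ _ (Fr i))) (cofin_fin rank)).
by apply: cofinW => x [? [? ?]]; split=> //; exact: coord_space_line.
Qed.

End OpenCurves.

Lemma morphisms_neq0 (K : fieldType) n d : @morphisms K n d `<=` [set F | F != 0].
Proof.
move=> F Fm; apply/eqP => F0; have p0 : pt 0 1 != 0 :> 'cV[K]_2.
  by apply/eqP => /(congr1 (fun w : 'cV[K]_2 => w 1 0)) /eqP; rewrite !mxE /= oner_eq0.
by have := Fm _ p0; rewrite F0 /mor_eval mul0mx eqxx.
Qed.

Theorem theorem3p8 (R : realType) (a b c d : nat) (S : set nat) :
  let r := [tuple (a * b)%N; (a * c)%N; (b * c)%N] in
  (2 <= a)%N -> (a < b)%N -> (b < c)%N ->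
  coprime a b -> coprime a c -> coprime b c ->
  generic_semigroup R[i]%C r S ->
  (2 * genus S <= d)%N ->
  (4 <= a)%N ->
  excess_dimensional R[i]%C d (genus S) S r.
Proof.
move=> r _ ab bc cab cac cbc [f fgen SE] gd a4.
have fr := fgen.1.
have r0 i : (2 <= tnth r i <= b * c)%N.
  by rewrite (tnth_nth 0%N); case: i => [[|[|[|]]]] //= _; apply/andP; split; nia.
have gen i : S (tnth r i) by rewrite SE; apply: value_semigroup_gen (fr i).
have nS : numerical_semigroup S.
  have Sab : S (a * b)%N := gen ord0.
  have Sac : S (a * c)%N := gen (lift ord0 ord0).
  have Sbc : S (b * c)%N := gen (lift ord0 (lift ord0 ord0)).
  apply: (semigroup_cofinite _ _ Sab Sac Sbc) => //; try lia.
    by rewrite SE; exact: value_semigroup0.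
  by rewrite SE => x y; exact: value_semigroupD.
have gS : (a * b + a * c + b * c < genus S)%N.
  by rewrite SE; apply: genus_lower_bound => //; rewrite -SE.
have [F0 [m [m2 F00 F0r rankF]]] : exists (F : 'M[R[i]%C]_(4, d.+1)) m,
  [/\ (2 <= m)%N, F 0 0 != 0,
      forall i : 'I_3, pval (form F (lift ord0 i)) (tnth r i) &
      forall k, (k <= (m * d).+1)%N ->
        (cnt S k <= \rank (hilbert_mx F m *m (pid_mx k : 'M_((m * d).+1))))%N].
  by rewrite SE; apply: good_curve; rewrite -?SE.
have rd i : (tnth r i <= d)%N by have /andP[_] := r0 i; lia.
pose O : set 'M[R[i]%C]_(4, d.+1) := open_curves S m rd.
have OX : O `<=` @severi R[i]%C 3 d (genus S) S r.
  move=> F [FU F_00 Fr rankk]; have [x xF] := affine_coordinates F_00.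
  have d0 : (0 < d)%N by lia.
  have r2 i : (2 <= tnth r i)%N by have /andP[] := r0 i.
  have Smax (y : 'I_3 -> fps R[i]%C) : (forall i, fps_val (y i) (tnth r i)) ->
      forall k, (cnt (value_semigroup y) k <= cnt S k)%N.
    move=> yr k; rewrite SE; apply: cnt_value_semigroup_generic fgen yr => l.
    exact: ltnW (r2 l).
  have rankF' k : (k <= (m * d).+1)%N ->
      (cnt S k <= \rank (hilbert_mx F m *m (pid_mx k : 'M_((m * d).+1))))%N.
    by move=> km; exact: (rankk (Ordinal (km : (k < (m * d).+2)%N))).
  have sr : sorted ltn r by rewrite /= !ltn_pmul2l ?ltn_pmul2r ?bc ?ab //; lia.
  have Fp := (coord_space_pval rd FU).1 Fr.
  exact: (severi_cusp nS gd d0 m2 r2 Smax F_00 Fp rankF' xF sr).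
have UF0 : profile_space r F0.
  move=> [i j]; rewrite mem_free_coords /free_coord /=.
  case: unliftP => // l -> ; rewrite -ltnNge => jr.
  by rewrite -form_coef; have [_ ->] := F0r l.
have OF0 : O F0.
  by split=> // [|k]; [exact/coord_space_pval | apply: rankF; rewrite -ltnS].
have chain := zchain_open OX OF0 UF0 F00 (free_coords_uniq d r) (@open_curves_open _ _ _ _ S m rd).
have SX : @severi R[i]%C 3 d (genus S) S r `<=` @morphisms R[i]%C 3 d.
  by move=> F [_ _ _ Fm _]; exact: Fm.
have mn0 : (0 < 4 * d.+1)%N by rewrite muln_gt0.
have [c' cP cl] := zcodim_le mn0 (@morphisms_neq0 R[i]%C 3 d) SX chain.
exists c' => //; have := size_free_coords d r.
rewrite !big_ord_recl big_ord0 !(tnth_nth 0%N) /=.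
by move: cl gS; rewrite mul1n; lia.
Qed.
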